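(* Let $d\ge1$ and let $X$ be the subordinate random walk in $\mathbb{Z}^d$ associated with a complete Bernstein function $\phi$ (with $\phi(1)=1$). Assume there exist $0<\gamma_1\le\gamma_2<1$ with $\gamma_2<d/2$ and $a_1,a_2>0$ such that $$a_1\Big(\frac Rr\Big)^{\gamma_1}\le\frac{\phi(R)}{\phi(r)}\le a_2\Big(\frac Rr\Big)^{\gamma_2}\quad\text{for all } 0<r\le R\le1.$$ Then there exist constants $C_6,C_7>0$ and $b_1,b_2\in(0,\tfrac12)$ with $2b_1\le b_2$ such that for every $n\in\mathbb{N}$ $$C_6n^{-d}\,\mathbb{E}_y[\tau_{B_n}]\le G_{B_n}(x,y)\le C_7n^{-d}\,\mathbb{E}_y[\tau_{B_n}]\quad\text{for all } x\in B_{b_1n},\ y\in A(b_2n,n).$$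
   Context: A complete Bernstein function here is $\phi(\lambda)=\int_{(0,\infty)}(1-e^{-\lambda t})\,\mu(dt)$, $\lambda>0$, where $\int_{(0,\infty)}(1\wedge t)\,\mu(dt)<\infty$ and $\mu$ has a completely monotone density with respect to Lebesgue measure; it is normalized by $\phi(1)=1$. Subordinate random walk: let $Z=(Z_n)_{n\ge0}$ be the simple symmetric random walk in $\mathbb{Z}^d$ started at the origin (each step is $\pm e_i$ with probability $1/(2d)$). For $m\in\mathbb{N}$ put $c_m^\phi=\int_{(0,\infty)}\frac{t^m}{m!}e^{-t}\mu(dt)$; then $\sum_{m\ge1}c_m^\phi=\phi(1)=1$. Let $(R_k)_{k\ge1}$ be i.i.d., independent of $Z$, with $\mathbb{P}(R_k=m)=c_m^\phi$, $m\in\mathbb{N}$; set $T_n=\sum_{k=1}^nR_k$ (with $T_0=0$) and $X_n=Z_{T_n}$. $\mathbb{P}_x,\mathbb{E}_x$ refer to the walk started at $x\in\mathbb{Z}^d$. For $r>0$, $B_r=\{y\in\mathbb{Z}^d:|y|<r\}$, and for $0<r<s$, $A(r,s)=\{y\in\mathbb{Z}^d:r\le|y|<s\}$ ($|\cdot|$ Euclidean norm). For $B\subset\mathbb{Z}^d$, $\tau_B=\inf\{n\ge1:X_n\notin B\}$ and $G_B(x,y)=\mathbb{E}_x\big[\sum_{n=0}^{\tau_B-1}\mathbf{1}_{\{X_n=y\}}\big]$. *)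

(* Defs.v *)
From HB Require Import structures.
From mathcomp Require Import all_boot all_order all_algebra finmap.
From mathcomp Require Import all_classical all_reals all_analysis.

Set Implicit Arguments.
Unset Strict Implicit.
Unset Printing Implicit Defensive.

Import Order.TTheory GRing.Theory Num.Theory.
Import numFieldNormedType.Exports.

Local Open Scope classical_set_scope.
Local Open Scope ring_scope.

Section BernsteinFunctions.
Context {R : realType}.
Implicit Types (m phi : R -> R) (mu : {measure set (measurableTypeR R) -> \bar R}).

Definition completely_monotone m : Prop :=
  forall (n : nat) (t : R), 0 < t ->
    derivable (derive1n n m) t 1 /\ 0 <= (-1) ^+ n * derive1n n m t.

(* Measures on (0, oo) are represented by measures on R of which only the
   restriction to (0, oo) is ever used; likewise phi is only used on (0, oo). *)
Record complete_bernstein phi mu : Prop := CompleteBernstein {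
  cb_density : exists m, completely_monotone m /\
    forall A : set (measurableTypeR R), measurable A -> A `<=` `]0, +oo[ ->
      mu A = (\int[lebesgue_measure]_(t in A) (m t)%:E)%E;
  cb_levy : (\int[mu]_(t in `]0%R, +oo[) (Num.min 1 t)%:E < +oo)%E;
  cb_repr : forall l : R, 0 < l ->
    (phi l)%:E = (\int[mu]_(t in `]0%R, +oo[) (1 - expR (- (l * t)))%:E)%E
}.

Definition jump_weight mu (k : nat) : \bar R :=
  (\int[mu]_(t in `]0%R, +oo[) (t ^+ k / k`!%:R * expR (- t))%:E)%E.

End BernsteinFunctions.

(* The random variables below take values in countable sets equipped with the
   discrete sigma-algebra, so every subset of the target is measurable. *)
Section DiscreteProcesses.
Context {R : realType} {disp : measure_display} {Omega : measurableType disp}.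
Variable P : probability Omega R.

Definition discrete_process {V : Type} (Y : nat -> Omega -> V) : Prop :=
  forall (k : nat) (B : set V), measurable (Y k @^-1` B).

Definition mutually_independent {V : Type} (Y : nat -> Omega -> V) : Prop :=
  forall (J : {fset nat}) (B : nat -> set V),
    P (\bigcap_(k in [set` J]) (Y k @^-1` B k)) =
    (\prod_(k <- J) P (Y k @^-1` B k))%E.

Definition process_sigma_algebra {V : Type} (Y : nat -> Omega -> V) :
    set (set Omega) :=
  <<s [set A | exists (k : nat) (B : set V), A = Y k @^-1` B] >>.

Definition independent_processes {V W : Type}
    (Y : nat -> Omega -> V) (Y' : nat -> Omega -> W) : Prop :=
  forall A A' : set Omega,
    process_sigma_algebra Y A -> process_sigma_algebra Y' A' ->
    P (A `&` A') = (P A * P A')%E.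

End DiscreteProcesses.

Section SubordinateRandomWalk.
Context {R : realType} {disp : measure_display} {Omega : measurableType disp}.
Variable P : probability Omega R.
Variable d : nat.
Implicit Types (Z X : nat -> Omega -> 'rV[int]_d) (S : nat -> Omega -> nat).
Implicit Types (x y : 'rV[int]_d) (B : set 'rV[int]_d).

Record simple_random_walk Z : Prop := SimpleRandomWalk {
  srw_measurable : discrete_process Z;
  srw_start : forall w, Z 0%N w = 0;
  srw_indep : mutually_independent P (fun n w => Z n.+1 w - Z n w);
  srw_law : forall (n : nat) (i : 'I_d) (s : bool),
    P [set w | Z n.+1 w - Z n w = (-1) ^+ s *: delta_mx 0 i] =
    ((2 * d%:R)^-1)%:E
}.

(* S k is the (k+1)-st jump of the time change.  The law is prescribed on the
   positive integers only; these weights sum to phi 1 = 1, so S k > 0 a.s. *)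
Record time_jumps (mu : {measure set (measurableTypeR R) -> \bar R}) S : Prop :=
  TimeJumps {
    tj_measurable : discrete_process S;
    tj_indep : mutually_independent P S;
    tj_law : forall n k : nat, (0 < k)%N ->
      P [set w | S n w = k] = jump_weight mu k
  }.

Definition random_time S (n : nat) (w : Omega) : nat := (\sum_(k < n) S k w)%N.

(* The law of this process is that of the walk under P_x. *)
Definition subordinate_walk Z S x : nat -> Omega -> 'rV[int]_d :=
  fun n w => x + Z (random_time S n w) w.

(* The value is +oo if the process never leaves B. *)
Definition exit_time X B (w : Omega) : \bar R :=
  ereal_inf [set (n%:R)%:E | n in [set n : nat | (1 <= n)%N /\ ~ B (X n w)]].

Definition expected_exit_time X B : \bar R := (\int[P]_w exit_time X B w)%E.

Definition occupation_before_exit X B y : \bar R :=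
  (\int[P]_w \sum_(0 <= n <oo | n%:R%:E < exit_time X B w)
     ((X n w == y)%:R)%:E)%E.

Definition green_function Z S B x y : \bar R :=
  occupation_before_exit (subordinate_walk Z S x) B y.

End SubordinateRandomWalk.

Section LatticeSets.
Context {R : realType}.
Variable d : nat.

Definition euclidean_norm (y : 'rV[int]_d) : R :=
  Num.sqrt (\sum_(i < d) ((y 0 i)%:~R) ^+ 2).

Definition lattice_ball (r : R) : set 'rV[int]_d :=
  [set y | euclidean_norm y < r].

Definition lattice_annulus (r s : R) : set 'rV[int]_d :=
  [set y | r <= euclidean_norm y < s].

End LatticeSets.

(* Main.v *)
Require Import Defs.
From HB Require Import structures.
From mathcomp Require Import all_boot all_order all_algebra finmap.
From mathcomp Require Import all_classical all_reals all_analysis.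
From mathcomp Require Import measurable_realfun ring lra zify.

Set Implicit Arguments.
Unset Strict Implicit.
Unset Printing Implicit Defensive.

Import Order.TTheory GRing.Theory Num.Theory.
Import numFieldNormedType.Exports.

Local Open Scope classical_set_scope.
Local Open Scope ring_scope.

(** The subordinate walk started at [x] is a Markov chain with kernel
[J (y - x)], where [J u] is the average of the simple random walk kernel
[p_m u] over the jump law [c_m] ([alive_prob]).  Hence both sides of the claim
are sums of powers of the kernel restricted to the ball: the Green function
[G x y] is the sum over [k] of the [k]-th powers at [(x, y)], and
[eta y = E_y tau] is the sum of [G y z] over [z] in the ball.  What remains is
an inequality between [h = G x] and [n ^- d * eta] on an annulus, and it is
proved by comparison.

Scales.  Averaging the Poisson generating function over the Levy measure gives
[\sum_m c_m (1 - (1 - l) ^+ m) = phi l] ([jump_weight_laplace]), so [phi l] is,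
up to a factor 2, the expectation of [min 1 (l m)] under the jump law.  With
[l = n ^- 2] this shows that [rate n = phi (n ^- 2)] is the order of the
probability that one step of the subordinate walk is of length [n] or more.
The upper scaling exponent being less than 1, a fixed fraction of this
probability comes from times of order at least [n ^ 2] ([long_jumps]), and the
lower exponent being positive, from times of order exactly [n ^ 2]
([jumps_window]).

Kernel estimates.  The simple random walk satisfies [p_m z <= C n ^- d] for
[m >= n ^ 2], [p_m z <= C n ^- d min 1 (m / n ^ 2)] for [|z|] at least of order
[n], and [p_m + p_(m+1) >= c n ^- d] for [|z| <= 2 n] and [m] of order [n ^ 2]
([srw_upper], [srw_far], [srw_lower]).  The proofs use no Fourier analysis.
The gap [p_2m 0 - p_2m u] is half the squared distance in [l2] between [p_m] and
its translate by [u], so it grows at most quadratically along a path;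
averaging over a box yields a Nash inequality, and convexity of the return
probabilities turns it into the on-diagonal bounds.  Exponential moments give
the off-diagonal ones.  Averaging over the jump law, [J] is at most of order
[n ^- d * rate n] at distance of order [n] ([jump_far]); so is it at least, once
its composition with one step of the simple walk is added to remove the parity
obstruction ([jump_near]).

Comparison.  Symmetry of [J] makes [h] harmonic away from [x], while
[J eta = eta - 1] in the ball.  For the upper bound, remove from [h] its
values near [x].  In the annulus [|w| >= 0.3 n] the truncated function fails to
be subharmonic by at most [C n ^- d * rate n] times the total mass [eta x] of
[h], that is, by at most [C n ^- d], which a multiple of [n ^- d * eta] absorbs.
Inside [|w| < 0.3 n] the truncated function is at most [C n ^- d / rate n]
([green_off]), hence at most a multiple of a bump function supported in
[|w| < 0.4 n], on which the generator is at most of order [rate n], so that the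
bump costs again a multiple of [n ^- d * eta].  The maximum principle in the
annulus, where the bump has disappeared from [|y| >= 0.4 n] on, concludes
([green_upper_ball]).  The lower bound reverses the signs
([green_lower_ball]): the part of [h] near [x] has mass at least of order
[1 / rate n] ([green_core_mass]), and jumps from there to anywhere in the
annulus have probability at least of order [n ^- d * rate n], up to one unit
step, which costs the factor [c 1 > 0]; this source dominates a multiple of
[n ^- d].  Small radii are settled by following a single path ([green_path]).

The bound [green_off] is where [gamma2 < d / 2] enters.  At distance of order
[n], [p_m] is dominated by geometric sequences [(1 - l_i) ^+ m] with
[l_i = 4 ^- i * n ^- 2 / 2] and weights [C n ^- d * 2 ^- (i d)].  Subordination
turns the [k]-fold convolution of a geometric sequence into
[(1 - phi l_i) ^+ k], so that summing over [k] bounds the Green function by the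
sum of [C n ^- d * 2 ^- (i d) / phi l_i], a convergent geometric series. *)

(** * Simple random walk: transition operator and kernel *)

Section WalkKernel.
Context {R : realType} {d : nat}.
Hypothesis d_gt0 : (0 < d)%N.
Local Notation pt := ('rV[int]_d).
Implicit Types (f g : pt -> R) (u v w x y z : pt) (m l k : nat) (s : seq pt).

Definition step (e : 'I_d * bool) : pt := (-1) ^+ e.2 *: delta_mx 0 e.1.

Definition avg (f : 'I_d * bool -> R) : R := (2 * d%:R)^-1 * \sum_e f e.

(** The walk runs over finitely many paths of given length, so expectations at
a fixed time need no measure theory; recursion on the first step keeps every
identity below an induction on time. *)
Fixpoint Ex m f : R :=
  if m is m'.+1 then avg (fun e => Ex m' (fun x => f (x + step e))) else f 0.

Definition srw m u : R := Ex m (fun x => (x == u)%:R).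

Let two_d_gt0 : 0 < 2 * d%:R :> R.
Proof. by rewrite mulr_gt0 // ltr0n. Qed.

Lemma avg_cst (c : R) : avg (fun=> c) = c.
Proof.
rewrite /avg sumr_const card_prod card_ord card_bool -[c *+ _]mulr_natr natrM.
by rewrite mulrCA [d%:R * _]mulrC mulVf ?mulr1 // gt_eqF.
Qed.

Lemma eq_avg h1 h2 : h1 =1 h2 -> avg h1 = avg h2.
Proof. by move=> e12; congr (_ * _); apply: eq_bigr. Qed.

Lemma ler_avg (h1 h2 : 'I_d * bool -> R) :
  (forall e, h1 e <= h2 e) -> avg h1 <= avg h2.
Proof. by move=> le12; rewrite ler_pM2l ?invr_gt0 //; apply: ler_sum. Qed.

Lemma avgD (h1 h2 : 'I_d * bool -> R) :
  avg (fun e => h1 e + h2 e) = avg h1 + avg h2.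
Proof. by rewrite /avg big_split mulrDr. Qed.

Lemma avgZ (c : R) (h1 : 'I_d * bool -> R) :
  avg (fun e => c * h1 e) = c * avg h1.
Proof. by rewrite /avg -mulr_sumr mulrCA. Qed.

Lemma eq_Ex m f g : f =1 g -> Ex m f = Ex m g.
Proof. by move=> /funext ->. Qed.

Lemma ExD m f g : Ex m (fun x => f x + g x) = Ex m f + Ex m g.
Proof.
elim: m f g => //= m IH f g.
by rewrite -avgD; apply: eq_avg => e; rewrite IH.
Qed.

Lemma ExZ m (c : R) f : Ex m (fun x => c * f x) = c * Ex m f.
Proof.
elim: m f => //= m IH f.
by rewrite -avgZ; apply: eq_avg => e; rewrite IH.
Qed.

Lemma Ex_cst m (c : R) : Ex m (fun=> c) = c.
Proof.
elim: m => //= m IH.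
by rewrite -[RHS]avg_cst; apply: eq_avg => e; rewrite IH.
Qed.

Lemma Ex_sum m (I : Type) (r : seq I) (F : I -> pt -> R) :
  Ex m (fun x => \sum_(i <- r) F i x) = \sum_(i <- r) Ex m (F i).
Proof.
elim: r => [|i r IH].
  by rewrite big_nil -[RHS](Ex_cst m); apply: eq_Ex => x; rewrite big_nil.
by rewrite big_cons -IH -ExD; apply: eq_Ex => x; rewrite big_cons.
Qed.

Lemma ler_Ex m f g : (forall x, f x <= g x) -> Ex m f <= Ex m g.
Proof.
elim: m f g => //= m IH f g fg.
by apply: ler_avg => e; apply: IH.
Qed.

Lemma Ex_ge0 m f : (forall x, 0 <= f x) -> 0 <= Ex m f.
Proof. by move=> f0; rewrite -(Ex_cst m 0); apply: ler_Ex. Qed.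

Lemma Ex_avg m (F : 'I_d * bool -> pt -> R) :
  Ex m (fun x => avg (F^~ x)) = avg (fun e => Ex m (F e)).
Proof. by rewrite /avg ExZ Ex_sum. Qed.

Lemma Ex_add m l f : Ex (m + l) f = Ex m (fun x => Ex l (fun y => f (x + y))).
Proof.
elim: m f => [|m IH] f.
  by rewrite add0n /=; apply: eq_Ex => y; rewrite add0r.
rewrite addSn /=; apply: eq_avg => e; rewrite IH.
by apply: eq_Ex => x; apply: eq_Ex => y; rewrite addrAC.
Qed.

Lemma Ex_exchange m l (F : pt -> pt -> R) :
  Ex m (fun x => Ex l (F x)) = Ex l (fun y => Ex m (F^~ y)).
Proof.
elim: m F => [//|m IH] F /=.
by rewrite Ex_avg; apply: eq_avg => e; rewrite IH.
Qed.

Lemma stepN e : step (e.1, ~~ e.2) = - step e.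
Proof. by case: e => i [] /=; rewrite /step /= ?expr1 ?expr0 ?scaleN1r ?scale1r ?opprK. Qed.

Lemma avg_opp (h1 : 'I_d * bool -> R) : avg (fun e => h1 (e.1, ~~ e.2)) = avg h1.
Proof.
rewrite /avg; congr (_ * _).
have inv : involutive (fun e : 'I_d * bool => (e.1, ~~ e.2)).
  by move=> [i b] /=; rewrite negbK.
by rewrite [RHS](reindex_inj (inv_inj inv)).
Qed.

Lemma Ex_opp m f : Ex m (fun x => f (- x)) = Ex m f.
Proof.
elim: m f => [|m IH] f /=; first by rewrite oppr0.
rewrite -[LHS]avg_opp; apply: eq_avg => e; rewrite -(IH (fun x => f (x + step e))).
by apply: eq_Ex => x; rewrite stepN opprB addrC.
Qed.

Lemma srw0 u : srw 0 u = (u == 0)%:R.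
Proof. by rewrite /srw /= eq_sym. Qed.

Lemma srwS m u : srw m.+1 u = avg (fun e => srw m (u - step e)).
Proof.
rewrite /srw /=; apply: eq_avg => e; apply: eq_Ex => x.
by rewrite eq_sym -subr_eq eq_sym.
Qed.

Lemma srw_ge0 m u : 0 <= srw m u.
Proof. by apply: Ex_ge0 => x; rewrite ler0n. Qed.

Lemma srw_le1 m u : srw m u <= 1.
Proof. by rewrite -(Ex_cst m 1); apply: ler_Ex => x; rewrite lern1 leq_b1. Qed.

Lemma srwN m u : srw m (- u) = srw m u.
Proof.
rewrite /srw -[RHS]Ex_opp; apply: eq_Ex => x.
by rewrite -(inj_eq (@oppr_inj _)) opprK.
Qed.

Lemma srwE m w z : Ex m (fun x => (w + x == z)%:R) = srw m (z - w).
Proof. by apply: eq_Ex => x; rewrite [in RHS]eq_sym subr_eq [in RHS]eq_sym addrC. Qed.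

(** A function supported in a finite set is a combination of point indicators,
so its expectation is the corresponding combination of transition
probabilities. *)
Lemma Ex_supp m s f w : uniq s -> (forall x, x \notin s -> f x = 0) ->
  Ex m (fun u => f (w + u)) = \sum_(z <- s) f z * srw m (z - w).
Proof.
move=> us fs; transitivity (Ex m (fun u => \sum_(z <- s) f z * (w + u == z)%:R)).
  apply: eq_Ex => u; have [ins|nins] := boolP (w + u \in s); last first.
    rewrite fs // big1 // => z _; case: eqP => [wz|]; last by rewrite mulr0.
    by rewrite mulr1 -wz fs.
  by rewrite (bigD1_seq _ ins us) /= eqxx mulr1 big1 ?addr0 // => z;
    rewrite eq_sym => /negbTE ->; rewrite mulr0.
by rewrite Ex_sum; apply: eq_bigr => z _; rewrite ExZ srwE.
Qed.

(** Truncating the state space to a finite set can only lose mass. *)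
Lemma Ex_supp_le m s f w : uniq s -> (forall x, 0 <= f x) ->
  \sum_(z <- s) f z * srw m (z - w) <= Ex m (fun u => f (w + u)).
Proof.
move=> us f0.
pose g x := f x * (x \in s)%:R.
have -> : \sum_(z <- s) f z * srw m (z - w) = \sum_(z <- s) g z * srw m (z - w).
  by rewrite !big_seq; apply: eq_bigr => z zs; rewrite /g zs mulr1.
rewrite -(@Ex_supp _ _ g) //; last by move=> x /negbTE xs; rewrite /g xs mulr0.
by apply: ler_Ex => x; rewrite /g; case: (_ \in _); rewrite ?mulr1 // mulr0.
Qed.

Lemma srw_add m l z : srw (m + l) z = Ex m (fun x => srw l (z - x)).
Proof. by rewrite /srw Ex_add; apply: eq_Ex => x; rewrite srwE. Qed.

Lemma srw_conv_le m l s y : uniq s ->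
  \sum_(z <- s) srw m z * srw l (y - z) <= srw (m + l) y.
Proof.
move=> us; have := @Ex_supp_le m s (fun z => srw l (y - z)) 0 us (fun=> srw_ge0 _ _).
rewrite (eq_Ex _ (g := fun x => srw l (y - x))) ?srw_add //; last by move=> x; rewrite add0r.
by under eq_bigr do rewrite subr0 mulrC.
Qed.

Lemma sum_srw_le1 m s w : uniq s -> \sum_(z <- s) srw m (z - w) <= 1.
Proof.
move=> us; have := @Ex_supp_le m s (fun=> 1) w us (fun=> ler01).
by rewrite Ex_cst; under eq_bigr do rewrite mul1r.
Qed.

Lemma srw_supp m : exists s : seq pt, forall u, srw m u != 0 -> u \in s.
Proof.
elim: m => [|m [s IH]].
  by exists [:: 0] => u; rewrite srw0 inE; case: (u == 0) => /=; rewrite ?eqxx.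
exists [seq x + step e | x <- s, e <- enum {: 'I_d * bool}] => u.
rewrite srwS => nz; case: (pselect (exists e, srw m (u - step e) != 0)).
  move=> [e /IH us]; rewrite -(subrK (step e) u); apply: allpairs_f => //.
  by rewrite mem_enum.
move=> /forallNP H; move: nz; rewrite (eq_avg (h2 := fun=> 0)) ?avg_cst ?eqxx //.
by move=> e; have /negP := H e; rewrite negbK => /eqP.
Qed.

End WalkKernel.

(** * Lattice boxes and shortest paths *)

Section LatticeBox.
Context {d : nat}.
Local Notation pt := ('rV[int]_d).
Implicit Types (u x : pt) (e : 'I_d * bool).

Definition box (r : nat) : seq pt :=
  [seq \row_i ((nat_of_ord (f i))%:Z - r%:Z) | f : {ffun 'I_d -> 'I_(2 * r).+1}].

Lemma box_uniq r : uniq (box r).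
Proof.
rewrite map_inj_uniq ?enum_uniq // => f g /rowP fg.
apply/ffunP => i; have := fg i; rewrite !mxE => /addIr [] /eqP.
by move=> /eqP /val_inj.
Qed.

Lemma size_box r : size (box r) = ((2 * r).+1 ^ d)%N.
Proof. by rewrite size_map -cardE card_ffun !card_ord. Qed.

Lemma mem_box r (x : pt) : reflect (forall i, (`|x 0%R i| <= r)%N) (x \in box r).
Proof.
apply: (iffP mapP) => [[f _ ->] i|xr].
  rewrite mxE; have := ltn_ord (f i); rewrite ltnS; move: (nat_of_ord (f i)) => a ?; lia.
have H i : (`|(x 0 i + r%:Z)%R| < (2 * r).+1)%N by have := xr i; lia.
exists [ffun i => Ordinal (H i)]; first by rewrite mem_enum.
apply/rowP => i; rewrite mxE ffunE /=.
by have := xr i; lia.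
Qed.

Definition l1 (u : pt) : nat := \sum_i `|u 0%R i|%N.

Lemma l1_eq0 u : l1 u = 0%N -> u = 0.
Proof.
move=> /eqP; rewrite /l1 sum_nat_eq0 => /forallP H; apply/rowP => i.
by rewrite mxE; apply/eqP; rewrite -absz_eq0; have := H i.
Qed.

(** Stepping towards the origin along a nonzero coordinate. *)
Lemma l1_step u : u != 0 -> exists e, (l1 (u - step e)%R).+1 = l1 u /\
  forall i, (`|(u - step e)%R 0%R i| <= `|u 0%R i|)%N.
Proof.
move=> u0; have [i ui] : exists i, u 0 i != 0.
  apply: contrapT => /forallNP H; move/eqP: u0; apply; apply/rowP => i.
  by rewrite mxE; have /negP := H i; rewrite negbK => /eqP.
have stepi b k : (u - step (i, b)) 0 k = u 0 k - (-1) ^+ b * (k == i)%:R.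
  by rewrite !mxE eqxx.
have [b bP] : exists b : bool, (`|(u 0%R i - (-1) ^+ b)%R|.+1 = `|u 0%R i|)%N.
  by case: (ltP (u 0 i) 0) => u1; [exists true|exists false];
    rewrite ?expr1 ?expr0; lia.
exists (i, b); split; last first.
  move=> k; rewrite stepi; case: eqP => [->|_]; last by rewrite mulr0 subr0.
  by rewrite mulr1; lia.
rewrite /l1 (bigD1 i) //= [in RHS](bigD1 i) //= stepi eqxx mulr1 -bP -addSn.
by congr (_ + _)%N; apply: eq_bigr => k ki; rewrite stepi (negbTE ki) mulr0 subr0.
Qed.

End LatticeBox.

(** * Return probabilities and regularity of the walk kernel *)

Section HeatKernel.
Context {R : realType} {d : nat}.
Hypothesis d_gt0 : (0 < d)%N.
Local Notation pt := ('rV[int]_d).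
Local Notation srw := (@srw R d).
Implicit Types (u v w x y z : pt) (m l k : nat) (s : seq pt).

(** A shortest path to [u] is one of the trajectories of the walk. *)
Lemma srw_path u : (2 * d%:R)^-1 ^+ l1 u <= srw (l1 u) u.
Proof.
move: {2}(l1 u) (erefl (l1 u)) => n; elim: n u => [|n IH] u lu.
  by rewrite lu (l1_eq0 lu) srw0 eqxx expr0.
have u0 : u != 0.
  by apply/eqP => u0; move: lu; rewrite u0 /l1 big1 // => i _; rewrite mxE.
have [e [eu _]] := l1_step u0.
rewrite -eu srwS exprS /avg ler_pM2l ?invr_gt0 ?mulr_gt0 ?ltr0n //.
rewrite (bigD1 e) //=; apply: le_trans (IH _ _) _; first by move: eu lu; lia.
by rewrite lerDl sumr_ge0 // => e' _; apply: srw_ge0.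
Qed.

Lemma cover_supp (us : seq (nat * pt)) : exists s, uniq s /\
  forall q, q \in us -> forall x, x \notin s -> srw q.1 (x + q.2) = 0.
Proof.
suff [s sP] : exists s, forall q, q \in us -> forall x, srw q.1 (x + q.2) != 0 -> x \in s.
  exists (undup s); split; first exact: undup_uniq.
  move=> q kus x; rewrite mem_undup => xs; apply/eqP/negP => /negP /sP.
  by move=> /(_ kus) xs'; rewrite xs' in xs.
elim: us => [|[m u] us [s IH]]; first by exists [::].
have [t tP] := @srw_supp R d d_gt0 m.
exists ([seq y - u | y <- t] ++ s) => q; rewrite inE => /orP[/eqP -> x /= nz|kus x nz].
  by rewrite mem_cat; apply/orP; left; apply/mapP; exists (x + u); rewrite ?tP ?addrK.
by rewrite mem_cat (IH _ kus) ?orbT.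
Qed.

(** Chapman-Kolmogorov, read as an inner product of two translated kernels. *)
Lemma srw_gram m l u v s : uniq s ->
  (forall x, x \notin s -> srw m (x + u) = 0) ->
  \sum_(x <- s) srw m (x + u) * srw l (x + v) = srw (l + m) (u - v).
Proof.
move=> us cov; have := @Ex_supp R d d_gt0 l s (fun z => srw m (z + u)) (- v) us cov.
under eq_bigr do rewrite opprK; move=> <-.
rewrite srw_add // -Ex_opp //; apply: eq_Ex => x.
by rewrite addrC addrA.
Qed.

(** Only even times are used: there the kernel is a squared norm in [l2], so it
is maximal at the origin and no parity obstruction occurs. *)
Definition ret m : R := srw (m + m) 0.
Definition gap m u : R := ret m - srw (m + m) u.

(** The gap is half the squared [l2] distance between two translates of the
kernel. *)
Lemma gapE m u v s : uniq s ->
  (forall x, x \notin s -> srw m (x + u) = 0) ->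
  (forall x, x \notin s -> srw m (x + v) = 0) ->
  \sum_(x <- s) (srw m (x + u) - srw m (x + v)) ^+ 2 = 2 * gap m (u - v).
Proof.
move=> us cu cv; rewrite /gap /ret.
have Huu := srw_gram m u us cu; have Huv := srw_gram m v us cu.
have Hvv := srw_gram m v us cv; rewrite subrr in Huu; rewrite subrr in Hvv.
transitivity (\sum_(x <- s) (srw m (x + u) * srw m (x + u) +
   (- 2 * (srw m (x + u) * srw m (x + v)) + srw m (x + v) * srw m (x + v)))).
  by apply: eq_bigr => x _; ring.
rewrite !big_split /= -mulr_sumr Huu Huv Hvv; ring.
Qed.

Lemma gap_ge0 m u : 0 <= gap m u.
Proof.
have [s [us cov]] := cover_supp [:: (m, u); (m, 0)].
have := gapE us (cov _ (mem_head _ _)) (cov _ (mem_last _ [:: _])).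
rewrite subr0 => H; rewrite -(@pmulr_rge0 _ 2) // -H.
by apply: sumr_ge0 => x _; apply: sqr_ge0.
Qed.

Lemma gap0 m : gap m 0 = 0.
Proof. by rewrite /gap subrr. Qed.

(** The quadratic inequality
[(a + b) ^+ 2 <= (1 + k^-1) * a ^+ 2 + (1 + k) * b ^+ 2], summed over the
lattice; these weights make the bounds of a path of length [k] add up to a square. *)
Lemma gapD m k u v : (0 < k)%N ->
  gap m (u + v) <= (1 + k%:R^-1) * gap m u + (1 + k%:R) * gap m v.
Proof.
move=> k0; have [s [us cov]] := cover_supp [:: (m, u + v); (m, v); (m, 0)].
have c1 := cov _ (mem_head _ _).
have c2 : forall x, x \notin s -> srw m (x + v) = 0.
  by apply: (cov (m, v)); rewrite !inE eqxx orbT.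
have c3 := cov _ (mem_last _ [:: _; _]).
have E1 := gapE us c1 c2; have E2 := gapE us c2 c3; have E3 := gapE us c1 c3.
rewrite addrK in E1; rewrite subr0 in E2; rewrite subr0 in E3.
rewrite -(@ler_pM2l _ 2) // -E3 mulrDr mulrCA -E1 mulrCA -E2 !mulr_sumr -big_split.
apply: ler_sum => x _ /=.
set a := srw m (x + (u + v)); set b := srw m (x + v); set c := srw m (x + 0).
have k0' : (0 : R) < k%:R by rewrite ltr0n.
set t : R := k%:R in k0' *.
have -> : (1 + t^-1) * (a - b) ^+ 2 + (1 + t) * (b - c) ^+ 2 =
  (a - c) ^+ 2 + t^-1 * ((a - b) - t * (b - c)) ^+ 2 by field; rewrite gt_eqF.
by rewrite lerDl mulr_ge0 ?sqr_ge0 // invr_ge0 ltW.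
Qed.

(** The gap behaves like a squared distance: it grows at most quadratically
along a path. *)
Lemma gap_walk m (D : R) (us : seq pt) : 0 <= D ->
  (forall u, u \in us -> gap m u <= D) ->
  gap m (\sum_(u <- us) u) <= (size us)%:R ^+ 2 * D.
Proof.
move=> D0; elim: us => [|u us IH] H; first by rewrite big_nil gap0 mulr_ge0 ?sqr_ge0.
have Hu := H u (mem_head _ _); have {}IH : gap m (\sum_(v <- us) v) <= (size us)%:R ^+ 2 * D.
  by apply: IH => v vus; apply: H; rewrite inE vus orbT.
rewrite big_cons addrC /=; have [us0|us0] := posnP (size us).
  by rewrite (size0nil us0) big_nil add0r expr1n mul1r.
apply: le_trans (gapD _ _ _ us0) _.
have k0' : (0 : R) < (size us)%:R by rewrite ltr0n.
have -> : (size us).+1%:R = (size us)%:R + 1 :> R by rewrite -natr1.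
set t : R := (size us)%:R in k0' IH *.
have -> : (t + 1) ^+ 2 * D = (1 + t^-1) * (t ^+ 2 * D) + (1 + t) * D.
  by field; rewrite gt_eqF.
by rewrite lerD // ler_pM2l // addr_gt0 // invr_gt0.
Qed.

Lemma ret_ge0 m : 0 <= ret m. Proof. exact: srw_ge0. Qed.

Lemma srw_le_ret m k z : (k + k <= m)%N -> srw m z <= ret k.
Proof.
move=> km; rewrite -(subnK km) srw_add // -[leRHS](Ex_cst d_gt0 (m - (k + k))).
by apply: ler_Ex => // x; rewrite -subr_ge0; apply: gap_ge0.
Qed.

Lemma ret_decr m k : (m <= k)%N -> ret k <= ret m.
Proof. by move=> mk; apply: srw_le_ret; rewrite leq_add. Qed.

(** Two further steps lead from the origin to [step e + step e'], which again
has even parity. *)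
Lemma ret_diff m :
  ret m - ret m.+1 = avg (fun e => avg (fun e' => gap m (step e + step e'))).
Proof.
rewrite /ret addSn addnS srwS; set RHS' := RHS.
have -> : srw (m + m) 0 = avg (fun e : 'I_d * bool => avg (fun e' : 'I_d * bool => srw (m + m) 0)).
  by rewrite !avg_cst.
rewrite -mulN1r -avgZ -avgD; apply: eq_avg => e.
rewrite mulN1r srwS -mulN1r -avgZ -avgD; apply: eq_avg => e'.
by rewrite mulN1r sub0r -opprD srwN.
Qed.

(** One of the [(2 * d) ^ 2] nonnegative terms of the average [ret_diff]. *)
Lemma gap_double m (e : 'I_d * bool) :
  gap m (step e + step e) <= (2 * d%:R) ^+ 2 * (ret m - ret m.+1).
Proof.
have d0 : (0 : R) < 2 * d%:R by rewrite mulr_gt0 // ltr0n.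
have avg_ge (f : 'I_d * bool -> R) e0 : (forall e, 0 <= f e) ->
    f e0 <= 2 * d%:R * avg f.
  move=> f0; rewrite /avg mulrA mulfV ?mul1r ?gt_eqF // (bigD1 e0) //= lerDl.
  by apply: sumr_ge0.
rewrite ret_diff expr2 -mulrA.
apply: le_trans (avg_ge (fun e' => gap m (step e + step e')) e _) _.
  by move=> e'; apply: gap_ge0.
rewrite ler_pM2l //; apply: (avg_ge (fun e => avg (fun e' => gap m (step e + step e')))) => e1.
by rewrite -(avg_cst d_gt0 0); apply: ler_avg => // e2; apply: gap_ge0.
Qed.

(** The second difference of [ret] is the squared [l2] distance between the
kernels at times [m] and [m + 2]. *)
Lemma ret_convex m : ret m.+1 - ret m.+2 <= ret m - ret m.+1.
Proof.
have [s [us cov]] := cover_supp [:: (m, 0 : pt); (m.+2, 0 : pt)].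
have c1 := cov _ (mem_head _ _); have c2 := cov _ (mem_last _ [:: _]).
have := srw_gram m 0 us c1; have := srw_gram m.+2 0 us c1; have := srw_gram m.+2 0 us c2.
rewrite /= subr0 => H1 H2 H3.
have : 0 <= \sum_(x <- s) (srw m (x + 0) - srw m.+2 (x + 0)) ^+ 2.
  by apply: sumr_ge0 => x _; apply: sqr_ge0.
have -> : \sum_(x <- s) (srw m (x + 0) - srw m.+2 (x + 0)) ^+ 2 =
  \sum_(x <- s) (srw m (x + 0) * srw m (x + 0) +
   (- 2 * (srw m (x + 0) * srw m.+2 (x + 0)) + srw m.+2 (x + 0) * srw m.+2 (x + 0))).
  by apply: eq_bigr => x _; ring.
rewrite !big_split /= -mulr_sumr H1 H2 H3 -!/(ret _).
have -> : srw (m.+2 + m) 0 = ret m.+1 by rewrite /ret addSn addnS.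
by rewrite /ret; lra.
Qed.

Lemma ret_diff_decr m k : (m <= k)%N -> ret k - ret k.+1 <= ret m - ret m.+1.
Proof.
move=> /subnK <-; elim: (k - m)%N => [//|l IH].
by rewrite addSn; apply: le_trans (ret_convex _) IH.
Qed.

(** A convex decreasing nonnegative sequence: [m] decrements, each at least the
one at [k], fit below [ret m]. *)
Lemma ret_diff_le m k : (m.*2 <= k)%N -> m%:R * (ret k - ret k.+1) <= ret m.
Proof.
move=> mk; apply: (@le_trans _ _ (ret m - ret (m + m))); last first.
  by rewrite gerBl ret_ge0.
have : forall l, (l <= m)%N -> l%:R * (ret k - ret k.+1) <= ret m - ret (m + l).
  elim=> [|l IH] lm; first by rewrite addn0 subrr mul0r.
  rewrite -natr1 mulrDl mul1r addnS.
  have := IH (ltnW lm); have : ret k - ret k.+1 <= ret (m + l) - ret (m + l).+1.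
    by apply: ret_diff_decr; lia.
  lra.
by apply.
Qed.

(** Reach [v + v] by doubled unit steps, of which there are at most [d * r]. *)
Lemma gap_box m v (r : nat) : (forall i, (`|v 0%R i| <= r)%N) ->
  gap m (v + v) <= (d * r)%:R ^+ 2 * ((2 * d%:R) ^+ 2 * (ret m - ret m.+1)).
Proof.
move=> vr; pose e i : 'I_d * bool := (i, v 0 i < 0).
pose us := flatten [seq nseq `|v 0%R i|%N (step (e i) + step (e i)) | i <- enum 'I_d].
have D0 : 0 <= (2 * d%:R) ^+ 2 * (ret m - ret m.+1).
  by rewrite mulr_ge0 ?sqr_ge0 // subr_ge0 ret_decr.
have -> : v + v = \sum_(u <- us) u.
  rewrite /us big_flatten /= big_map big_enum /=.
  rewrite {1 2}(row_sum_delta v) -big_split /=; apply: eq_bigr => i _.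
  rewrite big_nseq iter_addr_0 /step /e /=.
  rewrite -!scalerDl scalerMnl; congr (_ *: _); rewrite -mulr_natr natz.
  by case: ltP => vi; rewrite ?expr1 ?expr0; lia.
apply: le_trans (gap_walk (D := (2 * d%:R) ^+ 2 * (ret m - ret m.+1)) D0 _) _.
  move=> u /flattenP[_ /mapP[i _ ->]]; rewrite mem_nseq => /andP[_ /eqP ->].
  exact: gap_double.
apply: ler_wpM2r => //; rewrite lerXn2r ?nnegrE ?ler0n // ler_nat /us size_flatten.
rewrite /shape -map_comp sumnE big_map big_enum /=.
apply: (@leq_trans (\sum_(i < d) r)%N); last by rewrite sum_nat_const card_ord.
by apply: leq_sum => i _; rewrite size_nseq.
Qed.

End HeatKernel.

(** * On-diagonal upper bound and tails of the walk *)

Section HeatKernelBounds.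
Context {R : realType} {d : nat}.
Hypothesis d_gt0 : (0 < d)%N.
Local Notation pt := ('rV[int]_d).
Local Notation srw := (@srw R d).
Local Notation ret := (@ret R d).
Local Notation gap := (@gap R d).
Implicit Types (u v w x y z : pt) (m l k n r : nat).

(** Sum [ret m = srw (m + m) (v + v) + gap m (v + v)] over [v] in a box of side
[2 r + 1]: the first terms add up to at most 1, and [gap_box] bounds the
others.  Doubled vectors are used because the walk is at even sites at even
times. *)
Lemma nash m r : (0 < r)%N ->
  ret m <= r%:R ^- d + (4 * d ^ 4)%:R * r%:R ^+ 2 * (ret m - ret m.+1).
Proof.
move=> r0; set D := ret m - ret m.+1.
have D0 : 0 <= D by rewrite subr_ge0 ret_decr.
pose N : R := (2 * r).+1%:R ^+ d.
have N0 : 0 < N by rewrite exprn_gt0 ?ltr0n.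
have inj : injective (fun v : pt => v + v).
  have dbl (a b : int) : a + a = b + b -> a = b by lia.
  by move=> v w /rowP vw; apply/rowP => i; apply: dbl; have := vw i; rewrite !mxE.
have H : N * ret m <= 1 + N * ((d * r)%:R ^+ 2 * ((2 * d%:R) ^+ 2 * D)).
  have sumc (c : R) : \sum_(v <- @box d r) c = N * c.
    by rewrite big_const_seq count_predT size_box iter_addr_0 -mulr_natl natrX.
  rewrite -!sumc; apply: (@le_trans _ _ (\sum_(v <- @box d r) (srw (m + m) (v + v) + gap m (v + v)))).
    by apply: ler_sum => v _; rewrite /gap addrC subrK.
  rewrite big_split /= lerD //.
    have := @sum_srw_le1 R d d_gt0 (m + m) [seq v + v | v <- box r] 0.
    rewrite map_inj_uniq // box_uniq big_map => /(_ isT).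
    by under eq_bigr do rewrite subr0.
  rewrite !big_seq; apply: ler_sum => v /mem_box vr.
  exact: gap_box.
have -> : (4 * d ^ 4)%:R * r%:R ^+ 2 * D = (d * r)%:R ^+ 2 * ((2 * d%:R) ^+ 2 * D).
  by rewrite [(d * r)%:R]natrM [(4 * d ^ 4)%:R]natrM natrX; ring.
apply: (@le_trans _ _ (N^-1 + (d * r)%:R ^+ 2 * ((2 * d%:R) ^+ 2 * D))).
  by rewrite -(ler_pM2l N0) mulrDr mulfV ?gt_eqF.
rewrite lerD2r /N lef_pV2 ?posrE ?exprn_gt0 ?ltr0n //.
by rewrite lerXn2r ?nnegrE ?ler0n // ler_nat; lia.
Qed.

(** Convexity bounds the decrement in the Nash inequality by the return
probability at half the time, so that the bound improves by a factor [2 ^- d]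
from one dyadic scale to the next. *)
Lemma ret_dyadic : exists2 K, (0 < K)%N &
  forall j, ret (K * 4 ^ j)%N <= 2 ^+ d.+1 * (2 ^- d) ^+ j.
Proof.
(* With this factor the Nash coefficient at radius [2 ^ j] is [2 ^- d.+1] times
   the time [k = K * 4 ^ j]. *)
exists (4 * d ^ 4 * 2 ^ d.+1)%N; first by rewrite !muln_gt0 !expn_gt0 d_gt0.
set K := (_ * 2 ^ d.+1)%N; elim=> [|j IH].
  rewrite muln1 expr0 mulr1; apply: le_trans (srw_le1 _ _ _) _ => //.
  by rewrite exprn_ege1 // ler1n.
set k := (K * 4 ^ j)%N in IH *.
have k0 : (0 < k)%N by rewrite !muln_gt0 !expn_gt0 d_gt0.
apply: (@le_trans _ _ (ret k.*2)).
  by apply: ret_decr => //; rewrite expnS /k mulnCA -mul2n leq_mul2r orbT.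
have := @nash k.*2 (2 ^ j) ltac:(by rewrite expn_gt0).
have := @ret_diff_le R d d_gt0 k k.*2 (leqnn _).
set D := ret _ - _; move: (ret k.*2) => b HD Hn; apply: (le_trans Hn).
have -> : (4 * d ^ 4)%:R * (2 ^ j)%:R ^+ 2 * D = 2 ^- d.+1 * (k%:R * D).
  have kE : k%:R = (4 * d ^ 4)%:R * 2 ^+ d.+1 * (2 ^ j)%:R ^+ 2 :> R.
    by rewrite /k /K !natrM !natrX -exprM mulnC exprM -[2 ^+ 2](natrX _ 2 2).
  rewrite kE; set a : R := (4 * _)%:R; set b2 : R := 2 ^+ d.+1; set c : R := _ ^+ 2.
  by field; rewrite expf_neq0 // pnatr_eq0.
have -> : (2 ^ j)%:R ^- d = (2 ^- d) ^+ j :> R.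
  by rewrite natrX exprVn -!exprM mulnC.
have q0 : 0 <= (2 ^- d) ^+ j :> R by rewrite exprn_ge0 // invr_ge0 exprn_ge0.
have {}HD : 2 ^- d.+1 * (k%:R * D) <= (2 ^- d) ^+ j.
  apply: (@le_trans _ _ (2 ^- d.+1 * (2 ^+ d.+1 * (2 ^- d) ^+ j))).
    by rewrite ler_pM2l ?invr_gt0 ?exprn_gt0 // (le_trans HD).
  by rewrite mulKf // expf_neq0 // pnatr_eq0.
have -> : 2 ^+ d.+1 * (2 ^- d) ^+ j.+1 = (2 ^- d) ^+ j + (2 ^- d) ^+ j :> R.
  rewrite [(2 ^- d) ^+ j.+1]exprS exprS; set q : R := _ ^+ j; set t : R := 2 ^+ d.
  by field; rewrite expf_neq0 // pnatr_eq0.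
by rewrite lerD2l.
Qed.

(** The dyadic bound at the largest dyadic scale below [r], as the kernel is
dominated by [ret], which decreases. *)
Lemma srw_upper : exists2 C : R, 0 < C &
  forall m r z, (0 < r)%N -> (r * r <= m)%N -> srw m z <= C / r%:R ^+ d.
Proof.
have [K K0 KP] := ret_dyadic.
pose C : R := 2 ^+ d.+1 * (4 * K)%:R ^+ d.
exists C; first by rewrite mulr_gt0 // exprn_gt0 // ltr0n muln_gt0.
move=> m r z r0 rm.
have rR : (0 : R) < r%:R by rewrite ltr0n.
have [rK|Kr] := ltnP r (2 * K).
  apply: le_trans (srw_le1 d_gt0 _ _) _; rewrite ler_pdivlMr ?exprn_gt0 // mul1r.
  apply: (@le_trans _ _ ((4 * K)%:R ^+ d)).
    by rewrite lerXn2r ?nnegrE ?ler0n // ler_nat; lia.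
  by rewrite ler_peMl ?exprn_ge0 // exprn_ege1 // ler1n.
pose j := trunc_log 2 (r %/ (2 * K)).
have q0 : (0 < r %/ (2 * K))%N by rewrite divn_gt0 // muln_gt0.
have := trunc_log_bounds (isT : (1 < 2)%N) q0; rewrite -/j => /andP[jl ju].
have jl' : (2 * K * 2 ^ j <= r)%N.
  by apply: leq_trans (leq_trunc_div r (2 * K)); rewrite mulnC leq_mul2r jl orbT.
have ju' : (r < 4 * K * 2 ^ j)%N.
  by move: ju; rewrite ltn_divLR ?muln_gt0 // expnS; nia.
apply: (@le_trans _ _ (ret (K * 4 ^ j))).
  apply: srw_le_ret => //; apply: leq_trans rm.
  apply: (@leq_trans ((2 * K * 2 ^ j) * (2 * K * 2 ^ j))%N); last exact: leq_mul.
  have -> : (4 ^ j = 2 ^ j * 2 ^ j)%N by rewrite -expnMn.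
  by move: (2 ^ j)%N => t; nia.
apply: le_trans (KP j) _; rewrite /C -mulrA ler_pM2l ?exprn_gt0 //.
have -> : (2 ^- d) ^+ j = (2 ^ j)%:R ^- d :> R.
  by rewrite natrX exprVn -!exprM mulnC.
rewrite ler_pdivlMr ?exprn_gt0 // mulrC ler_pdivrMr ?exprn_gt0 ?ltr0n ?expn_gt0 //.
by rewrite -exprMn -natrM lerXn2r ?nnegrE ?ler0n // ler_nat ltnW.
Qed.

Lemma expR_sym_le (t : R) : `|t| <= 2^-1 -> expR t + expR (- t) <= 2 * (1 + 2 * t ^+ 2).
Proof.
move=> t2; have [tl tu] : - 2^-1 <= t /\ t <= 2^-1 by move: t2; rewrite ler_norml => /andP.
have b (s : R) : s <= 2^-1 -> expR s <= (1 - s)^-1.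
  move=> s2; have s1 : 0 < 1 - s by lra.
  have := expR_ge1Dx (- s); rewrite expRN => H.
  by rewrite -[expR s]invrK lef_pV2 ?posrE ?invr_gt0 ?expR_gt0.
have b1 := b _ tu; have b2 : expR (- t) <= (1 - - t)^-1 by apply: b; lra.
have t4 : t ^+ 2 <= 4^-1 by nra.
have pos : 0 < 1 - t ^+ 2 by lra.
apply: le_trans (lerD b1 b2) _.
have -> : (1 - t)^-1 + (1 - - t)^-1 = 2 / (1 - t ^+ 2).
  by field; apply/and3P; split; rewrite gt_eqF //; lra.
by rewrite ler_pdivrMr //; have := sqr_ge0 t; nra.
Qed.

(** Twice the hyperbolic cosine of [th] times a coordinate: an exact multiple of
itself under the average over opposite steps. *)
Definition expsym (th : R) (i : 'I_d) (y : pt) : R :=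
  expR (th * (y 0 i)%:~R) + expR (- (th * (y 0 i)%:~R)).

Lemma Ex_expsym (th : R) (i : 'I_d) m x : 0 <= th <= 2^-1 ->
  Ex m (fun y => expsym th i (x + y)) <= (1 + 2 * th ^+ 2) ^+ m * expsym th i x.
Proof.
pose g := expsym th i; rewrite -/g; move=> /andP[th0 th2]; elim: m x => [|m IH] x; first by rewrite /= addr0 mul1r.
have g0 y : 0 <= g y by rewrite addr_ge0 // expR_ge0.
have lam0 : 0 <= 1 + 2 * th ^+ 2 by rewrite addr_ge0 // mulr_ge0 // sqr_ge0.
apply: (@le_trans _ _ (avg (fun e => (1 + 2 * th ^+ 2) ^+ m * g (x + step e)))).
  apply: ler_avg => // e; apply: le_trans (IH _).
  by rewrite le_eqVlt; apply/orP; left; apply/eqP/eq_Ex => y; rewrite addrA addrAC.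
rewrite avgZ (exprSr _ m) -mulrA ler_wpM2l ?exprn_ge0 //.
have sym (f : 'I_d * bool -> R) : 2 * avg f = avg (fun e => f e + f (e.1, ~~ e.2)).
  by rewrite avgD avg_opp; ring.
rewrite -(@ler_pM2l _ 2) // sym.
rewrite -[leRHS](avg_cst d_gt0); apply: ler_avg => // e; rewrite stepN.
pose t := th * (step e 0 i)%:~R.
have t2 : `|t| <= th.
  rewrite /t /step !mxE eqxx normrM ger0_norm // ler_piMr //.
  by case: (e.2); case: eqP => _; rewrite ?expr1 ?expr0 ?mulr0 ?mulr1 ?mulN1r ?mulrN1z ?normrN ?normr1 ?normr0.
have -> : g (x + step e) + g (x - step e) = g x * (expR t + expR (- t)).
  rewrite /g /expsym.
  have -> : ((x + step e) 0 i)%:~R = (x 0 i)%:~R + (step e 0 i)%:~R :> R.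
    by rewrite mxE rmorphD.
  have -> : ((x - step e) 0 i)%:~R = (x 0 i)%:~R - (step e 0 i)%:~R :> R.
    by rewrite -rmorphB /=; congr (_%:~R); rewrite !mxE.
  by rewrite !mulrDr !mulrN -/t !opprD opprK !expRD; ring.
have -> : 2 * ((1 + 2 * th ^+ 2) * g x) = g x * (2 * (1 + 2 * th ^+ 2)) by ring.
apply: ler_wpM2l => //; apply: le_trans (expR_sym_le (le_trans t2 th2)) _.
have : t ^+ 2 <= th ^+ 2.
  by rewrite -[t ^+ 2]real_normK ?num_real // lerXn2r ?nnegrE.
lra.
Qed.

(** Exponential moments of parameter [1 / (2 r)] stay bounded up to time
[r ^ 2], and they dominate powers of the same scale. *)
Lemma Ex_moment k : (0 < k)%N -> exists2 C : R, 0 < C &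
  forall m r i, (0 < r)%N -> (m <= r * r)%N ->
  Ex m (fun x => `|(x 0 i)%:~R| ^+ k) <= C * r%:R ^+ k.
Proof.
move=> k0; exists ((2 * k%:R) ^+ k * (2 * expR 1)).
  by rewrite !mulr_gt0 ?exprn_gt0 ?expR_gt0 ?mulr_gt0 ?ltr0n.
move=> m r i r0 mr.
have rR : (0 : R) < r%:R by rewrite ltr0n.
have kR : (0 : R) < k%:R by rewrite ltr0n.
pose th : R := (2 * r%:R)^-1.
have th0 : 0 < th by rewrite invr_gt0 mulr_gt0.
have th2 : th <= 2^-1 by rewrite lef_pV2 ?posrE ?mulr_gt0 // ler_peMr // ler1n.
pose g := expsym th i.
apply: (@le_trans _ _ (Ex m (fun x => (2 * k%:R) ^+ k * r%:R ^+ k * g x))).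
  apply: ler_Ex => // x; set t : R := (x 0 i)%:~R.
  have -> : `|t| = (2 * k%:R * r%:R) * (th * `|t| / k%:R).
    by rewrite /th; field; rewrite !gt_eqF.
  rewrite -[(2 * k%:R) ^+ k * _]exprMn [leLHS]exprMn ler_pM2l; last by rewrite exprn_gt0 ?mulr_gt0.
  apply: (@le_trans _ _ (expR (th * `|t|))).
    have kE : th * `|t| = k%:R * (th * `|t| / k%:R) by field; rewrite gt_eqF.
    rewrite [in leRHS]kE.
    rewrite expRM_natl lerXn2r ?nnegrE ?expR_ge0 //.
      by rewrite divr_ge0 ?ler0n // mulr_ge0 // ltW.
    by apply: le_trans (expR_ge1Dx _); rewrite lerDr.
  rewrite /g /expsym -/t; have [t0|t0] := leP 0 t.
    by rewrite ger0_norm // lerDl expR_ge0.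
  by rewrite ltr0_norm // mulrN lerDr expR_ge0.
rewrite ExZ [leRHS]mulrAC ler_pM2l; last by rewrite mulr_gt0 ?exprn_gt0 ?mulr_gt0.
apply: le_trans (_ : (1 + 2 * th ^+ 2) ^+ m * g 0 <= _).
  have := @Ex_expsym th i m 0; rewrite (ltW th0) th2 => /(_ isT).
  by apply: le_trans; rewrite le_eqVlt; apply/orP; left; apply/eqP/eq_Ex => y; rewrite add0r.
rewrite /g /expsym mxE mulr0 oppr0 expR0 mulrC ler_pM2l ?addr_gt0 //.
apply: (@le_trans _ _ (expR (2 * th ^+ 2) ^+ m)).
  by rewrite lerXn2r ?nnegrE ?expR_ge0 ?expR_ge1Dx // addr_ge0 // mulr_ge0 // sqr_ge0.
rewrite -expRM_natl ler_expR.
have -> : m%:R * (2 * th ^+ 2) = m%:R / (2 * r%:R ^+ 2) by rewrite /th; field; rewrite gt_eqF.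
rewrite ler_pdivrMr ?mulr_gt0 ?exprn_gt0 // mul1r.
have : m%:R <= r%:R ^+ 2 :> R by rewrite expr2 -natrM ler_nat.
by have := exprn_gt0 2 rR; lra.
Qed.

Definition nsq (x : pt) : R := \sum_i (x 0 i)%:~R ^+ 2.

Lemma nsq_ge0 x : 0 <= nsq x.
Proof. by apply: sumr_ge0 => i _; apply: sqr_ge0. Qed.

Lemma nsq0 : nsq 0 = 0.
Proof. by rewrite /nsq big1 // => i _; rewrite mxE expr0n. Qed.

Lemma nsqN x : nsq (- x) = nsq x.
Proof. by apply: eq_bigr => i _; rewrite !mxE rmorphN sqrrN. Qed.

Lemma nsqD_le x y : nsq (x + y) <= 2 * nsq x + 2 * nsq y.
Proof.
rewrite /nsq !mulr_sumr -big_split; apply: ler_sum => i _ /=.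
rewrite !mxE rmorphD /=; set a : R := (x 0 i)%:~R; set b : R := (y 0 i)%:~R.
by have := sqr_ge0 (a - b); nra.
Qed.

Lemma coord_le_nsq x i : (x 0 i)%:~R ^+ 2 <= nsq x.
Proof. by rewrite /nsq (bigD1 i) //= lerDl sumr_ge0 // => k _; apply: sqr_ge0. Qed.

(** Markov inequality for the moments of order [2 k] of the coordinates. *)
Lemma tail_bound k : (0 < k)%N -> exists2 C : R, 0 < C &
  forall m r (rho : R), (0 < r)%N -> (m <= r * r)%N -> 0 < rho ->
  Ex m (fun x => (rho <= nsq x)%R%:R) <= C * (r%:R ^+ 2 / rho) ^+ k.
Proof.
move=> k0; have [C C0 CP] := @Ex_moment (2 * k) ltac:(by rewrite muln_gt0).
have dR : (0 : R) < d%:R by rewrite ltr0n.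
exists (d%:R * (d%:R ^+ k * C)); first by rewrite !mulr_gt0 ?exprn_gt0.
move=> m r rho r0 mr rho0.
apply: (@le_trans _ _ (Ex m (fun x => \sum_(i < d) (d%:R / rho) ^+ k * `|(x 0 i)%:~R| ^+ (2 * k)))).
  apply: ler_Ex => // x; have F0 (i : 'I_d) : 0 <= (d%:R / rho) ^+ k * `|(x 0 i)%:~R| ^+ (2 * k).
    by rewrite mulr_ge0 ?exprn_ge0 // divr_ge0 // ltW.
  case: (leP rho (nsq x)) => [rx|_]; last by apply: sumr_ge0 => i _.
  have [i iP] : exists i, rho / d%:R <= (x 0 i)%:~R ^+ 2.
    apply: contrapT => /forallNP H.
    suff : nsq x < rho by rewrite ltNge rx.
    have -> : rho = \sum_(i < d) (rho / d%:R).
      by rewrite sumr_const card_ord -[_ *+ d]mulr_natr divfK ?gt_eqF.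
    apply: ltr_sum => [|i _]; last by rewrite ltNge; apply/negP/H.
    by apply/hasP; exists (Ordinal d_gt0); rewrite ?mem_index_enum.
  rewrite (bigD1 i) //= -[leLHS]addr0 lerD ?sumr_ge0 //.
  rewrite exprM -exprMn real_normK ?num_real // exprn_ege1 //.
  by rewrite mulrAC ler_pdivlMr // mul1r mulrC -ler_pdivrMr.
rewrite Ex_sum //.
apply: (@le_trans _ _ (\sum_(i < d) (d%:R / rho) ^+ k * (C * r%:R ^+ (2 * k)))).
  apply: ler_sum => i _; rewrite ExZ ler_pM2l ?exprn_gt0 ?divr_gt0 //.
  exact: CP.
rewrite sumr_const card_ord -[leLHS]mulr_natl -mulrA ler_pM2l //.
rewrite le_eqVlt; apply/orP; left; apply/eqP; rewrite !expr_div_n -exprM.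
by field; rewrite expf_neq0 // gt_eqF.
Qed.

End HeatKernelBounds.

(** * Off-diagonal upper bound and near-diagonal lower bound *)

Section HeatKernelScales.
Context {R : realType} {d : nat}.
Hypothesis d_gt0 : (0 < d)%N.
Local Notation pt := ('rV[int]_d).
Local Notation srw := (@srw R d).
Local Notation ret := (@ret R d).
Local Notation gap := (@gap R d).
Local Notation nsq := (@nsq R d).
Implicit Types (u v w x y z : pt) (m l k n r : nat).

Lemma sqrt_floor m : (0 < m)%N -> exists2 r, (0 < r)%N & (r * r <= m < r.+1 * r.+1)%N.
Proof.
move=> m0; have ex : exists r, (r * r <= m)%N by exists 0%N.
have bd r : (r * r <= m)%N -> (r <= m)%N by case: r => // r; apply: leq_trans; rewrite leq_pmulr.
have [r rm rmax] := ex_maxnP ex bd.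
exists r; first by case: r rm rmax => // _ /(_ 1%N); rewrite muln1 => /(_ m0).
by rewrite rm ltnNge; apply/negP => /rmax; rewrite ltnn.
Qed.

(** Both halves are of order [r ^ 2] for the same [r], so that the kernel bound
and the moment bound apply to each of them. *)
Lemma half_time m : (1 < m)%N -> exists m1 m2 r,
  [/\ m = (m1 + m2)%N, (0 < r)%N, (r * r <= m1)%N & (r * r <= m2)%N] /\
  (m1 <= (4 * r) * (4 * r))%N /\ (m2 <= (4 * r) * (4 * r))%N.
Proof.
move=> m1; have h0 : (0 < m %/ 2)%N by lia.
have [r r0 /andP[rh hr]] := sqrt_floor h0.
by exists (m %/ 2)%N, (m - m %/ 2)%N, r; split; [split|split]; nia.
Qed.

(** If [x + y = z] then one of the two halves covers a quarter of [nsq z]; by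
the Markov property at half time the walk needs an atypical displacement in one
of the halves. *)
Lemma srw_split m l z (rho : R) : 4 * rho <= nsq z -> forall a : R,
  (forall x, srw m x <= a) -> (forall x, srw l x <= a) ->
  srw (m + l) z <= a * (Ex m (fun x => (rho <= nsq x)%R%:R) +
                        Ex l (fun x => (rho <= nsq x)%R%:R)).
Proof.
move=> rz a am al; pose far x : R := (rho <= nsq x)%R%:R.
have srwE' k w : srw k (z - w) = Ex k (fun y => (w + y == z)%:R) by rewrite srwE.
have -> : srw (m + l) z = Ex m (fun x => Ex l (fun y => (x + y == z)%:R)).
  by rewrite srw_add //; apply: eq_Ex => x; rewrite srwE'.
apply: (@le_trans _ _ (Ex m (fun x => Ex l (fun y => far x * (x + y == z)%:R)) +
                       Ex m (fun x => Ex l (fun y => far y * (x + y == z)%:R)))).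
  rewrite -ExD //; apply: ler_Ex => // x; rewrite -ExD //; apply: ler_Ex => // y.
  rewrite -mulrDl; have [xyz|_] := eqVneq; last by rewrite mulr0.
  rewrite mulr1 /far -natrD ler1n addn_gt0 !lt0b; apply: contrapT => /negP.
  rewrite negb_or -!ltNge => /andP[h1 h2].
  by have := @nsqD_le R d x y; rewrite xyz; lra.
rewrite mulrDr lerD //.
  rewrite -ExZ //; apply: ler_Ex => // x; rewrite ExZ // -srwE' mulrC.
  by rewrite ler_wpM2r // ler0n.
rewrite Ex_exchange // -ExZ //; apply: ler_Ex => // y; rewrite ExZ //.
rewrite (eq_Ex _ (g := fun x => (y + x == z)%:R)); last by move=> x; rewrite addrC.
by rewrite -srwE' mulrC ler_wpM2r // ler0n.
Qed.

(** Split the time in halves of order [r ^ 2]: one factor is the on-diagonal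
bound [r ^- d], the other a tail [(r / n) ^+ (2 k)].  With [k = d + 2] the tail
turns [r ^- d] into [n ^- d] and leaves a factor [(r / n) ^+ 2]. *)
Lemma srw_far_diffusive (del : R) : 0 < del -> exists2 C : R, 0 < C &
  forall m n z, (0 < n)%N -> (m < n * n)%N -> del * n%:R ^+ 2 <= nsq z ->
  srw m z <= C / n%:R ^+ d * (m%:R / n%:R ^+ 2).
Proof.
move=> del0; have [C1 C10 U1] := @srw_upper R d d_gt0.
pose k := d.+2; have [C2 C20 T] := @tail_bound R d d_gt0 k isT.
pose A := C2 / del ^+ k; pose B := 2 * C1 * C2 * (64 / del) ^+ k.
have A0 : 0 < A by rewrite divr_gt0 // exprn_gt0.
have B0 : 0 < B by rewrite mulr_gt0 ?exprn_gt0 ?divr_gt0 // !mulr_gt0.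
exists (A + B); first exact: addr_gt0.
move=> m n z n0 mn nz.
have nR : (0 : R) < n%:R by rewrite ltr0n.
have n1 : (1 : R) <= n%:R by rewrite ler1n.
have nz0 : 0 < nsq z by apply: lt_le_trans nz; rewrite mulr_gt0 ?exprn_gt0.
have nd0 : 0 < n%:R ^- d :> R by rewrite invr_gt0 exprn_gt0.
case: m mn => [|[|m']] mn.
- rewrite srw0; case: eqP => [z0|_]; last by rewrite mul0r mulr0.
  by move: nz0; rewrite z0 nsq0 ltxx.
- apply: (@le_trans _ _ (A / n%:R ^+ d * (1%:R / n%:R ^+ 2))); last first.
    rewrite ler_pM2r ?divr_gt0 ?exprn_gt0 // ler_pM2r //.
    by rewrite lerDl ltW.
  apply: (@le_trans _ _ (Ex 1 (fun x => (del * n%:R ^+ 2 <= nsq x)%R%:R))).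
    apply: ler_Ex => // x; have [->|_] := eqVneq; last by rewrite ler0n.
    by rewrite nz.
  apply: le_trans (T 1%N 1%N _ isT isT _) _; first by rewrite mulr_gt0 ?exprn_gt0.
  rewrite expr1n div1r exprVn exprMn invfM mulrA -/A -!mulrA ler_pM2l //.
  rewrite ler_pM2l ?invr_gt0 ?exprn_gt0 // div1r -exprM -invfM -exprD lef_pV2 ?posrE ?exprn_gt0 //.
  by rewrite ler_weXn2l // /k addn2 leq_pmull.
set m := m'.+2 in mn *.
have [m1 [m2 [r [[m1m2 r0 rm rm2] [m1r m2r]]]]] := @half_time m isT.
have rR : (0 : R) < r%:R by rewrite ltr0n.
have rmm : (r * r <= m)%N by rewrite m1m2; apply: leq_trans rm (leq_addr _ _).
have rn : (r <= n)%N.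
  rewrite leqNgt; apply/negP => nr; move: mn; rewrite ltnNge => /negP; apply.
  by apply: leq_trans rmm; rewrite leq_mul // ltnW.
have r40 : (0 < 4 * r)%N by rewrite muln_gt0.
pose rho := del * n%:R ^+ 2 / 4.
have rho0 : 0 < rho by rewrite divr_gt0 ?mulr_gt0 ?exprn_gt0.
have rz : 4 * rho <= nsq z by rewrite /rho mulrCA mulfV ?mulr1 // pnatr_eq0.
have := @srw_split m1 m2 z rho rz (C1 / r%:R ^+ d) (fun x => U1 _ _ _ r0 rm) (fun x => U1 _ _ _ r0 rm2).
rewrite -m1m2 => /le_trans; apply.
have T1 := T m1 (4 * r)%N rho r40 m1r rho0; have T2 := T m2 (4 * r)%N rho r40 m2r rho0.
apply: (@le_trans _ _ (C1 / r%:R ^+ d * (2 * (C2 * ((4 * r)%:R ^+ 2 / rho) ^+ k)))).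
  rewrite ler_pM2l ?divr_gt0 ?exprn_gt0 //.
  by have := lerD T1 T2; rewrite -[_ + C2 * _]mulr2n mulr_natl.
apply: (@le_trans _ _ (B / n%:R ^+ d * (m%:R / n%:R ^+ 2))); last first.
  rewrite ler_wpM2r ?divr_ge0 ?exprn_ge0 // ler_pM2r //.
  by rewrite lerDr ltW.
have -> : (4 * r)%:R ^+ 2 / rho = (64 / del) * (r%:R / n%:R) ^+ 2.
  by rewrite /rho natrM; field; rewrite !gt_eqF.
rewrite exprMn -exprM.
have -> : C1 / r%:R ^+ d * (2 * (C2 * ((64 / del) ^+ k * (r%:R / n%:R) ^+ (2 * k)))) =
          B * ((r%:R / n%:R) ^+ (2 * k) / r%:R ^+ d).
  by rewrite /B; ring.
rewrite -mulrA ler_pM2l //.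
apply: (@le_trans _ _ ((r%:R / n%:R) ^+ k / r%:R ^+ d)).
  rewrite ler_pM2r ?invr_gt0 ?exprn_gt0 //.
  have rn1 : r%:R / n%:R <= 1 :> R by rewrite ler_pdivrMr // mul1r ler_nat.
  by rewrite ler_wiXn2l ?divr_ge0 ?leq_pmull.
have -> : (r%:R / n%:R) ^+ k / r%:R ^+ d = n%:R ^- d * (r%:R ^+ 2 / n%:R ^+ 2) :> R.
  rewrite /k -addn2 exprD !expr_div_n.
  by field; rewrite !expf_neq0 // gt_eqF.
by rewrite ler_pM2l // ler_pM2r ?invr_gt0 ?exprn_gt0 // expr2 -natrM ler_nat.
Qed.

(** Off-diagonal bound at spatial scale [n]: the kernel is never much larger
than at the diffusive time [n ^ 2], and is smaller before it. *)
Lemma srw_far (del : R) : 0 < del -> exists2 C : R, 0 < C &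
  forall m n z, (0 < n)%N -> del * n%:R ^+ 2 <= nsq z ->
  srw m z <= C / n%:R ^+ d * Num.min 1 (m%:R / n%:R ^+ 2).
Proof.
move=> del0; have [C1 C10 U1] := @srw_upper R d d_gt0.
have [C2 C20 H2] := srw_far_diffusive del0.
exists (C1 + C2); first exact: addr_gt0.
move=> m n z n0 nz.
have nR : (0 : R) < n%:R by rewrite ltr0n.
have nd0 : 0 < n%:R ^- d :> R by rewrite invr_gt0 exprn_gt0.
have [mn|nm] := ltnP m (n * n).
  have mn1 : m%:R / n%:R ^+ 2 <= 1 :> R.
    by rewrite ler_pdivrMr ?exprn_gt0 // mul1r expr2 -natrM ler_nat ltnW.
  rewrite min_r //; apply: le_trans (H2 _ _ _ n0 mn nz) _.
  by rewrite ler_wpM2r ?divr_ge0 ?exprn_ge0 // ler_pM2r // lerDr ltW.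
rewrite min_l; last by rewrite ler_pdivlMr ?exprn_gt0 // mul1r expr2 -natrM ler_nat.
rewrite mulr1; apply: le_trans (U1 _ _ _ n0 nm) _.
by rewrite ler_pM2r // lerDl ltW.
Qed.

(** By Chebyshev's inequality half of the mass at time [2 k] is in a box of side
of order [r], and no point carries more than [ret k]. *)
Lemma ret_lower : exists2 c : R, 0 < c &
  forall k r, (0 < r)%N -> (k <= r * r)%N -> c / r%:R ^+ d <= ret k.
Proof.
have [C C0 M] := @Ex_moment R d d_gt0 2 isT.
have dR : (0 : R) < d%:R by rewrite ltr0n.
pose a := 8 * d%:R * C; have a0 : 0 < a by rewrite mulr_gt0 // mulr_gt0.
pose L := (Num.truncn a).+1.
have aL : a < L%:R by apply: truncnS_gt.
have L0 : (0 : R) < L%:R by rewrite ltr0n.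
have L1 : (1 : R) <= L%:R by rewrite ler1n.
exists (2 * (3 * L)%:R ^+ d)^-1.
  by rewrite invr_gt0 mulr_gt0 // exprn_gt0 // ltr0n.
move=> k r r0 kr.
have rR : (0 : R) < r%:R by rewrite ltr0n.
have rL0 : (0 : R) < (L * r)%:R by rewrite ltr0n muln_gt0.
pose ind (x : pt) : R := (x \in box (L * r))%:R.
have half : 2^-1 <= Ex (k + k) ind.
  have H : 1 <= Ex (k + k) ind + Ex (k + k) (fun x => \sum_(i < d) (L * r)%:R ^- 2 * `|(x 0 i)%:~R| ^+ 2).
    rewrite -[leLHS](Ex_cst d_gt0 (k + k)) -ExD //; apply: ler_Ex => // x; rewrite /ind.
    have F0 (i : 'I_d) : 0 <= (L * r)%:R ^- 2 * `|(x 0 i)%:~R| ^+ 2 :> R.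
      by rewrite mulr_ge0 ?invr_ge0 ?exprn_ge0.
    case: mem_box => xb; first by rewrite lerDl sumr_ge0.
    rewrite add0r; have /existsNP[i /negP] := xb; rewrite -ltnNge => xi.
    rewrite (bigD1 i) //= -[leLHS]addr0 lerD ?sumr_ge0 //.
    rewrite mulrC ler_pdivlMr ?exprn_gt0 // mul1r lerXn2r ?nnegrE ?ler0n //.
    by rewrite -intr_norm -[leLHS]/((L * r)%N%:Z%:~R) ler_int; move: xi; clear; lia.
  have {}H : 1 <= Ex (k + k) ind + 2^-1.
    apply: le_trans H _; rewrite lerD2l Ex_sum //.
    apply: (@le_trans _ _ (\sum_(i < d) (L * r)%:R ^- 2 * (C * (2 * r)%:R ^+ 2))).
      apply: ler_sum => i _; rewrite ExZ // ler_pM2l ?invr_gt0 ?exprn_gt0 //.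
      apply: M; rewrite ?muln_gt0 //; clear -kr; nia.
    rewrite sumr_const card_ord -[leLHS]mulr_natl.
    have -> : d%:R * ((L * r)%:R ^- 2 * (C * (2 * r)%:R ^+ 2)) = a / L%:R ^+ 2 / 2.
      by rewrite /a !natrM; field; rewrite !gt_eqF.
    rewrite -[leRHS]mul1r ler_pM2r ?invr_gt0 // ler_pdivrMr ?exprn_gt0 // mul1r.
    by apply: le_trans (ltW aL) _; rewrite expr2 ler_peMl // ltW.
  by have := H; lra.
have : Ex (k + k) ind <= (3 * L * r)%:R ^+ d * ret k.
  rewrite (eq_Ex _ (g := fun x => ind (0 + x))); last by move=> x; rewrite add0r.
  rewrite (@Ex_supp _ _ d_gt0 _ (box (L * r))) ?box_uniq //; last first.
    by move=> x /negbTE xb; rewrite /ind xb.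
  apply: (@le_trans _ _ (\sum_(z <- @box d (L * r)) ret k)).
    apply: ler_sum => z _; rewrite -[leRHS]mul1r ler_pM ?ler0n ?srw_ge0 //.
      by rewrite /ind lern1 leq_b1.
    exact: srw_le_ret.
  rewrite big_const_seq count_predT size_box iter_addr_0 -[leLHS]mulr_natl natrX.
  rewrite ler_wpM2r ?ret_ge0 // lerXn2r ?nnegrE ?ler0n // ler_nat.
  have : (0 < L * r)%N by rewrite muln_gt0 r0.
  by rewrite -mulnA; move: (L * r)%N; clear; lia.
move=> /(le_trans half) H.
rewrite -invfM -mulrA -exprMn -natrM -(@ler_pM2l _ ((3 * L * r)%:R ^+ d)); last first.
  by rewrite exprn_gt0 // ltr0n !muln_gt0.
apply: le_trans _ H; rewrite invfM mulrCA mulfV ?mulr1 //.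
by rewrite expf_neq0 // pnatr_eq0 !muln_eq0 -lt0n r0.
Qed.

(** Near the diagonal the kernel is comparable with the return probability, as
the gap is controlled by the small decrement of the convex sequence [ret]. *)
Lemma srw_near : exists2 K, (0 < K)%N & forall n k v, (0 < n)%N ->
  (forall i, (`|v 0%R i| <= n)%N) -> (K * (n * n) <= k)%N ->
  ret k <= 2 * srw (k + k) (v + v).
Proof.
have [C C0 U] := @srw_upper R d d_gt0; have [c c0 L] := ret_lower.
pose Q : R := C * 4 ^+ d / c.
have Q0 : 0 < Q by rewrite divr_gt0 // mulr_gt0 // exprn_gt0.
pose A : R := (4 * d ^ 4)%:R; have A0 : 0 < A by rewrite ltr0n muln_gt0 expn_gt0 d_gt0.
pose K := (Num.truncn (6 * A * Q)).+3.
have KP : 6 * A * Q < K%:R.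
  by apply: lt_le_trans (truncnS_gt _) _; rewrite ler_nat /K; apply: leq_trans (leqnSn _) (leqnSn _).
exists K => // n k v n0 vn Kk.
have nR : (0 : R) < n%:R by rewrite ltr0n.
pose h := (k %/ 2)%N.
have k3 : (3 <= k)%N.
  by apply: leq_trans Kk; apply: (@leq_mul 3 1); rewrite ?muln_gt0 ?n0.
have [h0 h2] : (0 < h)%N /\ (h.*2 <= k <= h.*2.+1)%N.
  by rewrite /h; clear -k3; split; lia.
have hR : (0 : R) < h%:R by rewrite ltr0n.
have [r r0 /andP[rh hr]] := sqrt_floor h0.
have rR : (0 : R) < r%:R by rewrite ltr0n.
have Hh : ret h <= C / r%:R ^+ d.
  by apply: U => //; apply: leq_trans rh (leq_addr _ _).
have Hk : c / (4 * r)%:R ^+ d <= ret k.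
  apply: L; first by rewrite muln_gt0.
  by move: h2 h0 hr; clear; move: h => h; nia.
have hk : ret h <= Q * ret k.
  apply: le_trans Hh _; apply: le_trans (_ : Q * (c / (4 * r)%:R ^+ d) <= _).
    rewrite le_eqVlt; apply/orP; left; apply/eqP; rewrite /Q natrM exprMn.
    by field; rewrite !expf_neq0 ?gt_eqF.
  by rewrite ler_pM2l.
have := @gap_box R d d_gt0 k v n vn; set D := ret k - ret k.+1 => G.
have HD : h%:R * D <= ret h by apply: ret_diff_le => //; case/andP: h2.
have G' : gap k (v + v) <= A * n%:R ^+ 2 * D.
  apply: le_trans G _; rewrite le_eqVlt; apply/orP; left; apply/eqP.
  by rewrite /A [(d * n)%:R]natrM [(4 * d ^ 4)%:R]natrM natrX; ring.
have An : 2 * A * n%:R ^+ 2 * Q <= h%:R.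
  have : K%:R * n%:R ^+ 2 <= 3 * h%:R :> R.
    rewrite expr2 -!natrM ler_nat; apply: leq_trans Kk _.
    by move: h2 h0; clear; move: h => h; lia.
  have := exprn_gt0 2 nR; move: (n%:R ^+ 2) => N N0.
  have : 6 * A * Q * N <= K%:R * N by rewrite ler_pM2r // ltW.
  have -> : 2 * A * N * Q = (6 * A * Q * N) / 3 by field.
  by lra.
have rk0 : 0 <= ret k by apply: ret_ge0.
have : 2 * gap k (v + v) <= ret k.
  rewrite -(ler_pM2l hR) ; apply: (@le_trans _ _ (2 * A * n%:R ^+ 2 * (h%:R * D))).
    have -> : 2 * A * n%:R ^+ 2 * (h%:R * D) = h%:R * (2 * (A * n%:R ^+ 2 * D)) by ring.
    by rewrite ler_pM2l // ler_pM2l.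
  have cA : 0 <= 2 * A * n%:R ^+ 2 by rewrite !mulr_ge0 ?exprn_ge0 // ltW.
  apply: le_trans (ler_wpM2l cA (le_trans HD hk)) _.
  by rewrite mulrA ler_wpM2r.
by rewrite /gap; lra.
Qed.

(** Write [u = w + 2 v] with the coordinates of [w] in [{0, 1}]: go to [w] along a
shortest path, then to [v + v] by [srw_near].  The parity of [l1 w] selects
which of the two consecutive times can be reached. *)
Lemma srw_lower : exists2 K, (0 < K)%N & forall K', exists2 c : R, 0 < c &
  forall n u m, (0 < n)%N -> (forall i, (`|u 0%R i| <= 2 * n)%N) ->
  (K * (n * n) <= m)%N -> (m <= K' * (n * n))%N ->
  c / n%:R ^+ d <= srw m u + srw m.+1 u.
Proof.
have [K0 K00 N] := srw_near; have [c c0 L] := ret_lower.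
exists (2 * K0 + d)%N; first by rewrite addn_gt0 d_gt0 orbT.
move=> K'; pose e := (2 * d%:R)^-1 ^+ d : R.
have td0 : (0 : R) < 2 * d%:R by rewrite mulr_gt0 // ltr0n.
have e0 : 0 < e by rewrite exprn_gt0 // invr_gt0.
exists (e * (c / (K'.+1)%:R ^+ d / 2)).
  by rewrite mulr_gt0 // !divr_gt0 // exprn_gt0.
move=> n u m n0 un Km mK.
have nR : (0 : R) < n%:R by rewrite ltr0n.
pose v : pt := \row_i (u 0%R i %/ 2)%Z; pose w : pt := \row_i (u 0%R i %% 2)%Z.
have uE : u = w + (v + v).
  apply/rowP => i; rewrite !mxE; move: (u 0 i) => a; clear; lia.
have vn i : (`|v 0%R i| <= n)%N by rewrite mxE; have := un i; move: (u 0 i) => a; clear; lia.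
have lw : (l1 w <= d)%N.
  rewrite -[X in (_ <= X)%N]card_ord -sum1_card; apply: leq_sum => i _.
  by rewrite mxE; move: (u 0 i) => a; clear; lia.
have [m' [m'm par]] : exists m', (m' = m \/ m' = m.+1) /\ ~~ odd (m' + l1 w).
  case od : (odd (m + l1 w)); [exists m.+1|exists m]; split; auto.
    by rewrite addSn /= od.
  by rewrite od.
pose k := ((m' - l1 w) %/ 2)%N.
have nn0 : (0 < n * n)%N by rewrite muln_gt0 n0.
have dm : (2 * (K0 * (n * n)) + d <= m)%N.
  by apply: leq_trans Km; rewrite mulnDl -mulnA leq_add2l leq_pmulr.
have m'E : m' = (l1 w + (k + k))%N.
  by rewrite /k; move: m'm par dm lw; move: (l1 w) (K0 * (n * n))%N; clear; lia.
have kK : (K0 * (n * n) <= k)%N.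
  by rewrite /k; move: m'm par dm lw; move: (l1 w) (K0 * (n * n))%N; clear; lia.
apply: (@le_trans _ _ (srw m' u)); last first.
  by case: m'm => ->; [rewrite lerDl|rewrite lerDr]; apply: srw_ge0.
have H := @srw_conv_le R d d_gt0 (l1 w) (k + k) [:: w] u isT.
rewrite m'E; apply: le_trans _ H; rewrite big_seq1 uE addrAC subrr add0r -mulrA.
apply: ler_pM.
- exact: ltW.
- by rewrite mulr_ge0 ?invr_ge0 ?exprn_ge0 // divr_ge0 ?divr_ge0 ?exprn_ge0 // ltW.
- apply: le_trans (srw_path d_gt0 w); rewrite ler_wiXn2l ?invr_ge0 ?(ltW td0) //.
  by rewrite invf_le1 // -natrM ler1n muln_gt0.
have kK' : (k <= (K'.+1 * n) * (K'.+1 * n))%N.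
  apply: leq_trans (_ : K' * (n * n) + 1 <= _)%N; last by move: nn0; clear; nia.
  by rewrite /k; move: m'm mK; move: (l1 w) (K' * (n * n))%N; clear; lia.
have Hr : c / (K'.+1 * n)%:R ^+ d <= ret k by apply: L => //; rewrite muln_gt0.
have Hn := N n k v n0 vn kK.
have -> : c / K'.+1%:R ^+ d / 2 / n%:R ^+ d = (c / (K'.+1 * n)%:R ^+ d) / 2.
  by rewrite natrM exprMn invfM; ring.
by lra.
Qed.

End HeatKernelScales.

(** * Expectation under the jump law *)

Section JumpLawExpectation.
Context {R : realType} (c : nat -> R).
Hypothesis c_ge0 : forall m, 0 <= c m.
Hypothesis c_sum : (\sum_(m <oo) (c m)%:E = 1)%E.
Implicit Types (f g : nat -> R) (M a b : R).

(** Nonnegativity is included so that series under the jump law can be handled in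
the extended reals. *)
Definition bdd f := exists M, forall m, 0 <= f m <= M.

Definition Ec f : R := fine (\sum_(m <oo) (c m * f m)%:E)%E.

Lemma bddM f g : bdd f -> bdd g -> bdd (fun m => f m * g m).
Proof.
move=> [M fM] [N gN]; exists (M * N) => m.
by have /andP[f0 f1] := fM m; have /andP[g0 g1] := gN m; rewrite mulr_ge0 // ler_pM.
Qed.

Lemma bddD f g : bdd f -> bdd g -> bdd (fun m => f m + g m).
Proof.
move=> [M fM] [N gN]; exists (M + N) => m.
by have /andP[f0 f1] := fM m; have /andP[g0 g1] := gN m; rewrite addr_ge0 // lerD.
Qed.

Lemma bdd_cst a : 0 <= a -> bdd (fun=> a).
Proof. by move=> a0; exists a => m; rewrite a0 lexx. Qed.

Lemma bdd_bool (p : nat -> bool) : bdd (fun m => (p m)%:R).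
Proof. by exists 1 => m; rewrite ler0n lern1 leq_b1. Qed.

Lemma bddZ a f : 0 <= a -> bdd f -> bdd (fun m => a * f m).
Proof. by move=> a0; apply: bddM; apply: bdd_cst. Qed.

Lemma bdd_sum (I : eqType) (r : seq I) (F : I -> nat -> R) :
  (forall i, i \in r -> bdd (F i)) -> bdd (fun m => \sum_(i <- r) F i m).
Proof.
elim: r => [|i r IH] H.
  by exists 0 => m; rewrite big_nil lexx.
have /(bddD (H i (mem_head _ _))) [M MP] : bdd (fun m => \sum_(j <- r) F j m).
  by apply: IH => j jr; apply: H; rewrite inE jr orbT.
by exists M => m; rewrite big_cons.
Qed.

Lemma EcE f : bdd f -> (Ec f)%:E = (\sum_(m <oo) (c m * f m)%:E)%E.
Proof.
move=> [M fM]; have M0 : 0 <= M by have /andP[f0] := fM 0%N; apply: le_trans.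
rewrite /Ec fineK // ge0_fin_numE; last first.
  by apply: nneseries_ge0 => m _ _; rewrite lee_fin mulr_ge0 //; have /andP[] := fM m.
apply: (@le_lt_trans _ _ (\sum_(m <oo) (M%:E * (c m)%:E))%E).
  apply: lee_nneseries => m _; last first.
    by rewrite lee_fin mulrC ler_wpM2r //; have /andP[] := fM m.
  by move=> _; rewrite lee_fin mulr_ge0 //; have /andP[] := fM m.
by rewrite nneseriesZl ?c_sum ?mule1 ?ltry // => m _; rewrite lee_fin.
Qed.

Lemma eq_Ec f g : f =1 g -> Ec f = Ec g.
Proof. by move=> /funext ->. Qed.

Lemma Ec_cst a : 0 <= a -> Ec (fun=> a) = a.
Proof.
move=> a0; rewrite /Ec (eq_eseriesr (g := fun m => (a%:E * (c m)%:E)%E)).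
  by rewrite nneseriesZl ?c_sum ?mule1 // => m _; rewrite lee_fin.
by move=> m _; rewrite mulrC EFinM.
Qed.

Lemma EcD f g : bdd f -> bdd g -> Ec (fun m => f m + g m) = Ec f + Ec g.
Proof.
move=> bf bg; apply: EFin_inj; rewrite EcE ?EFinD; last exact: bddD.
rewrite !EcE // -nneseriesD.
- by apply: eq_eseriesr => m _; rewrite mulrDr EFinD.
- by case: bf => M fM m _ _; rewrite lee_fin mulr_ge0 //; have /andP[] := fM m.
- by case: bg => M fM m _ _; rewrite lee_fin mulr_ge0 //; have /andP[] := fM m.
Qed.

Lemma EcZ a f : 0 <= a -> bdd f -> Ec (fun m => a * f m) = a * Ec f.
Proof.
move=> a0 bf; apply: EFin_inj; rewrite EcE ?EFinM; last exact: bddZ.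
rewrite EcE // -nneseriesZl.
  by apply: eq_eseriesr => m _; rewrite mulrCA EFinM.
by case: bf => M fM m _; rewrite lee_fin mulr_ge0 //; have /andP[] := fM m.
Qed.

Lemma ler_Ec f g : bdd f -> bdd g -> (forall m, f m <= g m) -> Ec f <= Ec g.
Proof.
move=> bf bg fg; rewrite -lee_fin !EcE //; apply: lee_nneseries.
  by case: bf => M fM m _ _; rewrite lee_fin mulr_ge0 //; have /andP[] := fM m.
by move=> m _; rewrite lee_fin ler_wpM2l.
Qed.

Lemma Ec_ge0 f : bdd f -> 0 <= Ec f.
Proof.
move=> bf; rewrite -[X in X <= _](Ec_cst (lexx _)); apply: ler_Ec => //.
  exact: bdd_cst.
by case: bf => M fM m; have /andP[] := fM m.
Qed.

Lemma Ec_sum (I : eqType) (r : seq I) (F : I -> nat -> R) :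
  (forall i, i \in r -> bdd (F i)) ->
  Ec (fun m => \sum_(i <- r) F i m) = \sum_(i <- r) Ec (F i).
Proof.
elim: r => [|i r IH] H.
  rewrite big_nil -[RHS](Ec_cst (lexx _)); apply: eq_Ec => m.
  by rewrite big_nil.
have H' j : j \in r -> bdd (F j) by move=> jr; apply: H; rewrite inE jr orbT.
rewrite big_cons -IH // -EcD; last exact: bdd_sum.
  by apply: eq_Ec => m; rewrite big_cons.
exact: H (mem_head _ _).
Qed.

Lemma Ec_ge_term m f : bdd f -> c m * f m <= Ec f.
Proof.
move=> bf; have f0 k : (0 <= (c k * f k)%:E)%E.
  by rewrite lee_fin mulr_ge0 //; case: bf => M /(_ k) /andP[].
rewrite -lee_fin EcE //; apply: le_trans (nneseries_lim_ge m.+1 _) => //.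
by rewrite big_nat_recr //= leeDr // sume_ge0.
Qed.

End JumpLawExpectation.

(** * Truncated first moments of the jump law *)

Section JumpLawTails.
Context {R : realType} (c : nat -> R) (phi : R -> R).
Hypothesis c_ge0 : forall m, 0 <= c m.
Hypothesis c_sum : (\sum_(m <oo) (c m)%:E = 1)%E.
Hypothesis phi_laplace : forall l : R, 0 < l <= 1 ->
  (\sum_(m <oo) (c m * (1 - (1 - l) ^+ m))%:E = (phi l)%:E)%E.
Local Notation Ec := (Ec c).
Implicit Types (l a b t : R) (m n k : nat).

Let bdd01 (f : nat -> R) : (forall m, 0 <= f m <= 1) -> bdd f.
Proof. by exists 1. Qed.

(** Its expectation [psi] is comparable with [phi], and the truncated identity is
easier than a power to compare with indicators of large times. *)
Definition trunc_jump l m : R := Num.min 1 (l * m%:R).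
Definition psi l := Ec (trunc_jump l).

Lemma trunc_jump_ge0 l m : 0 <= l -> 0 <= trunc_jump l m.
Proof. by move=> l0; rewrite /trunc_jump le_min ler01 mulr_ge0. Qed.

Lemma bdd_trunc_jump l : 0 <= l -> bdd (trunc_jump l).
Proof. by move=> l0; apply: bdd01 => m; rewrite trunc_jump_ge0 //= ge_min lexx. Qed.

(** With [expr_sub_ge], this compares [1 - (1 - l) ^+ m] with [trunc_jump l m]
up to a factor 2. *)
Lemma expr_sub_le l m : 0 <= l <= 1 -> (1 - l) ^+ m * (1 + l * m%:R) <= 1.
Proof.
move=> /andP[l0 l1]; elim: m => [|m IH]; first by rewrite mulr0 addr0 expr0 mulr1.
apply: le_trans IH; rewrite exprSr -mulrA ler_wpM2l ?exprn_ge0 ?subr_ge0 //.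
rewrite -natr1; have : 0 <= m%:R :> R by []; nra.
Qed.

Lemma expr_sub_ge l m : 0 <= l <= 1 -> 1 - l * m%:R <= (1 - l) ^+ m.
Proof.
move=> /andP[l0 l1]; elim: m => [|m IH]; first by rewrite mulr0 subr0 expr0.
have m0 : 0 <= m%:R :> R by [].
have l10 : 0 <= 1 - l by rewrite subr_ge0.
rewrite exprS; apply: le_trans (ler_wpM2l l10 IH).
by rewrite -natr1; nra.
Qed.

Lemma expr_sub01 l m : 0 <= l <= 1 -> 0 <= (1 - l) ^+ m <= 1.
Proof. by move=> /andP[l0 l1]; rewrite exprn_ge0 ?exprn_ile1 ?subr_ge0 // gerBl. Qed.

Lemma bdd_expr_sub l : 0 <= l <= 1 -> bdd (fun m => 1 - (1 - l) ^+ m).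
Proof. by move=> l01; apply: bdd01 => m; have := expr_sub01 m l01; lra. Qed.

Lemma phiE l : 0 < l <= 1 -> phi l = Ec (fun m => 1 - (1 - l) ^+ m).
Proof. by move=> l01; rewrite /Ec phi_laplace. Qed.

Lemma phi_le_psi l : 0 < l <= 1 -> phi l <= psi l.
Proof.
move=> l01; have /andP[l0 l1] := l01.
have l01' : 0 <= l <= 1 by rewrite ltW.
rewrite phiE //; apply: ler_Ec => //; first exact: bdd_expr_sub.
  exact/bdd_trunc_jump/ltW.
move=> m; have := expr_sub_ge m l01'; have := expr_sub01 m l01'.
by rewrite /trunc_jump le_min => /andP[h1 h2] h3; apply/andP; split; lra.
Qed.

Lemma psi_le_phi l : 0 < l <= 1 -> psi l <= 2 * phi l.
Proof.
move=> l01; have /andP[l0 l1] := l01.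
have l01' : 0 <= l <= 1 by rewrite ltW.
have bl := bdd_expr_sub l01'.
rewrite phiE // -EcZ //; apply: ler_Ec => //; first exact/bdd_trunc_jump/ltW.
  exact: bddZ.
move=> m; have := expr_sub_le m l01'; have /andP[] := expr_sub01 m l01'.
have : 0 <= l * m%:R by rewrite mulr_ge0 // ltW.
rewrite /trunc_jump; move: (l * _) ((1 - l) ^+ m) => x y x0 y0 y1 xy.
by rewrite ge_min; apply/orP; have [x1|x1] := leP 1 x; [left|right]; nra.
Qed.

Lemma psi_scale l t : 0 <= l -> 1 <= t -> psi (t * l) <= t * psi l.
Proof.
move=> l0 t1; have t0 : 0 <= t by apply: le_trans t1.
have bl := bdd_trunc_jump l0.
rewrite -EcZ //; apply: ler_Ec => //; [by apply: bdd_trunc_jump; rewrite mulr_ge0|exact: bddZ|].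
by move=> m; rewrite /trunc_jump minr_pMr // mulr1 mulrA le_min !ge_min lexx t1 orbT.
Qed.

End JumpLawTails.

(** * Tails of the jump law under the scaling condition *)

Section JumpLawScaling.
Context {R : realType} (c : nat -> R) (phi : R -> R).
Hypothesis c_ge0 : forall m, 0 <= c m.
Hypothesis c_sum : (\sum_(m <oo) (c m)%:E = 1)%E.
Hypothesis phi_laplace : forall l : R, 0 < l <= 1 ->
  (\sum_(m <oo) (c m * (1 - (1 - l) ^+ m))%:E = (phi l)%:E)%E.
Hypothesis phi1 : phi 1 = 1.
Context {g1 g2 a1 a2 : R}.
Hypothesis (g1_gt0 : 0 < g1) (g2_lt1 : g2 < 1) (a1_gt0 : 0 < a1) (a2_gt0 : 0 < a2).
Hypothesis scaling : forall r s : R, 0 < r -> r <= s -> s <= 1 ->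
  a1 * (s / r) `^ g1 <= phi s / phi r /\ phi s / phi r <= a2 * (s / r) `^ g2.
Local Notation Ec := (Ec c).
Local Notation psi := (psi c).
Implicit Types (l a b t : R) (m n k : nat).

Lemma phi_gt0 l : 0 < l <= 1 -> 0 < phi l.
Proof.
move=> /andP[l0 l1]; have [+ _] := scaling l0 l1 (lexx _).
rewrite phi1 !div1r => H; rewrite -invr_gt0; apply: lt_le_trans H.
by rewrite mulr_gt0 // powR_gt0 // invr_gt0.
Qed.

Lemma a2_ge1 : 1 <= a2.
Proof.
have [_] := scaling ltr01 (lexx _) (lexx _).
by rewrite phi1 divr1 powR1 mulr1.
Qed.

(** Below the scale [eps / l] the truncated first moment is a small fraction of
[phi l], because [g2 < 1]; so a fixed fraction of [phi l] comes from jumps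
longer than [eps / l]. *)
Lemma long_jumps : exists2 eps, 0 < eps <= 1 & forall l, 0 < l <= eps ->
  phi l <= 2 * Ec (fun m => (eps <= l * m%:R)%R%:R).
Proof.
have g20 : 0 < 1 - g2 by rewrite subr_gt0.
(* The choice of [eps] makes [eps * a2 * eps `^ (- g2)] equal to one quarter. *)
pose q := (1 - g2)^-1; pose A := 4 * a2.
have A0 : 0 < A by rewrite mulr_gt0.
have A1 : 1 <= A by have := a2_ge1; rewrite /A; lra.
pose eps := A `^ (- q).
have eps0 : 0 < eps by rewrite powR_gt0.
have eps1 : eps <= 1.
  by rewrite -[leRHS](powRr0 A) ler_powR // oppr_le0 invr_ge0 ltW.
exists eps; first by rewrite eps0.
move=> l /andP[l0 le]; have l1 : l <= 1 := le_trans le eps1.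
have le0 : 0 < l / eps by rewrite divr_gt0.
have le1 : l / eps <= 1 by rewrite ler_pdivrMr // mul1r.
have lle : l <= l / eps by rewrite ler_pdivlMr // ler_piMr // ltW.
have phil := phi_gt0 (l := l); rewrite l0 l1 in phil; have {}phil := phil isT.
have key : eps * phi (l / eps) <= 4^-1 * phi l.
  have [_] := scaling l0 lle le1; rewrite ler_pdivrMr //.
  have -> : l / eps / l = A `^ q by rewrite mulrAC divff ?gt_eqF // div1r /eps powRN invrK.
  move=> H; apply: le_trans (ler_wpM2l (ltW eps0) H) _.
  rewrite mulrA ler_pM2r // -powRrM mulrCA /eps -powRD; last first.
    by rewrite (gt_eqF A0) implybT.
  have -> : - q + q * g2 = -1 by rewrite /q; field; rewrite gt_eqF.
  by rewrite powR_inv1 ?(ltW A0) // /A invfM mulrCA mulfV ?mulr1 // gt_eqF.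
have bl : bdd (trunc_jump (l / eps)) by apply: bdd_trunc_jump; apply: ltW.
have bi : bdd (fun m => (eps <= l * m%:R)%R%:R : R) by apply: bdd_bool.
have : psi l <= Ec (fun m => (eps <= l * m%:R)%R%:R) + eps * psi (l / eps).
  have be : bdd (fun m => eps * trunc_jump (l / eps) m) by apply: bddZ => //; apply: ltW.
  rewrite -EcZ ?(ltW eps0) // -EcD //; apply: ler_Ec => //.
  - exact/bdd_trunc_jump/ltW.
  - exact: bddD.
  move=> m; rewrite /trunc_jump; have [h|h] := leP eps (l * m%:R).
    apply: (@le_trans _ _ 1); first by rewrite ge_min lexx.
    by rewrite lerDl mulr_ge0 ?(ltW eps0) // le_min ler01 mulr_ge0 ?(ltW le0).
  rewrite add0r minr_pMr; last exact: ltW.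
  rewrite mulr1 le_min !ge_min (ltW h) orbT /=.
  by rewrite mulrA [eps * _]mulrC divfK ?gt_eqF // lexx orbT.
have P1 : phi l <= psi l by apply: phi_le_psi; rewrite // l0.
have P2 : psi (l / eps) <= 2 * phi (l / eps) by apply: psi_le_phi; rewrite // le0.
have := ler_wpM2l (ltW eps0) P2; lra.
Qed.

(** The order of the probability that one step of the subordinate walk has
length at least [n]. *)
Definition rate n : R := phi (n%:R ^- 2).

Lemma inv_sqr01 n : (0 < n)%N -> 0 < (n%:R ^- 2 : R) <= 1.
Proof.
move=> n0; rewrite invr_gt0 exprn_gt0 ?ltr0n //=.
by rewrite invf_le1 ?exprn_gt0 ?ltr0n // exprn_ege1 // ler1n.
Qed.

Lemma rate_gt0 n : (0 < n)%N -> 0 < rate n.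
Proof. by move=> n0; apply/phi_gt0/inv_sqr01. Qed.

Lemma psi_rate n : (0 < n)%N -> psi (n%:R ^- 2) <= 2 * rate n.
Proof. by move=> n0; apply: psi_le_phi => //; apply: inv_sqr01. Qed.

(** The threshold [K * n ^ 2] is [eps / l] for [l] a fixed multiple of
[n ^- 2], and [psi] changes by at most a constant between the two. *)
Lemma jumps_ge K : (0 < K)%N -> exists2 b, 0 < b & forall n, (0 < n)%N ->
  b * rate n <= Ec (fun m => (K * (n * n) <= m)%N%:R).
Proof.
move=> K0; have [eps /andP[e0 e1] H] := long_jumps.
have KR : (0 : R) < K%:R by rewrite ltr0n.
exists (eps / (4 * K%:R)); first by rewrite divr_gt0 // mulr_gt0.
move=> n n0; have nR : (0 : R) < n%:R ^+ 2 by rewrite exprn_gt0 // ltr0n.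
have D0 : 0 < K%:R * n%:R ^+ 2 := mulr_gt0 KR nR.
pose l := eps / (K%:R * n%:R ^+ 2).
have l0 : 0 < l by rewrite divr_gt0.
have le : l <= eps.
  rewrite /l ler_pdivrMr //.
  rewrite ler_peMr ?(ltW e0) //.
  by rewrite expr2 -!natrM ler1n !muln_gt0 K0 n0.
have l1 : l <= 1 := le_trans le e1.
have {}H : phi l <= 2 * Ec (fun m => (K * (n * n) <= m)%N%:R).
  have := H l; rewrite l0 le => /(_ isT) /le_trans; apply.
  rewrite ler_pM2l // le_eqVlt; apply/orP; left; apply/eqP; apply: eq_Ec => m.
  rewrite /l mulrAC ler_pdivlMr // ler_pM2l //.
  by rewrite expr2 -!natrM ler_nat.
have t1 : 1 <= K%:R / eps by rewrite ler_pdivlMr // mul1r (le_trans e1) // ler1n.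
have P1 := @phi_le_psi _ _ _ c_ge0 c_sum phi_laplace _ (inv_sqr01 n0).
have P2 : psi (n%:R ^- 2) <= K%:R / eps * psi l.
  have := psi_scale c_ge0 c_sum (ltW l0) t1.
  have -> // : K%:R / eps * l = n%:R ^- 2.
  by rewrite /l; field; rewrite !gt_eqF // ltr0n.
have P3 : psi l <= 2 * phi l by apply: psi_le_phi; rewrite // l0.
have -> : Ec (fun m => (K * (n * n) <= m)%N%:R) =
  eps / (4 * K%:R) * (K%:R / eps * (2 * (2 * Ec (fun m => (K * (n * n) <= m)%N%:R)))).
  by field; rewrite !gt_eqF.
rewrite ler_pM2l; last by rewrite divr_gt0 // mulr_gt0.
apply: le_trans P1 _; apply: le_trans P2 _; rewrite ler_pM2l ?divr_gt0 //.
by apply: le_trans P3 _; rewrite ler_pM2l.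
Qed.

(** The lower scaling condition makes very long jumps rare, so that the jumps
of order [n ^ 2] already carry a fraction of the rate. *)
Lemma jumps_window K : (0 < K)%N -> exists K' b, 0 < b /\ forall n, (0 < n)%N ->
  b * rate n <= Ec (fun m => (K * (n * n) <= m <= K' * (n * n))%N%:R).
Proof.
move=> K0; have [b b0 H] := jumps_ge K0.
pose A := 4 / (a1 * b); have A0 : 0 < A by rewrite divr_gt0 // mulr_gt0.
pose K' := (Num.truncn (A `^ g1^-1)).+1.
have K'P : A <= K'%:R `^ g1.
  have -> : A = (A `^ g1^-1) `^ g1 by rewrite -powRrM mulVf ?gt_eqF // powRr1 // ltW.
  by apply: ge0_ler_powR; rewrite ?nnegrE ?powR_ge0 ?ler0n ?(ltW g1_gt0) // ltW // truncnS_gt.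
have K'R : (0 : R) < K'%:R by rewrite ltr0n.
exists K', (b / 2); split; first by rewrite divr_gt0.
move=> n n0; have nR : (0 : R) < n%:R ^+ 2 by rewrite exprn_gt0 // ltr0n.
have /andP[in0 in1] := inv_sqr01 n0.
have D0 : 0 < K'%:R * n%:R ^+ 2 := mulr_gt0 K'R nR.
pose l := (K'%:R * n%:R ^+ 2)^-1 : R.
have l0 : 0 < l by rewrite invr_gt0.
have ln : l <= n%:R ^- 2 by rewrite lef_pV2 ?posrE // ler_peMl ?(ltW nR) // ler1n.
have l01 : 0 < l <= 1 by rewrite l0 (le_trans ln).
have pl : phi l <= b / 4 * rate n.
  have [+ _] := scaling l0 ln in1; have -> : n%:R ^- 2 / l = K'%:R.
    by rewrite /l; field; rewrite !gt_eqF // ltr0n.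
  rewrite ler_pdivlMr ?phi_gt0 //.
  have : a1 * A * phi l <= a1 * K'%:R `^ g1 * phi l.
    by rewrite ler_pM2r ?phi_gt0 // ler_pM2l.
  have -> : a1 * A = 4 / b by rewrite /A; field; rewrite !gt_eqF.
  move=> /le_trans h /h {h} h; rewrite -(@ler_pM2l _ (4 / b)) ?divr_gt0 //.
  by apply: le_trans h _; rewrite le_eqVlt; apply/orP; left; apply/eqP;
    rewrite /rate; field; rewrite gt_eqF.
have T : Ec (fun m => (K' * (n * n) < m)%N%:R) <= b / 2 * rate n.
  apply: (@le_trans _ _ (psi l)).
    apply: ler_Ec => //; [exact: bdd_bool|exact/bdd_trunc_jump/ltW|].
    move=> m; case: ltnP => h; last by apply: trunc_jump_ge0; apply: ltW.
    rewrite /trunc_jump le_min lexx /= /l mulrC ler_pdivlMr // mul1r.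
    by rewrite expr2 -!natrM ler_nat ltnW.
  apply: le_trans (psi_le_phi c_ge0 c_sum phi_laplace l01) _.
  by move: pl; lra.
have := H n n0.
have : Ec (fun m => (K * (n * n) <= m)%N%:R) <=
    Ec (fun m => (K * (n * n) <= m <= K' * (n * n))%N%:R) + Ec (fun m => (K' * (n * n) < m)%N%:R).
  rewrite -EcD //; [|exact: bdd_bool|exact: bdd_bool].
  apply: ler_Ec => //; [exact: bdd_bool|by apply: bddD; apply: bdd_bool|].
  by move=> m; rewrite -natrD ler_nat; case: (K * (n * n) <= m)%N => //=;
    case: (leqP m (K' * (n * n))).
by move: T; lra.
Qed.

End JumpLawScaling.

(** * The kernel of the subordinate walk *)

Section SubordinatedKernel.
Context {R : realType} {d : nat} (c : nat -> R) (phi : R -> R).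
Hypothesis d_gt0 : (0 < d)%N.
Hypothesis c_ge0 : forall m, 0 <= c m.
Hypothesis c_sum : (\sum_(m <oo) (c m)%:E = 1)%E.
Local Notation pt := ('rV[int]_d).
Local Notation Ec := (Ec c).
Local Notation srw := (@srw R d).
Implicit Types (u v w x y z : pt) (s : seq pt) (F : pt -> R).

(** The one-step kernel of the subordinate walk. *)
Definition jump u : R := Ec (srw^~ u).

Lemma bdd_srw u : bdd (srw^~ u).
Proof. by exists 1 => m; rewrite srw_ge0 ?srw_le1. Qed.

Lemma bdd_srwS u : bdd (fun m => srw m.+1 u).
Proof. by exists 1 => m; rewrite srw_ge0 ?srw_le1. Qed.

Lemma jump_ge0 u : 0 <= jump u.
Proof. by apply: Ec_ge0 => //; apply: bdd_srw. Qed.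

Lemma jumpN u : jump (- u) = jump u.
Proof. by apply: eq_Ec => m; rewrite srwN. Qed.

Lemma jumpC u v : jump (u - v) = jump (v - u).
Proof. by rewrite -jumpN opprB. Qed.

Lemma jump_sum s F w : (forall x, 0 <= F x) ->
  \sum_(z <- s) F z * jump (z - w) = Ec (fun m => \sum_(z <- s) F z * srw m (z - w)).
Proof.
move=> F0; rewrite Ec_sum //.
  by apply: eq_bigr => z _; rewrite EcZ //; apply: bdd_srw.
by move=> z _; apply: bddZ => //; apply: bdd_srw.
Qed.

Lemma jump_neighbor u : c 1 * srw 1 u <= jump u.
Proof. by apply: (Ec_ge_term c_ge0 c_sum); apply: bdd_srw. Qed.

End SubordinatedKernel.

(** * Bump functions under the simple random walk *)

Section Bumps.
Context {R : realType} {d : nat}.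
Hypothesis d_gt0 : (0 < d)%N.
Local Notation pt := ('rV[int]_d).
Local Notation nsq := (@nsq R d).
Implicit Types (u v w x y z : pt) (m : nat) (r : R).

Definition dot x y : R := \sum_i (x 0 i)%:~R * (y 0 i)%:~R.

Lemma nsqD x y : nsq (x + y) = nsq x + 2 * dot x y + nsq y.
Proof.
rewrite /nsq /dot mulr_sumr -!big_split; apply: eq_bigr => i _ /=.
by rewrite mxE rmorphD /=; ring.
Qed.

Lemma dotN x y : dot x (- y) = - dot x y.
Proof. by rewrite /dot -sumrN; apply: eq_bigr => i _; rewrite mxE rmorphN mulrN. Qed.

(** Cauchy-Schwarz, from the square of [nsq y] times the component of [x]
orthogonal to [y]. *)
Lemma dot_sqr_le x y : dot x y ^+ 2 <= nsq x * nsq y.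
Proof.
have [y0|yn0] := eqVneq (nsq y) 0.
  rewrite y0 mulr0 /dot big1 ?expr0n // => i _.
  have := @coord_le_nsq R d y i; rewrite y0 => h.
  have /eqP : (y 0 i)%:~R ^+ 2 == 0 :> R by rewrite eq_le h sqr_ge0.
  by move=> /eqP; rewrite sqrf_eq0 => /eqP ->; rewrite mulr0.
have y0 : 0 < nsq y by rewrite lt_neqAle eq_sym yn0 nsq_ge0.
have : 0 <= \sum_i ((x 0 i)%:~R * nsq y - dot x y * (y 0 i)%:~R) ^+ 2.
  by apply: sumr_ge0 => i _; apply: sqr_ge0.
have -> : \sum_i ((x 0 i)%:~R * nsq y - dot x y * (y 0 i)%:~R) ^+ 2 =
  nsq y ^+ 2 * nsq x + (- 2 * nsq y * dot x y * dot x y + dot x y ^+ 2 * nsq y).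
  rewrite -[nsq x]/(\sum_i (x 0 i)%:~R ^+ 2) -[_ * dot x y * dot x y]mulrA.
  transitivity (\sum_i (nsq y ^+ 2 * (x 0 i)%:~R ^+ 2 + (- 2 * nsq y * dot x y *
    ((x 0 i)%:~R * (y 0 i)%:~R) + dot x y ^+ 2 * (y 0 i)%:~R ^+ 2))).
    by apply: eq_bigr => i _; ring.
  by rewrite !big_split /= -!mulr_sumr mulrA.
have -> : nsq y ^+ 2 * nsq x + (- 2 * nsq y * dot x y * dot x y + dot x y ^+ 2 * nsq y) =
  nsq y * (nsq x * nsq y - dot x y ^+ 2) by ring.
by rewrite pmulr_rge0 // subr_ge0.
Qed.

Lemma nsq_step (e : 'I_d * bool) : nsq (step e) = 1.
Proof.
rewrite /nsq (bigD1 e.1) //= big1 => [|i ie]; last first.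
  by rewrite /step !mxE eqxx (negbTE ie) /= mulr0 expr0n.
rewrite /step !mxE !eqxx mulr1 addr0.
by case: (e.2); rewrite ?expr1 ?expr0 ?rmorphN ?sqrrN expr1n.
Qed.

(** The squared norm minus time is a martingale. *)
Lemma Ex_nsq m x : Ex m (fun u => nsq (x + u)) = nsq x + m%:R.
Proof.
elim: m x => [|m IH] x; first by rewrite /= !addr0.
transitivity (avg (fun e : 'I_d * bool => nsq (x + step e) + m%:R)).
  by apply: eq_avg => e; rewrite -IH; apply: eq_Ex => y; rewrite addrA addrAC.
have sym (f : 'I_d * bool -> R) : 2 * avg f = avg (fun e => f e + f (e.1, ~~ e.2)).
  by rewrite avgD avg_opp; ring.
apply: (@mulfI _ 2); first by rewrite pnatr_eq0.
rewrite sym -[RHS](avg_cst d_gt0); apply: eq_avg => e.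
rewrite stepN !nsqD dotN nsqN nsq_step -natr1; ring.
Qed.

(** The bump itself serves lower bounds of the generator, as its kink at the
boundary is convex; its square, of class C1 with bounded second derivative,
serves upper bounds. *)
Definition bump r w : R := Num.max 0 (1 - nsq w / r).

Lemma bump_ge0 r w : 0 <= bump r w.
Proof. by rewrite /bump le_max lexx. Qed.

Lemma bump_le1 r w : 0 < r -> bump r w <= 1.
Proof. by move=> r0; rewrite /bump ge_max ler01 /= gerBl divr_ge0 ?nsq_ge0 // ltW. Qed.

Lemma bump_eq0 r w : 0 < r -> r <= nsq w -> bump r w = 0.
Proof.
move=> r0 rw; apply/eqP; rewrite eq_le bump_ge0 andbT /bump ge_max lexx /=.
by rewrite subr_le0 ler_pdivlMr // mul1r.
Qed.

Lemma bump_ge r w : 1 - nsq w / r <= bump r w.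
Proof. by rewrite /bump le_max lexx orbT. Qed.

(** A maximum is convex up to the worst convexity defect of its members, which
here is the curvature of the quadratic one. *)
Lemma bump_midpoint r w u : 0 < r ->
  2 * bump r w <= bump r (w + u) + bump r (w - u) + 2 * (nsq u / r).
Proof.
move=> r0; have q0 : 0 <= nsq u / r by rewrite divr_ge0 ?nsq_ge0 // ltW.
have h1 := bump_ge r (w + u); have h2 := bump_ge r (w - u).
have h3 := bump_ge0 r (w + u); have h4 := bump_ge0 r (w - u).
rewrite {1}/bump; case: (leP 0 (1 - nsq w / r)) => h; last by lra.
move: h1 h2; rewrite !nsqD dotN nsqN !mulrDl; lra.
Qed.

(** The first order terms in [u] cancel between [w + u] and [w - u]; the second
order ones add up to at most [2 q ^+ 2 + 8 b ^+ 2] with [q = nsq u / r <= 1] and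
[b ^+ 2 <= 4 q]. *)
Lemma sqbump_midpoint r w u : 0 < r ->
  bump r (w + u) ^+ 2 + bump r (w - u) ^+ 2 <=
  2 * bump r w ^+ 2 + 34 * Num.min 1 (nsq u / r).
Proof.
move=> r0; have q0 : 0 <= nsq u / r by rewrite divr_ge0 ?nsq_ge0 // ltW.
have sq1 x : bump r x ^+ 2 <= 1 by rewrite exprn_ile1 ?bump_ge0 ?bump_le1.
have sq0 x : 0 <= bump r x ^+ 2 by apply: sqr_ge0.
have [q1|q1] := leP 1 (nsq u / r).
  by have := sq1 (w + u); have := sq1 (w - u); have := sq0 w; lra.
have [s4|s4] := leP (4 * r) (nsq w).
  have far v : nsq v = nsq u -> bump r (w + v) = 0.
    move=> vu; apply: bump_eq0 => //; have := @nsqD_le R d (w + v) (- v).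
    by rewrite addrK nsqN vu; move: q1; rewrite ltr_pdivrMr // mul1r; lra.
  rewrite !far ?nsqN // expr0n /=; have := sq0 w; lra.
pose t := 1 - nsq w / r; pose b := dot w u / r; pose q := nsq u / r.
have b2 : b ^+ 2 <= 4 * q.
  rewrite /b /q expr_div_n ler_pdivrMr ?exprn_gt0 //.
  have -> : 4 * (nsq u / r) * r ^+ 2 = 4 * r * nsq u by field; rewrite gt_eqF.
  by apply: le_trans (dot_sqr_le w u) _; rewrite ler_wpM2r ?nsq_ge0 // ltW.
have tp : 1 - nsq (w + u) / r = t - q - 2 * b by rewrite nsqD /t /q /b; ring.
have tm : 1 - nsq (w - u) / r = t - q + 2 * b by rewrite nsqD dotN nsqN /t /q /b; ring.
have B t' : 0 <= Num.max 0 t -> Num.max 0 t' ^+ 2 <=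
    Num.max 0 t ^+ 2 + 2 * Num.max 0 t * (t' - t) + (t' - t) ^+ 2.
  have s1 := sqr_ge0 t'; have s2 := sqr_ge0 (t' - t).
  by case: (leP 0 t) => ht _; case: (leP 0 t') => ht'; nra.
have T0 : 0 <= Num.max 0 t by rewrite le_max lexx.
have B1 := B (t - q - 2 * b) T0; have B2 := B (t - q + 2 * b) T0.
rewrite /bump tp tm -/t -/q; move: (Num.max 0 t) T0 B1 B2 => T T0 B1 B2.
have q1' : q <= 1 by apply: ltW.
have q0' : 0 <= q by [].
nra.
Qed.

Lemma Ex_min_nsq m r : 0 < r ->
  Ex m (fun u => Num.min 1 (nsq u / r)) <= Num.min 1 (r^-1 * m%:R).
Proof.
move=> r0; rewrite le_min; apply/andP; split.
  by rewrite -[leRHS](Ex_cst d_gt0 m); apply: ler_Ex => // u; rewrite ge_min lexx.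
have -> : r^-1 * m%:R = r^-1 * Ex m (fun u => nsq (0 + u)) by rewrite Ex_nsq nsq0 add0r.
rewrite -ExZ //; apply: ler_Ex => // u.
by rewrite add0r ge_min mulrC lexx orbT.
Qed.

Lemma Ex_sym m (F : pt -> R) w :
  2 * Ex m (fun u => F (w + u)) = Ex m (fun u => F (w + u) + F (w - u)).
Proof. by rewrite ExD // (Ex_opp m (fun u => F (w + u))); ring. Qed.

Lemma Ex_bump m r w : 0 < r ->
  bump r w <= Ex m (fun u => bump r (w + u)) + Num.min 1 (r^-1 * m%:R).
Proof.
move=> r0; have H : 2 * bump r w <= 2 * Ex m (fun u => bump r (w + u)) + 2 * (r^-1 * m%:R).
  have -> : r^-1 * m%:R = r^-1 * Ex m (fun u => nsq (0 + u)) by rewrite Ex_nsq nsq0 add0r.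
  rewrite Ex_sym -!ExZ // -ExD // -[leLHS](Ex_cst d_gt0 m); apply: ler_Ex => // u.
  by rewrite add0r [r^-1 * _]mulrC; apply: bump_midpoint.
have E0 : 0 <= Ex m (fun u => bump r (w + u)) by apply: Ex_ge0 => // u; apply: bump_ge0.
by have := bump_le1 w r0; rewrite minEle; case: ifP => _; lra.
Qed.

Lemma Ex_sqbump m r w : 0 < r ->
  Ex m (fun u => bump r (w + u) ^+ 2) <=
  bump r w ^+ 2 + 17 * Num.min 1 (r^-1 * m%:R).
Proof.
move=> r0; rewrite -(@ler_pM2l _ 2) // (Ex_sym m (fun u => bump r u ^+ 2)).
apply: (@le_trans _ _ (2 * bump r w ^+ 2 + 34 * Ex m (fun u => Num.min 1 (nsq u / r)))).
  rewrite -ExZ // -[2 * _](Ex_cst d_gt0 m) -ExD //; apply: ler_Ex => // u.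
  exact: sqbump_midpoint.
by have := Ex_min_nsq m r0; lra.
Qed.

End Bumps.

(** * The subordinate kernel at a given spatial scale *)

Section JumpKernelBounds.
Context {R : realType} {d : nat} (c : nat -> R) (phi : R -> R).
Hypothesis d_gt0 : (0 < d)%N.
Hypothesis c_ge0 : forall m, 0 <= c m.
Hypothesis c_sum : (\sum_(m <oo) (c m)%:E = 1)%E.
Hypothesis phi_laplace : forall l : R, 0 < l <= 1 ->
  (\sum_(m <oo) (c m * (1 - (1 - l) ^+ m))%:E = (phi l)%:E)%E.
Hypothesis phi1 : phi 1 = 1.
Context {g1 g2 a1 a2 : R}.
Hypothesis (g1_gt0 : 0 < g1) (g2_lt1 : g2 < 1) (a1_gt0 : 0 < a1) (a2_gt0 : 0 < a2).
Hypothesis scaling : forall r s : R, 0 < r -> r <= s -> s <= 1 ->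
  a1 * (s / r) `^ g1 <= phi s / phi r /\ phi s / phi r <= a2 * (s / r) `^ g2.
Local Notation pt := ('rV[int]_d).
Local Notation Ec := (Ec c).
Local Notation srw := (@srw R d).
Local Notation nsq := (@nsq R d).
Local Notation jump := (@jump R d c).
Local Notation rate := (rate phi).
Implicit Types (u v w x y z : pt) (s : seq pt) (m n : nat).

(** [srw_far] bounds the walk kernel by [n ^- d] times the truncated time, whose
expectation is at most twice the rate. *)
Lemma jump_far (del : R) : 0 < del -> exists2 C, 0 < C &
  forall n z, (0 < n)%N -> del * n%:R ^+ 2 <= nsq z ->
  jump z <= C / n%:R ^+ d * rate n.
Proof.
move=> del0; have [C C0 F] := @srw_far R d d_gt0 del del0.
exists (C * 2); first by rewrite mulr_gt0.
move=> n z n0 nz; have nd : 0 < C / n%:R ^+ d by rewrite divr_gt0 // exprn_gt0 // ltr0n.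
have bt : bdd (trunc_jump (n%:R ^- 2 : R)) by apply: bdd_trunc_jump; rewrite invr_ge0 exprn_ge0.
apply: (@le_trans _ _ (C / n%:R ^+ d * psi c (n%:R ^- 2))).
  rewrite -EcZ ?(ltW nd) //; apply: ler_Ec => //.
  - exact: bdd_srw.
  - by apply: bddZ => //; apply: ltW.
  by move=> m; rewrite /trunc_jump [_ * m%:R]mulrC; apply: F.
apply: (@le_trans _ _ (C / n%:R ^+ d * (2 * rate n))).
  by rewrite ler_pM2l //; apply: psi_rate.
by rewrite le_eqVlt; apply/orP; left; apply/eqP; ring.
Qed.

(** Restrict to jumps of the time change of order [n ^ 2].  The second term is the
kernel after one more step of the simple walk; the sum of both is insensitive
to parity. *)
Lemma jump_near : exists2 b, 0 < b & forall n u, (0 < n)%N ->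
  (forall i, (`|u 0%R i| <= 2 * n)%N) ->
  b / n%:R ^+ d * rate n <= jump u + Ec (fun m => srw m.+1 u).
Proof.
have [K K0 L] := @srw_lower R d d_gt0.
have [K' [b [b0 W]]] := jumps_window c_ge0 c_sum phi_laplace phi1 g1_gt0 g2_lt1 a1_gt0 a2_gt0 scaling K0.
have [e e0 E] := L K'.
exists (e * b); first exact: mulr_gt0.
move=> n u n0 un; have nd : 0 < e / n%:R ^+ d by rewrite divr_gt0 // exprn_gt0 // ltr0n.
rewrite -EcD //; [|exact: bdd_srw|exact: bdd_srwS].
apply: (@le_trans _ _ (e / n%:R ^+ d * Ec (fun m => (K * (n * n) <= m <= K' * (n * n))%N%:R))).
  apply: (@le_trans _ _ (e / n%:R ^+ d * (b * rate n))); last by rewrite ler_pM2l // W.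
  by rewrite le_eqVlt; apply/orP; left; apply/eqP; ring.
have bi : bdd (fun m => (K * (n * n) <= m <= K' * (n * n))%N%:R : R) by apply: bdd_bool.
rewrite -EcZ ?(ltW nd) //; apply: ler_Ec => //.
- by apply: bddZ => //; apply: ltW.
- by apply: bddD; [apply: bdd_srw|apply: bdd_srwS].
move=> m; case: andP => [[h1 h2]|_]; first by rewrite mulr1; apply: E.
by rewrite mulr0 addr_ge0 // srw_ge0.
Qed.

(** At times above [(K n) ^ 2] the walk has density at most [C / (K n) ^ d], so for
large [K] it is outside a box of side [2 n + 1] with probability at least one
half. *)
Lemma jump_row : exists2 b, 0 < b & forall n s w, (0 < n)%N -> uniq s ->
  {subset s <= box n} -> \sum_(z <- s) jump (z - w) <= 1 - b * rate n.
Proof.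
have [C C0 U] := @srw_upper R d d_gt0.
pose K := (Num.truncn (2 * C * 3 ^+ d)).+1.
have KP : 2 * C * 3 ^+ d <= K%:R ^+ d.
  apply: le_trans (ltW (truncnS_gt _)) _.
  by rewrite -[leLHS]expr1 ler_weXn2l // ler1n.
have KR : (0 : R) < K%:R by rewrite ltr0n.
have KK : (0 < K * K)%N by [].
have [b b0 B] := jumps_ge c_ge0 c_sum phi_laplace phi1 g2_lt1 a1_gt0 a2_gt0 scaling KK.
exists (b / 2); first by rewrite divr_gt0.
move=> n s w n0 us sn; have nR : (0 : R) < n%:R by rewrite ltr0n.
have -> : \sum_(z <- s) jump (z - w) = \sum_(z <- s) 1 * jump (z - w).
  by apply: eq_bigr => z _; rewrite mul1r.
rewrite jump_sum //.
have Hm m : \sum_(z <- s) 1 * srw m (z - w) + 2^-1 * (K * K * (n * n) <= m)%N%:R <= 1.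
  rewrite -big_distrr /= mul1r; case: leqP => h; last first.
    by rewrite mulr0 addr0; apply: sum_srw_le1.
  have Hs : \sum_(z <- s) srw m (z - w) <= (3 * n)%:R ^+ d * (C / (K * n)%:R ^+ d).
    apply: (@le_trans _ _ (\sum_(z <- s) C / (K * n)%:R ^+ d)).
      apply: ler_sum => z _; apply: U; first by rewrite muln_gt0 n0.
      by rewrite mulnACA.
    rewrite big_const_seq count_predT iter_addr_0 -[leLHS]mulr_natl ler_wpM2r //.
      by rewrite divr_ge0 ?exprn_ge0 // ltW.
    rewrite -natrX ler_nat; apply: leq_trans (uniq_leq_size us sn) _.
    rewrite size_box leq_exp2r //; move: n0; clear; lia.
  have : (3 * n)%:R ^+ d * (C / (K * n)%:R ^+ d) <= 2^-1 :> R.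
    rewrite !natrM !exprMn.
    have -> : 3 ^+ d * n%:R ^+ d * (C / (K%:R ^+ d * n%:R ^+ d)) = 2 * C * 3 ^+ d / K%:R ^+ d / 2.
      by field; rewrite !expf_neq0 ?gt_eqF.
    by rewrite ler_piMl // ler_pdivrMr ?exprn_gt0 // mul1r.
  by rewrite mulr1; lra.
have bs : bdd (fun m => \sum_(z <- s) 1 * srw m (z - w)).
  by apply: bdd_sum => z _; apply: bddZ => //; apply: bdd_srw.
have bi : bdd (fun m => (K * K * (n * n) <= m)%N%:R : R) by apply: bdd_bool.
have : Ec (fun m => \sum_(z <- s) 1 * srw m (z - w) + 2^-1 * (K * K * (n * n) <= m)%N%:R) <= 1.
  rewrite -[leRHS](Ec_cst c_ge0 c_sum ler01); apply: ler_Ec => //.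
    by apply: bddD => //; apply: bddZ.
  exact: bdd_cst.
rewrite EcD //; last exact: bddZ.
by rewrite EcZ //; have := B n n0; lra.
Qed.

Lemma psi_radius (rho : R) n : (0 < n)%N -> 0 < rho <= 1 ->
  psi c (rho * n%:R ^+ 2)^-1 <= 2 / rho * rate n.
Proof.
move=> n0 /andP[rho0 rho1].
have i0 : 0 <= n%:R ^- 2 :> R by rewrite invr_ge0 exprn_ge0.
have r1 : 1 <= rho^-1 by rewrite invf_ge1.
rewrite invfM; apply: le_trans (psi_scale c_ge0 c_sum i0 r1) _.
rewrite [2 / rho]mulrC -mulrA ler_pM2l ?invr_gt0 //.
exact: psi_rate.
Qed.

Let radius_gt0 (rho : R) n : (0 < n)%N -> 0 < rho <= 1 -> 0 < rho * n%:R ^+ 2.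
Proof. by move=> n0 /andP[h _]; rewrite mulr_gt0 // exprn_gt0 // ltr0n. Qed.

Lemma jump_sqbump (rho : R) n s w : (0 < n)%N -> 0 < rho <= 1 -> uniq s ->
  \sum_(z <- s) bump (rho * n%:R ^+ 2) z ^+ 2 * jump (z - w) <=
  bump (rho * n%:R ^+ 2) w ^+ 2 + 34 / rho * rate n.
Proof.
move=> n0 rho01 us; set r := rho * _.
have r0 : 0 < r by apply: radius_gt0.
have ri0 : 0 <= r^-1 by rewrite invr_ge0 ltW.
have bt : bdd (trunc_jump r^-1) by apply: bdd_trunc_jump.
rewrite jump_sum //; last by move=> x; apply: sqr_ge0.
apply: (@le_trans _ _ (Ec (fun m => bump r w ^+ 2 + 17 * trunc_jump r^-1 m))).
  apply: ler_Ec => //.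
  - by apply: bdd_sum => z _; apply: bddZ; [apply: sqr_ge0|apply: bdd_srw].
  - by apply: bddD; [apply: bdd_cst; apply: sqr_ge0|apply: bddZ].
  move=> m; apply: le_trans (Ex_sqbump d_gt0 m w r0).
  by apply: (@Ex_supp_le R d d_gt0 m s (fun z => bump r z ^+ 2)) => // x; apply: sqr_ge0.
rewrite EcD //; [|by apply: bdd_cst; apply: sqr_ge0|exact: bddZ].
rewrite Ec_cst ?sqr_ge0 // lerD2l EcZ //.
by have := psi_radius n0 rho01; rewrite -/r /psi; lra.
Qed.

Lemma jump_bump (rho : R) n s w : (0 < n)%N -> 0 < rho <= 1 -> uniq s ->
  (forall z, nsq z < rho * n%:R ^+ 2 -> z \in s) ->
  bump (rho * n%:R ^+ 2) w <=
  \sum_(z <- s) bump (rho * n%:R ^+ 2) z * jump (z - w) + 2 / rho * rate n.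
Proof.
move=> n0 rho01 us; set r := rho * _ => cov.
have r0 : 0 < r by apply: radius_gt0.
have ri0 : 0 <= r^-1 by rewrite invr_ge0 ltW.
have bt : bdd (trunc_jump r^-1) by apply: bdd_trunc_jump.
rewrite jump_sum //; last by move=> x; apply: bump_ge0.
have bs : bdd (fun m => \sum_(z <- s) bump r z * srw m (z - w)).
  by apply: bdd_sum => z _; apply: bddZ; [apply: bump_ge0|apply: bdd_srw].
apply: (@le_trans _ _ (Ec (fun m => \sum_(z <- s) bump r z * srw m (z - w)) + Ec (trunc_jump r^-1))).
  rewrite -EcD // -[leLHS](Ec_cst c_ge0 c_sum (bump_ge0 r w)); apply: ler_Ec => //.
  - by apply: bdd_cst; apply: bump_ge0.
  - exact: bddD.
  move=> m; rewrite -(@Ex_supp R d d_gt0 m s) //; first exact: Ex_bump.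
  by move=> x xs; apply: bump_eq0 => //; rewrite leNgt; apply/negP => /cov; apply/negP.
by rewrite lerD2l; apply: psi_radius.
Qed.

End JumpKernelBounds.

(** * Potential theory of a killed kernel on a finite set *)

Section FinitePotential.
Context {R : realType} {T : eqType} (bs : seq T) (K : T -> T -> R) (del : R).
Hypothesis bs_uniq : uniq bs.
Hypothesis K_ge0 : forall x y, 0 <= K x y.
Hypothesis del01 : 0 < del <= 1.
Hypothesis K_row : forall x, \sum_(y <- bs) K x y <= 1 - del.
Implicit Types (x y z w : T) (k : nat) (v g : T -> R).

(** The kernel killed outside [bs]: the intermediate points, not the end points,
are restricted. *)
Fixpoint kpow k x y : R :=
  if k is k'.+1 then \sum_(z <- bs) kpow k' x z * K z y else (x == y)%:R.

Definition green x y : R := fine (\sum_(k <oo) (kpow k x y)%:E)%E.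

Lemma kpow_ge0 k x y : 0 <= kpow k x y.
Proof.
elim: k y => [|k IH] y /=; first by rewrite ler0n.
by apply: sumr_ge0 => z _; rewrite mulr_ge0.
Qed.

Lemma sum_delta x (F : T -> R) : x \in bs ->
  \sum_(z <- bs) (x == z)%:R * F z = F x.
Proof.
move=> xb; rewrite (bigD1_seq x) //= eqxx mul1r big1 ?addr0 // => z.
by rewrite eq_sym => /negbTE ->; rewrite mul0r.
Qed.

(** The recursion adds steps at the end; this adds one at the beginning. *)
Lemma kpowSl k x y : x \in bs -> y \in bs ->
  kpow k.+1 x y = \sum_(z <- bs) K x z * kpow k z y.
Proof.
move=> xb; elim: k y => [|k IH] y yb.
  rewrite /= sum_delta // -[LHS](sum_delta (K x) yb).
  by apply: eq_bigr => z _; rewrite eq_sym mulrC.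
transitivity (\sum_(w <- bs) \sum_(z <- bs) K x z * kpow k z w * K w y).
  by apply: eq_big_seq => w wb; rewrite [X in X * _](IH w wb) mulr_suml.
rewrite exchange_big /=; apply: eq_bigr => z _; rewrite mulr_sumr.
by apply: eq_bigr => w _; rewrite mulrA.
Qed.

Lemma kpow_row k x : x \in bs -> \sum_(y <- bs) kpow k x y <= (1 - del) ^+ k.
Proof.
move=> xb; have /andP[d0 d1] := del01; elim: k => [|k IH].
  rewrite expr0 -[leRHS](sum_delta (fun=> 1) xb) le_eqVlt; apply/orP; left; apply/eqP.
  by apply: eq_bigr => y _; rewrite mulr1.
rewrite exchange_big /= exprSr; apply: le_trans (ler_wpM2r _ IH); last first.
  by rewrite subr_ge0.
rewrite mulr_suml; apply: ler_sum => z _; rewrite -mulr_sumr.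
by rewrite ler_wpM2l ?kpow_ge0.
Qed.

Lemma sum_kpow_le n x : x \in bs ->
  \sum_(k < n) \sum_(y <- bs) kpow k x y <= del^-1.
Proof.
move=> xb; have /andP[d0 d1] := del01.
apply: (@le_trans _ _ (\sum_(k < n) (1 - del) ^+ k)).
  by apply: ler_sum => k _; apply: kpow_row.
have := subrX1 (1 - del) n.
set s := \sum_(i < n) _ => H.
rewrite -(ler_pM2l d0) mulfV ?gt_eqF //.
have : 0 <= (1 - del) ^+ n by rewrite exprn_ge0 // subr_ge0.
by move: H; lra.
Qed.

Lemma nneseries_le (u : nat -> \bar R) (M : \bar R) : (forall k, (0 <= u k)%E) ->
  (forall n, (\sum_(0 <= k < n) u k <= M)%E) -> (\sum_(k <oo) u k <= M)%E.
Proof.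
move=> u0 uM; apply: lime_le; last by apply: nearW => n; apply: uM.
by apply: is_cvg_nneseries => k _ _.
Qed.

Lemma greenE x y : x \in bs -> y \in bs ->
  (green x y)%:E = (\sum_(k <oo) (kpow k x y)%:E)%E.
Proof.
move=> xb yb; have k0 k : (0 <= (kpow k x y)%:E)%E by rewrite lee_fin kpow_ge0.
rewrite /green fineK // ge0_fin_numE; last by apply: nneseries_ge0 => k _ _.
apply: (@le_lt_trans _ _ (del^-1)%:E); last exact: ltry.
apply: nneseries_le => // n; rewrite sumEFin lee_fin big_mkord.
apply: le_trans (sum_kpow_le n xb); apply: ler_sum => k _.
by rewrite (bigD1_seq y) //= lerDl sumr_ge0 // => z _; apply: kpow_ge0.
Qed.

Lemma green_ge0 x y : 0 <= green x y.
Proof.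
by apply/fine_ge0/nneseries_ge0 => k _ _; rewrite lee_fin kpow_ge0.
Qed.

Lemma kpow_series_recl x y :
  (\sum_(k <oo) (kpow k x y)%:E = (x == y)%:R%:E + \sum_(k <oo) (kpow k.+1 x y)%:E)%E.
Proof.
rewrite nneseries_recl => [|k _|//]; last by rewrite lee_fin kpow_ge0.
rewrite -nneseries_addn; last by move=> k; rewrite lee_fin kpow_ge0.
by congr (_ + _)%E; apply: eq_eseriesr => k _; rewrite addn1.
Qed.

Lemma green_right x y : x \in bs -> y \in bs ->
  green x y = (x == y)%:R + \sum_(z <- bs) green x z * K z y.
Proof.
move=> xb yb; apply: EFin_inj; rewrite greenE // kpow_series_recl EFinD; congr (_ + _)%E.
transitivity (\sum_(z <- bs) \sum_(k <oo) (kpow k x z * K z y)%:E)%E.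
  rewrite -nneseries_sum; last by move=> z k _; rewrite lee_fin mulr_ge0 ?kpow_ge0.
  by apply: eq_eseriesr => k _; rewrite sumEFin.
rewrite -sumEFin; apply: eq_big_seq => z zb.
rewrite mulrC EFinM greenE // -nneseriesZl; last by move=> k _; rewrite lee_fin kpow_ge0.
by apply: eq_eseriesr => k _; rewrite mulrC EFinM.
Qed.

Lemma green_left x y : x \in bs -> y \in bs ->
  green x y = (x == y)%:R + \sum_(z <- bs) K x z * green z y.
Proof.
move=> xb yb; apply: EFin_inj; rewrite greenE // kpow_series_recl EFinD; congr (_ + _)%E.
transitivity (\sum_(z <- bs) \sum_(k <oo) (K x z * kpow k z y)%:E)%E.
  rewrite -nneseries_sum; last by move=> z k _; rewrite lee_fin mulr_ge0 ?kpow_ge0.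
  by apply: eq_eseriesr => k _; rewrite sumEFin kpowSl.
rewrite -sumEFin; apply: eq_big_seq => z zb.
rewrite EFinM greenE // -nneseriesZl; last by move=> k _; rewrite lee_fin kpow_ge0.
by apply: eq_eseriesr => k _; rewrite EFinM.
Qed.

Definition potential g x : R := \sum_(z <- bs) green x z * g z.

Lemma potentialE g x : x \in bs ->
  potential g x = g x + \sum_(w <- bs) K x w * potential g w.
Proof.
move=> xb; transitivity (\sum_(z <- bs) ((x == z)%:R * g z + \sum_(w <- bs) K x w * (green w z * g z))).
  apply: eq_big_seq => z zb; rewrite green_left // mulrDl mulr_suml; congr (_ + _).
  by apply: eq_bigr => w _; rewrite mulrA.
rewrite big_split /= sum_delta // exchange_big /=; congr (_ + _).
by apply: eq_bigr => w _; rewrite -mulr_sumr.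
Qed.

Lemma potential_cst1_le x : x \in bs -> potential (fun=> 1) x <= del^-1.
Proof.
move=> xb; rewrite -lee_fin.
have -> : (potential (fun=> 1) x)%:E = (\sum_(k <oo) (\sum_(z <- bs) kpow k x z)%:E)%E.
  rewrite /potential -sumEFin.
  transitivity (\sum_(z <- bs) \sum_(k <oo) (kpow k x z)%:E)%E.
    by apply: eq_big_seq => z zb; rewrite mulr1 greenE.
  rewrite -nneseries_sum; last by move=> z k _; rewrite lee_fin kpow_ge0.
  by apply: eq_eseriesr => k _; rewrite sumEFin.
apply: nneseries_le => [k|n]; first by rewrite lee_fin sumr_ge0 // => z _; apply: kpow_ge0.
by rewrite sumEFin lee_fin big_mkord; apply: sum_kpow_le.
Qed.

Lemma potential_cst1_ge1 x : x \in bs -> 1 <= potential (fun=> 1) x.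
Proof.
move=> xb; rewrite potentialE // lerDl sumr_ge0 // => w _; rewrite mulr_ge0 // sumr_ge0 // => z _.
by rewrite mulr1 green_ge0.
Qed.

Lemma seq_argmin v (s : seq T) x : x \in s -> exists2 w, w \in s & forall z, z \in s -> v w <= v z.
Proof.
elim: s x => [//|a [|b s] IH] x _.
  by exists a; rewrite ?mem_head // => z; rewrite inE => /eqP ->.
have [w ws wmin] := IH b (mem_head _ _).
have [aw|wa] := leP (v a) (v w).
  exists a; rewrite ?mem_head // => z; rewrite inE => /orP[/eqP ->//|zs].
  exact: le_trans aw (wmin _ zs).
exists w; first by rewrite inE ws orbT.
by move=> z; rewrite inE => /orP[/eqP ->|/wmin //]; apply: ltW.
Qed.

(** A negative minimum is attained in [D]; there, averaging over the killed kernel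
gives at least [1 - del] times the minimum, which is strictly larger than the
minimum. *)
Lemma maximum_principle (D : pred T) v :
  (forall w, w \in bs -> ~~ D w -> 0 <= v w) ->
  (forall w, w \in bs -> D w -> \sum_(z <- bs) K w z * v z <= v w) ->
  forall w, w \in bs -> 0 <= v w.
Proof.
move=> vout vin w wb; have [w0 w0b w0min] := seq_argmin v wb.
apply: le_trans (w0min _ wb); rewrite leNgt; apply/negP => neg.
have Dw0 : D w0 by apply/negPn/negP => /(vout _ w0b); rewrite leNgt neg.
have : (1 - del) * v w0 <= v w0.
  apply: le_trans (vin _ w0b Dw0); apply: (@le_trans _ _ (\sum_(z <- bs) K w0 z * v w0)).
    by rewrite -mulr_suml ler_wnM2r // ltW.
  by rewrite !big_seq; apply: ler_sum => z zb; rewrite ler_wpM2l ?w0min.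
by have /andP[d0 _] := del01; nra.
Qed.

End FinitePotential.

(** * Off-diagonal bound for the Green function *)

Section BallGreenFunction.
Context {R : realType} {d : nat} (c : nat -> R) (phi : R -> R).
Hypothesis d_gt0 : (0 < d)%N.
Hypothesis c_ge0 : forall m, 0 <= c m.
Hypothesis c1_gt0 : 0 < c 1.
Hypothesis c_sum : (\sum_(m <oo) (c m)%:E = 1)%E.
Hypothesis phi_laplace : forall l : R, 0 < l <= 1 ->
  (\sum_(m <oo) (c m * (1 - (1 - l) ^+ m))%:E = (phi l)%:E)%E.
Hypothesis phi1 : phi 1 = 1.
Context {g1 g2 a1 a2 : R}.
Hypothesis (g1_gt0 : 0 < g1) (g2_lt1 : g2 < 1) (g2_ltd : g2 < d%:R / 2).
Hypothesis (a1_gt0 : 0 < a1) (a2_gt0 : 0 < a2).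
Hypothesis scaling : forall r s : R, 0 < r -> r <= s -> s <= 1 ->
  a1 * (s / r) `^ g1 <= phi s / phi r /\ phi s / phi r <= a2 * (s / r) `^ g2.
Local Notation pt := ('rV[int]_d).
Local Notation Ec := (Ec c).
Local Notation srw := (@srw R d).
Local Notation nsq := (@nsq R d).
Local Notation jump := (@jump R d c).
Local Notation rate := (rate phi).
Implicit Types (u v w x y z : pt) (s : seq pt) (m n k l : nat).

Definition jump_from x y : R := jump (y - x).

Lemma jump_from_ge0 x y : 0 <= jump_from x y.
Proof. exact: jump_ge0. Qed.

Lemma jump_fromC x y : jump_from x y = jump_from y x.
Proof. exact: jumpC. Qed.

Lemma nneseries_geometric (a q : R) : 0 <= a -> 0 <= q < 1 ->
  (\sum_(k <oo) (a * q ^+ k)%:E <= (a / (1 - q))%:E)%E.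
Proof.
move=> a0 /andP[q0 q1]; have p0 : 0 < 1 - q by rewrite subr_gt0.
apply: nneseries_le => [k|n]; first by rewrite lee_fin mulr_ge0 ?exprn_ge0.
rewrite sumEFin lee_fin big_mkord -mulr_sumr ler_wpM2l // -(ler_pM2l p0) mulfV ?gt_eqF //.
have := subrX1 q n; have := exprn_ge0 n q0; lra.
Qed.

(** If the walk kernel towards [y] is dominated by a mixture of geometric
sequences, then so are its iterates: a geometric sequence of ratio [q] is an
eigenfunction of time-changing by the jump law, with eigenvalue its generating
function at [q]. *)
Lemma kpow_geometric (bs : seq pt) (wt q : nat -> R) x y :
  uniq bs -> x \in bs -> y \in bs ->
  (forall i, 0 <= wt i) -> (forall i, 0 <= q i <= 1) ->
  (forall m, exists i, srw m (y - x) <= wt i * q i ^+ m) ->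
  forall k l, ((\sum_(z <- bs) kpow bs jump_from k x z * srw l (y - z))%:E <=
    \sum_(i <oo) (wt i * q i ^+ l * Ec (fun m => q i ^+ m) ^+ k)%:E)%E.
Proof.
move=> us xb yb w0 q01 dom.
have q0 i : 0 <= q i by have /andP[] := q01 i.
have bq i : bdd (fun m => q i ^+ m).
  by exists 1 => m; have /andP[h1 h2] := q01 i; rewrite exprn_ge0 ?exprn_ile1.
have E0 i : 0 <= Ec (fun m => q i ^+ m) by apply: Ec_ge0.
elim=> [|k IH] l.
  rewrite sum_delta //; have [i iP] := dom l.
  have t0 j : (0 <= (wt j * q j ^+ l * Ec (fun m => q j ^+ m) ^+ 0)%:E)%E.
    by rewrite lee_fin !mulr_ge0 ?exprn_ge0.
  apply: le_trans (nneseries_lim_ge i.+1 (fun j _ _ => t0 j)).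
  rewrite big_nat_recr //=.
  apply: (@le_trans _ _ (wt i * q i ^+ l * Ec (fun m => q i ^+ m) ^+ 0)%:E).
    by rewrite lee_fin expr0 mulr1.
  by rewrite leeDr // sume_ge0.
apply: (@le_trans _ _ (Ec (fun m => \sum_(z <- bs) kpow bs jump_from k x z * srw (m + l) (y - z)))%:E).
  rewrite lee_fin.
  have -> : \sum_(z <- bs) kpow bs jump_from k.+1 x z * srw l (y - z) =
      \sum_(w <- bs) kpow bs jump_from k x w * \sum_(z <- bs) srw l (y - z) * jump (z - w).
    rewrite (eq_bigr (fun z => \sum_(w <- bs) kpow bs jump_from k x w * (srw l (y - z) * jump (z - w)))); last first.
      by move=> z _; rewrite /= mulr_suml; apply: eq_bigr => w _; rewrite -mulrA [_ * srw _ _]mulrC.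
    by rewrite exchange_big; apply: eq_bigr => w _; rewrite mulr_sumr.
  have bd w : bdd (fun m => srw (m + l) (y - w)).
    by exists 1 => m; rewrite srw_ge0 ?srw_le1.
  have k0 w : 0 <= kpow bs jump_from k x w by apply: kpow_ge0 => u v; apply: jump_from_ge0.
  rewrite Ec_sum //; last by move=> w _; apply: bddZ.
  apply: ler_sum => w _; rewrite EcZ // ler_wpM2l //.
  rewrite jump_sum //; last by move=> z; apply: srw_ge0.
  apply: ler_Ec => //; first by apply: bdd_sum => z _; apply: bddZ; [apply: srw_ge0|apply: bdd_srw].
  move=> m; rewrite srw_add //.
  have := @Ex_supp_le R d d_gt0 m bs (fun z => srw l (y - z)) w us (fun z => srw_ge0 d_gt0 _ _).
  move=> /le_trans; apply.
  by apply: ler_Ex => // u; rewrite opprD addrA.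
rewrite EcE //; last first.
  apply: bdd_sum => z _; apply: bddZ.
    by apply: kpow_ge0 => u v; apply: jump_from_ge0.
  by exists 1 => m; rewrite srw_ge0 ?srw_le1.
apply: (@le_trans _ _ (\sum_(m <oo) \sum_(i <oo)
    (c m * (wt i * q i ^+ (m + l) * Ec (fun m => q i ^+ m) ^+ k))%:E)%E).
  apply: lee_nneseries => [m _ _|m _].
    rewrite lee_fin mulr_ge0 // sumr_ge0 // => z _; rewrite mulr_ge0 ?srw_ge0 //.
    by apply: kpow_ge0 => u v; apply: jump_from_ge0.
  rewrite (eq_eseriesr (g := fun i => ((c m)%:E *
     (wt i * q i ^+ (m + l) * Ec (fun m => q i ^+ m) ^+ k)%:E)%E)); last first.
    by move=> i _; rewrite EFinM.
  rewrite nneseriesZl; last by move=> i _; rewrite lee_fin !mulr_ge0 ?exprn_ge0.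
  by rewrite EFinM; apply: lee_wpmul2l; [rewrite lee_fin|exact: IH].
rewrite nneseries_interchange; last first.
  by move=> m i; rewrite lee_fin !mulr_ge0 ?exprn_ge0.
apply: lee_nneseries => [i _ _|i _].
  by apply: nneseries_ge0 => m _ _; rewrite lee_fin !mulr_ge0 ?exprn_ge0.
rewrite le_eqVlt; apply/orP; left; apply/eqP.
rewrite exprSr mulrA EFinM EcE // -nneseriesZl; last first.
  by move=> m _; rewrite lee_fin mulr_ge0 ?exprn_ge0.
apply: eq_eseriesr => m _; rewrite -EFinM; congr _%:E; rewrite exprD; ring.
Qed.

(** The eigenvalue at [1 - l] is [1 - phi l], and the powers of it add up to
[1 / phi l]. *)
Lemma green_geometric (bs : seq pt) (wt lam : nat -> R) (del : R) x y :
  uniq bs -> x \in bs -> y \in bs -> 0 < del <= 1 ->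
  (forall z, \sum_(w <- bs) jump_from z w <= 1 - del) ->
  (forall i, 0 <= wt i) -> (forall i, 0 < lam i <= 1) ->
  (forall m, exists i, srw m (y - x) <= wt i * (1 - lam i) ^+ m) ->
  ((green bs jump_from x y)%:E <= \sum_(i <oo) (wt i / phi (lam i))%:E)%E.
Proof.
move=> us xb yb del01 row w0 l01 dom.
have q01 i : 0 <= 1 - lam i <= 1.
  by have /andP[h1 h2] := l01 i; rewrite subr_ge0 h2 gerBl ltW.
have K0 := jump_from_ge0.
have H := kpow_geometric us xb yb w0 q01 dom.
have gE i : Ec (fun m => (1 - lam i) ^+ m) = 1 - phi (lam i).
  have b1 : bdd (fun m => (1 - lam i) ^+ m).
    by exists 1 => m; have /andP[h1 h2] := q01 i; rewrite exprn_ge0 ?exprn_ile1.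
  have b2 : bdd (fun m => 1 - (1 - lam i) ^+ m).
    by apply: bdd_expr_sub; have /andP[h1 h2] := l01 i; rewrite ltW.
  have := EcD c_ge0 c_sum b1 b2; rewrite -(phiE phi_laplace (l01 i)).
  rewrite (eq_Ec _ (g := fun=> 1)); last by move=> m; rewrite addrC subrK.
  by rewrite Ec_cst //; lra.
have phi_pos i : 0 < phi (lam i) := phi_gt0 phi1 a1_gt0 scaling (l01 i).
have phi_le1 i : 0 <= 1 - phi (lam i).
  by rewrite -gE; apply: Ec_ge0 => //; exists 1 => m; have /andP[h1 h2] := q01 i; rewrite exprn_ge0 ?exprn_ile1.
rewrite (greenE us K0 del01 row) //.
apply: (@le_trans _ _ (\sum_(k <oo) \sum_(i <oo) (wt i * (1 - phi (lam i)) ^+ k)%:E)%E).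
  apply: lee_nneseries => [k _ _|k _]; first by rewrite lee_fin kpow_ge0.
  have := H k 0%N; rewrite (eq_bigr (fun z => (y == z)%:R * kpow bs jump_from k x z)); last first.
    by move=> z _; rewrite srw0 subr_eq0 mulrC.
  rewrite sum_delta // => /le_trans; apply; apply: lee_nneseries => [i _ _|i _].
    by rewrite lee_fin !mulr_ge0 ?exprn_ge0 ?gE //; have /andP[] := q01 i.
  by rewrite expr0 mulr1 gE.
rewrite nneseries_interchange; last by move=> k i; rewrite lee_fin mulr_ge0 ?exprn_ge0.
apply: lee_nneseries => [i _ _|i _].
  by apply: nneseries_ge0 => k _ _; rewrite lee_fin mulr_ge0 ?exprn_ge0.
apply: le_trans (nneseries_geometric (w0 i) _) _; last by rewrite opprB addrC subrK.
by rewrite phi_le1 gtrBl phi_pos.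
Qed.

Lemma scale_index n m : (0 < n)%N -> (n * n <= m)%N ->
  exists i, (4 ^ i * (n * n) <= m < 4 ^ i.+1 * (n * n))%N.
Proof.
move=> n0 nm; have nn : (0 < n * n)%N by rewrite muln_gt0 n0.
have q0 : (0 < m %/ (n * n))%N by rewrite divn_gt0.
exists (trunc_log 4 (m %/ (n * n))).
have := trunc_log_bounds (isT : (1 < 4)%N) q0.
by rewrite -leq_divRL // -ltn_divLR.
Qed.

(** The weights decay like [2 ^- (i d)], and by the upper scaling condition
[1 / phi (lam i)] grows at most like [4 ^ (i g2)]; the ratio [q] is less than 1
because [g2 < d / 2]. *)
Lemma green_off (rho : R) : 0 < rho -> exists2 C, 0 < C &
  forall n (bs : seq pt) x y (del : R), (0 < n)%N -> uniq bs -> x \in bs -> y \in bs ->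
  0 < del <= 1 -> (forall z, \sum_(w <- bs) jump_from z w <= 1 - del) ->
  rho * n%:R ^+ 2 <= nsq (y - x) ->
  green bs jump_from x y <= C / (n%:R ^+ d * rate n).
Proof.
move=> rho0; have [C1 C10 U] := @srw_upper R d d_gt0.
have [C2 C20 F] := @srw_far R d d_gt0 rho rho0.
pose C := 2 ^+ d.+1 * (C1 + C2); have C0 : 0 < C by rewrite mulr_gt0 ?exprn_gt0 ?addr_gt0.
pose q : R := 4 `^ g2 / 2 ^+ d.
have t20 : 0 < 2 ^+ d :> R by rewrite exprn_gt0.
have q0 : 0 <= q by rewrite divr_ge0 ?powR_ge0 // ltW.
have q1 : q < 1.
  rewrite /q ltr_pdivrMr // mul1r.
  have -> : 2 ^+ d = 4 `^ (d%:R / 2) :> R.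
    have -> : 4 = 2 `^ 2 :> R by rewrite (powR_mulrn 2) //; ring.
    by rewrite -powRrM mulrC divfK ?pnatr_eq0 // powR_mulrn.
  have -> : d%:R / 2 = g2 + (d%:R / 2 - g2) :> R by ring.
  rewrite powRD; last by rewrite pnatr_eq0 implybT.
  rewrite ltr_pMr ?powR_gt0 //; rewrite -[ltLHS]/((fun=> 1) (d%:R / 2 - g2)) -powR1.
  by apply: gt0_ltr_powR; rewrite ?subr_gt0 ?nnegrE // ltr1n.
pose B := a2 * 2 `^ g2; have B0 : 0 < B by rewrite mulr_gt0 ?powR_gt0.
exists (C * B / (1 - q)); first by rewrite divr_gt0 ?(subr_gt0 q) // mulr_gt0.
move=> n bs x y del n0 us xb yb del01 row far.
have nR : (0 : R) < n%:R by rewrite ltr0n.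
have nd0 : 0 < n%:R ^+ d :> R by rewrite exprn_gt0.
have rn0 : 0 < rate n := rate_gt0 phi1 a1_gt0 scaling n0.
pose wt i : R := C / n%:R ^+ d * (2 ^- d) ^+ i.
(* The [i]-th sequence stays above one half up to time [4 ^ i * n ^ 2], so it
   covers the times between two consecutive scales. *)
pose lam i : R := (2 * 4 ^+ i * n%:R ^+ 2)^-1.
have wt0 i : 0 <= wt i by rewrite mulr_ge0 ?divr_ge0 ?exprn_ge0 ?invr_ge0 ?ltW.
have den i : 1 <= 2 * 4 ^+ i :> R.
  by rewrite -[leLHS]mulr1 ler_pM // ?ler1n // exprn_ege1 // ler1n.
have lamn i : lam i <= n%:R ^- 2.
  rewrite /lam lef_pV2 ?posrE ?mulr_gt0 ?exprn_gt0 //.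
  by rewrite ler_peMl ?exprn_ge0.
have lam0 i : 0 < lam i by rewrite invr_gt0 !mulr_gt0 ?exprn_gt0.
have /andP[in0 in1] := @inv_sqr01 R n n0.
have lam01 i : 0 < lam i <= 1 by rewrite lam0 (le_trans (lamn i)).
have halfq i m : (m <= 4 ^ i * (n * n))%N -> 2^-1 <= (1 - lam i) ^+ m.
  move=> mi; have l01 : 0 <= lam i <= 1 by rewrite ltW //; have /andP[] := lam01 i.
  apply: le_trans (expr_sub_ge m l01).
  suff : lam i * m%:R <= 2^-1 by lra.
  rewrite /lam mulrC ler_pdivrMr ?mulr_gt0 ?exprn_gt0 //.
  have -> : 2^-1 * (2 * 4 ^+ i * n%:R ^+ 2) = (4 ^ i * (n * n))%:R :> R.
    by rewrite !natrM natrX; field.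
  by rewrite ler_nat.
have dom m : exists i, srw m (y - x) <= wt i * (1 - lam i) ^+ m.
  have [mn|nm] := ltnP m (n * n).
    exists 0%N; apply: (@le_trans _ _ (C2 / n%:R ^+ d)).
      apply: le_trans (F m n (y - x) n0 far) _.
      by rewrite ler_piMr ?divr_ge0 ?(ltW C20) ?(ltW nd0) // ge_min lexx.
    apply: (@le_trans _ _ (wt 0%N * 2^-1)).
      rewrite /wt expr0 mulr1 mulrAC ler_pM2r ?invr_gt0 // /C exprSr.
      have : 1 <= 2 ^+ d :> R by rewrite exprn_ege1 // ler1n.
      move: C10 C20; nra.
    by rewrite ler_wpM2l ?wt0 // halfq // expn0 mul1n ltnW.
  have [i /andP[im mi]] := scale_index n0 nm; exists i.+1.
  apply: (@le_trans _ _ (C1 / (2 ^ i * n)%:R ^+ d)).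
    apply: U; first by rewrite muln_gt0 expn_gt0 n0.
    by rewrite mulnACA -expnMn.
  apply: (@le_trans _ _ (wt i.+1 * 2^-1)).
    have -> : wt i.+1 * 2^-1 = (C1 + C2) / (2 ^ i * n)%:R ^+ d.
      rewrite /wt /C natrM exprMn natrX -exprM mulnC exprM exprVn (exprS _ i) (exprS _ d).
      by field; rewrite !expf_neq0 ?gt_eqF // expf_neq0 ?gt_eqF.
    by rewrite ler_pM2r ?invr_gt0 ?exprn_gt0 ?ltr0n ?muln_gt0 ?expn_gt0 ?n0 // lerDl ltW.
  by rewrite ler_wpM2l ?wt0 // halfq // ltnW.
have G := green_geometric us xb yb del01 row wt0 lam01 dom.
rewrite -lee_fin; apply: le_trans G _.
have A0 : 0 <= C * B / (n%:R ^+ d * rate n).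
  by apply: ltW; apply: divr_gt0; apply: mulr_gt0.
have q01 : 0 <= q < 1 by rewrite q0.
apply: le_trans (_ : (C * B / (n%:R ^+ d * rate n) / (1 - q))%:E <= _)%E; last first.
  by rewrite lee_fin mulrAC.
apply: le_trans (nneseries_geometric A0 q01).
apply: lee_nneseries => [i _ _|i _].
  by rewrite lee_fin divr_ge0 ?wt0 // ltW // (phi_gt0 phi1 a1_gt0 scaling (lam01 i)).
have pl : 0 < phi (lam i) := phi_gt0 phi1 a1_gt0 scaling (lam01 i).
have [_] := scaling (lam0 i) (lamn i) in1; rewrite -/(rate n).
have -> : n%:R ^- 2 / lam i = 2 * 4 ^+ i.
  by rewrite /lam invrK mulrC mulfK // expf_neq0 // gt_eqF.
have pE : (4 ^+ i) `^ g2 = (4 `^ g2) ^+ i :> R.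
  by rewrite -!powR_mulrn ?powR_ge0 // powRAC.
rewrite powRM // ?exprn_ge0 // pE => H.
rewrite lee_fin.
have -> : C * B / (n%:R ^+ d * rate n) * q ^+ i = wt i * (a2 * (2 `^ g2 * (4 `^ g2) ^+ i) / rate n).
  rewrite /wt /q expr_div_n exprVn /B.
  by field; rewrite !gt_eqF ?exprn_gt0.
by rewrite ler_wpM2l ?wt0 // ler_pdivlMr // mulrC.
Qed.

End BallGreenFunction.

(** * Green function and exit time of a ball *)

Section BallComparison.
Context {R : realType} {d : nat} (c : nat -> R) (phi : R -> R).
Hypothesis d_gt0 : (0 < d)%N.
Hypothesis c_ge0 : forall m, 0 <= c m.
Hypothesis c1_gt0 : 0 < c 1.
Hypothesis c_sum : (\sum_(m <oo) (c m)%:E = 1)%E.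
Hypothesis phi_laplace : forall l : R, 0 < l <= 1 ->
  (\sum_(m <oo) (c m * (1 - (1 - l) ^+ m))%:E = (phi l)%:E)%E.
Hypothesis phi1 : phi 1 = 1.
Context {g1 g2 a1 a2 : R}.
Hypothesis (g1_gt0 : 0 < g1) (g2_lt1 : g2 < 1) (g2_ltd : g2 < d%:R / 2).
Hypothesis (a1_gt0 : 0 < a1) (a2_gt0 : 0 < a2).
Hypothesis scaling : forall r s : R, 0 < r -> r <= s -> s <= 1 ->
  a1 * (s / r) `^ g1 <= phi s / phi r /\ phi s / phi r <= a2 * (s / r) `^ g2.
Local Notation pt := ('rV[int]_d).
Local Notation Ec := (Ec c).
Local Notation srw := (@srw R d).
Local Notation nsq := (@nsq R d).
Local Notation jump := (@jump R d c).
Local Notation rate := (rate phi).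
Implicit Types (u v w x y z : pt) (s : seq pt) (m n k l : nat).

Definition ball n : seq pt := [seq z <- box n | nsq z < n%:R ^+ 2].

Lemma ball_uniq n : uniq (ball n).
Proof. by rewrite filter_uniq // box_uniq. Qed.

Lemma ball_box n : {subset ball n <= box n}.
Proof. by move=> z; rewrite mem_filter => /andP[]. Qed.

Lemma mem_ball n z : (z \in ball n) = (nsq z < n%:R ^+ 2).
Proof.
rewrite mem_filter; case: (ltP (nsq z) _) => //= zn; apply/mem_box => i.
have := le_lt_trans (@coord_le_nsq R d z i) zn.
rewrite -[X in X < _ -> _](real_normK (num_real _)) ltr_pXn2r ?nnegrE //.
by rewrite -intr_norm -[n%:R]/(n%:~R) ltr_int; move: (z 0 i) => a; clear; lia.
Qed.

(** The comparison distinguishes the core [|z| < 0.2 n] containing [x], the inner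
ball [|z| < 0.3 n], outside of which the maximum principle is applied, and the
support [|z| < 0.4 n] of the bump.  Points of two such regions separated by
[0.1 n] are at squared distance at least [n ^ 2 / 200]. *)
Section OneBall.
Context (n : nat).
Hypothesis n_gt0 : (0 < n)%N.
Local Notation bs := (ball n).
Local Notation K := (@jump_from R d c).
Local Notation G := (green bs K).
Local Notation eta := (potential bs K (fun=> 1)).
Local Notation nn := (n%:R ^+ 2 : R).
Context (b : R) (b_gt0 : 0 < b).
Hypothesis row_gap : forall z, \sum_(w <- bs) K z w <= 1 - b * rate n.
Hypothesis gap_le1 : b * rate n <= 1.

Let us := ball_uniq n.
Let K0 x y : 0 <= K x y. Proof. exact: jump_from_ge0. Qed.
Let nR : (0 : R) < n%:R. Proof. by rewrite ltr0n. Qed.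
Let nn0 : 0 < nn. Proof. by rewrite exprn_gt0. Qed.
Let nd0 : 0 < n%:R ^- d :> R. Proof. by rewrite invr_gt0 exprn_gt0. Qed.
Let nP : 0 < n%:R ^+ d :> R. Proof. exact: exprn_gt0. Qed.
Let c256 : 0 < 256 / 49 :> R. Proof. lra. Qed.
Let rn0 : 0 < rate n := rate_gt0 phi1 a1_gt0 scaling n_gt0.
Let del01 : 0 < b * rate n <= 1. Proof. by rewrite mulr_gt0. Qed.

Let eta_le w : w \in bs -> eta w <= (b * rate n)^-1.
Proof. exact: (potential_cst1_le us K0 del01 row_gap). Qed.

Let eta_ge1 w : w \in bs -> 1 <= eta w.
Proof. exact: (potential_cst1_ge1 us K0 del01 row_gap). Qed.

Let etaE w : w \in bs -> \sum_(z <- bs) K w z * eta z = eta w - 1.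
Proof. by move=> wb; rewrite [in RHS](potentialE us K0 del01 row_gap) // addrAC subrr add0r. Qed.

Let greenK x w : x \in bs -> w \in bs ->
  G x w = (x == w)%:R + \sum_(z <- bs) K w z * G x z.
Proof.
move=> xb wb; rewrite (green_right us K0 del01 row_gap) //; congr (_ + _).
by apply: eq_bigr => z _; rewrite jump_fromC // mulrC.
Qed.

Let green_sum x : \sum_(z <- bs) G x z = eta x.
Proof. by apply: eq_bigr => z _; rewrite mulr1. Qed.

Let max_principle := maximum_principle K0 del01 row_gap.

Local Notation far := (fun w => 9%:R / 100%:R * nn <= nsq w).
Local Notation mid := (fun w => 4%:R / 100%:R * nn <= nsq w).

Let rho : R := 16%:R / 100%:R.
Let rho01 : 0 < rho <= 1. Proof. by rewrite /rho; apply/andP; split; lra. Qed.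
Local Notation F := (fun w => bump (rho * nn) w ^+ 2).
Local Notation CF := (34 / rho).

Let CF0 : 0 < CF. Proof. by rewrite divr_gt0 //; case/andP: rho01. Qed.

Let KF w : \sum_(z <- bs) K w z * F z <= F w + CF * rate n.
Proof.
have := jump_sqbump d_gt0 c_ge0 c_sum phi_laplace w n_gt0 rho01 us.
rewrite (eq_bigr (fun z => K w z * F z)) // => z _.
by rewrite /jump_from mulrC.
Qed.

(* [49 / 256] is the square of [1 - 9 / 16]. *)
Let F_core w : ~~ far w -> 49 / 256 <= F w.
Proof.
rewrite -ltNge => wf; have h := bump_ge (rho * nn) w.
have : 7 / 16 <= 1 - nsq w / (rho * nn).
  have : nsq w / (rho * nn) <= 9 / 16.
    rewrite ler_pdivrMr ?mulr_gt0 //.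
    by move: wf; rewrite /rho; lra.
  lra.
move: h; move: (bump _ _) => t; nra.
Qed.

Let F_out w : rho * nn <= nsq w -> F w = 0.
Proof.
move=> wr /=; rewrite bump_eq0 ?expr0n // mulr_gt0 //.
by case/andP: rho01.
Qed.

(** Maximum principle for [A * eta + A' * F - h] outside the inner ball, with [h]
the Green function cut off on the core: [A' * F] dominates [h] inside, and
[A * eta] compensates both the generator of [A' * F] and the mass that [h]
misses on the core. *)
Lemma green_upper_ball (CG CJ : R) x y : 0 < CG -> 0 < CJ ->
  (forall u v, u \in bs -> v \in bs -> 1%:R / 200%:R * nn <= nsq (v - u) ->
    G u v <= CG / (n%:R ^+ d * rate n)) ->
  (forall u, 1%:R / 200%:R * nn <= nsq u -> jump u <= CJ / n%:R ^+ d * rate n) ->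
  x \in bs -> y \in bs -> nsq x < 1%:R / 100%:R * nn -> rho * nn <= nsq y ->
  G x y <= (256 / 49 * CG * CF + CJ / b) / n%:R ^+ d * eta y.
Proof.
move=> CG0 CJ0 HG HJ xb yb xn yn.
pose h w := if mid w then G x w else 0.
pose A' := 256 / 49 * CG / (n%:R ^+ d * rate n).
pose A := (256 / 49 * CG * CF + CJ / b) / n%:R ^+ d.
have A'0 : 0 < A' by apply: divr_gt0; apply: mulr_gt0.
have A0 : 0 < A.
  by apply: divr_gt0 => //; apply: addr_gt0; [apply: mulr_gt0 => //; apply: mulr_gt0|apply: divr_gt0].
have AE : A = A' * (CF * rate n) + CJ / n%:R ^+ d * rate n * (b * rate n)^-1.
  by rewrite /A /A'; field; rewrite !gt_eqF ?exprn_gt0 //; case/andP: rho01.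
have h0 w : 0 <= h w by rewrite /h; case: ifP => // _; apply: green_ge0.
have far_mid w : far w -> mid w by move=> /= hw; apply: le_trans hw; move: nn0; lra.
pose v w := A * eta w + A' * F w - h w.
have sumE w : \sum_(z <- bs) K w z * v z =
    A * (\sum_(z <- bs) K w z * eta z) + A' * (\sum_(z <- bs) K w z * F z) - \sum_(z <- bs) K w z * h z.
  rewrite !mulr_sumr -big_split -sumrB; apply: eq_bigr => z _ /=; rewrite /v; ring.
have vb : 0 <= v y.
  apply: (max_principle (D := far)) yb => w wb.
    move=> nfar; have hw : h w <= A' * F w.
      rewrite /h; case: ifP => [wm|_]; last by rewrite mulr_ge0 ?(ltW A'0) // sqr_ge0.
      apply: (@le_trans _ _ (A' * (49 / 256))); last by rewrite ler_pM2l // F_core.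
      have -> : A' * (49 / 256) = CG / (n%:R ^+ d * rate n).
        by rewrite /A'; field; rewrite !gt_eqF ?exprn_gt0.
      apply: HG => //; have := @nsqD_le R d (w - x) x; rewrite subrK; lra.
    have : 0 <= A * eta w by rewrite mulr_ge0 ?(ltW A0) // (le_trans ler01) ?eta_ge1.
    by rewrite /v; lra.
  move=> wf; rewrite sumE etaE //.
  have hE : h w = \sum_(z <- bs) K w z * G x z.
    rewrite /h far_mid // greenK //; case: eqP => [xw|_]; last by rewrite add0r.
    by move: wf xn; rewrite xw; move: nn0; lra.
  have hK : \sum_(z <- bs) K w z * G x z <= \sum_(z <- bs) K w z * h z + CJ / n%:R ^+ d * rate n * (b * rate n)^-1.
    apply: (@le_trans _ _ (\sum_(z <- bs) (K w z * h z + CJ / n%:R ^+ d * rate n * G x z))).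
      apply: ler_sum => z _; rewrite /h; case: ifP => zm.
        rewrite lerDl mulr_ge0 ?green_ge0 //.
        by rewrite !mulr_ge0 // ltW.
      rewrite mulr0 add0r ler_wpM2r ?green_ge0 // /jump_from; apply: HJ.
      have := @nsqD_le R d (w - z) z; rewrite subrK -(opprB w z) nsqN.
      by move/negbT: zm; rewrite -ltNge; move: wf; lra.
    rewrite big_split /= lerD2l -mulr_sumr green_sum ler_wpM2l ?eta_le //.
    by rewrite !mulr_ge0 // ltW.
  have := ler_wpM2l (ltW A'0) (KF w).
  rewrite mulrDr /v; move: hK AE; rewrite -hE.
  move: (CJ / _ * _ * _) (A' * (CF * rate n)) => J1 J2; lra.
have yf : far y by move: yn nn0 => /=; rewrite /rho; lra.
have Fy : bump (rho * nn) y ^+ 2 = 0 := F_out yn.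
by move: vb; rewrite /v /h Fy (far_mid y yf) /A; lra.
Qed.

(** The potential of the core, that is, the expected time spent there, dominates
a bump supported on the core, as its generator there is [-1] and that of the
bump is at least of order [- rate n]; and the bump is at least [3 / 4] at [x]. *)
Lemma green_core_mass x : x \in bs -> nsq x < 1%:R / 100%:R * nn ->
  3 / 200 <= rate n * \sum_(z <- bs) G x z * (~~ mid z)%:R.
Proof.
move=> xb xn; pose g z : R := (~~ mid z)%:R.
have r01 : 0 < (4%:R / 100%:R : R) <= 1 by apply/andP; split; lra.
pose f w := bump (4%:R / 100%:R * nn) w.
have cov z : nsq z < 4%:R / 100%:R * nn -> z \in bs.
  by rewrite mem_ball => zn; apply: lt_le_trans zn _; move: nn0; lra.
pose C := 2 / (4%:R / 100%:R) * rate n : R.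
have C0 : 0 < C by rewrite mulr_gt0 // divr_gt0 //; lra.
have pot0 w : 0 <= potential bs K g w.
  by rewrite sumr_ge0 // => z _; rewrite mulr_ge0 ?green_ge0 // ler0n.
have H : 0 <= C * potential bs K g x - f x.
  apply: (max_principle (v := fun w => C * potential bs K g w - f w) (D := fun w => ~~ mid w)) xb => w wb.
    move=> /negPn wm; have -> : f w = 0 by apply: bump_eq0 wm; case/andP: r01 => r0 _; apply: mulr_gt0.
    by rewrite subr0; apply: mulr_ge0 => //; apply: ltW.
  move=> wm; have -> : \sum_(z <- bs) K w z * (C * potential bs K g z - f z) =
      C * (\sum_(z <- bs) K w z * potential bs K g z) - \sum_(z <- bs) K w z * f z.
    by rewrite mulr_sumr -sumrB; apply: eq_bigr => z _; ring.
  have E := potentialE us K0 del01 row_gap g wb.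
  have gw : g w = 1 by rewrite /g wm.
  have := jump_bump d_gt0 c_ge0 c_sum phi_laplace w n_gt0 r01 us cov.
  rewrite (eq_bigr (fun z => K w z * f z)) -/f -/C; last first.
    by move=> z _; rewrite /jump_from mulrC.
  have CE : C * potential bs K g w = C + C * \sum_(z <- bs) K w z * potential bs K g z.
    by rewrite [X in C * X]E gw mulrDr mulr1.
  by rewrite CE -/(f w); lra.
have : 3 / 4 <= f x.
  apply: le_trans (bump_ge _ _).
  have : nsq x / (4%:R / 100%:R * nn) <= 1 / 4.
    rewrite ler_pdivrMr; [lra|by rewrite mulr_gt0 //; lra].
  lra.
by move: H; rewrite /C /potential; set s := \sum_(z <- _) _; lra.
Qed.

(** Maximum principle for [h - A1 * eta + A2 * F] outside the inner ball, with [h]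
the Green function cut off on the inner ball: there [A2 * F] dominates
[A1 * eta], and outside, the mass of the Green function on the core, carried by
one jump, compensates the terms in [A1] and [A2]. *)
Lemma green_lower_ball (cJ cM : R) x y : cM = 2^-1 * c 1 * cJ * (3 / 200) ->
  (15 <= n)%N -> 0 < cJ ->
  (forall u, (forall i, (`|u 0%R i| <= 2 * n)%N) ->
    cJ / n%:R ^+ d * rate n <= jump u + Ec (fun m => srw m.+1 u)) ->
  x \in bs -> y \in bs -> nsq x < 1%:R / 100%:R * nn -> rho * nn <= nsq y ->
  Num.min (cM / 2) (b * (49 / 256) * (cM / (2 * CF))) / n%:R ^+ d * eta y <= G x y.
Proof.
move=> cME n15 cJ0 HJ xb yb xn yn.
have cM0 : 0 < cM by rewrite cME; apply: mulr_gt0; [apply: mulr_gt0 => //; apply: mulr_gt0|lra].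
have c1le : c 1 <= 1.
  have := @Ec_ge_term R c c_ge0 c_sum 1 (fun=> 1) (bdd_cst ler01).
  by rewrite mulr1 Ec_cst.
have nn225 : 225 <= nn by rewrite -[225]/(225%:R) expr2 -natrM ler_nat (@leq_mul 15 15).
pose h w := if far w then G x w else 0.
(* The kernel bound holds for the jump kernel plus its composition with one step
   of the simple walk.  The extra step is absorbed by the Green function, which is
   at least [c 1] times its average over neighbours; for [n >= 15] it does not
   lead from the core out of the inner ball. *)
have inner w : w \in bs -> cM / n%:R ^+ d <= \sum_(z <- bs) K w z * (G x z - h z).
  move=> wb; pose inn := [seq z <- bs | ~~ far z].
  have uinn : uniq inn by rewrite filter_uniq.
  pose J z' := \sum_(z <- inn) srw 1 (z - z') * jump (z - w).
  have JE z' : z' \in bs -> ~~ mid z' -> J z' = Ec (fun m => srw m.+1 (z' - w)).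
    move=> z'b z'm; rewrite /J jump_sum //; last by move=> z; apply: srw_ge0.
    apply: eq_Ec => m; rewrite -(@Ex_supp R d d_gt0 m inn (fun z => srw 1 (z - z'))) //; last first.
      move=> z zi; rewrite srwS; rewrite (eq_avg (h2 := fun=> 0)) ?avg_cst // => e.
      rewrite srw0; case: eqP => // ze; move: zi; rewrite mem_filter mem_ball -!ltNge.
      have -> : z = z' + step e by apply/eqP; rewrite -subr_eq0 opprD addrA ze.
      have := @nsqD_le R d z' (step e); rewrite nsq_step.
      by move: z'm; rewrite -ltNge => h1 h2; case/negP; apply/andP; split; lra.
    rewrite -[m.+1]addn1 srw_add //; apply: eq_Ex => u.
    by rewrite -[RHS]srwN; congr (srw 1 _); rewrite !opprB addrA [u + w]addrC.
  have hK z : 0 <= K w z * (G x z - h z).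
    rewrite mulr_ge0 // /h; case: ifP => _; first by rewrite subrr.
    by rewrite subr0 green_ge0.
  have S1 : \sum_(z' <- bs) G x z' * (~~ mid z')%:R * jump (z' - w) <= \sum_(z <- bs) K w z * (G x z - h z).
    apply: ler_sum => z _; case: (boolP (mid z)) => zm /=; first by rewrite mulr0 mul0r.
    rewrite mulr1 /h; case: ifP => [zf|_]; last by rewrite subr0 mulrC.
    by move: zm; rewrite -ltNge; move: zf nn0; lra.
  have S2 : c 1 * \sum_(z' <- bs) G x z' * (~~ mid z')%:R * J z' <= \sum_(z <- bs) K w z * (G x z - h z).
    apply: (@le_trans _ _ (\sum_(z <- inn) jump (z - w) * G x z)); last first.
      rewrite big_filter big_mkcond /=; apply: ler_sum => z _; case: ifP => zf; last exact: hK.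
      by rewrite /h (negbTE zf) subr0.
    have -> : c 1 * \sum_(z' <- bs) G x z' * (~~ mid z')%:R * J z' =
        \sum_(z <- inn) jump (z - w) * (c 1 * \sum_(z' <- bs) G x z' * (~~ mid z')%:R * srw 1 (z - z')).
      rewrite mulr_sumr.
      rewrite (eq_bigr (fun z' => \sum_(z <- inn) c 1 * (G x z' * (~~ mid z')%:R * (srw 1 (z - z') * jump (z - w))))); last first.
        by move=> z' _; rewrite /J !mulr_sumr.
      rewrite exchange_big /=; apply: eq_bigr => z _; rewrite !mulr_sumr.
      by apply: eq_bigr => z' _; ring.
    rewrite !big_seq; apply: ler_sum => z; rewrite mem_filter => /andP[_ zb].
    rewrite ler_wpM2l ?jump_ge0 // greenK //; apply: ler_wpDl; first by rewrite ler0n.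
    rewrite mulr_sumr; apply: ler_sum => z' _.
    apply: (@le_trans _ _ (G x z' * (c 1 * srw 1 (z - z')))).
      have -> : c 1 * (G x z' * (~~ mid z')%:R * srw 1 (z - z')) =
        G x z' * (c 1 * srw 1 (z - z')) * (~~ mid z')%:R by ring.
      rewrite ler_piMr ?lern1 ?leq_b1 //.
      by apply: mulr_ge0; [apply: green_ge0|apply: mulr_ge0 => //; apply: srw_ge0].
    rewrite mulrC ler_wpM2r ?green_ge0 //.
    by rewrite jump_fromC //; apply: jump_neighbor.
  have J0 z' : 0 <= J z' by rewrite sumr_ge0 // => z _; rewrite mulr_ge0 ?srw_ge0 ?jump_ge0.
  have S3 : c 1 * (cJ / n%:R ^+ d * rate n) * \sum_(z' <- bs) G x z' * (~~ mid z')%:R <=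
     \sum_(z' <- bs) G x z' * (~~ mid z')%:R * jump (z' - w) +
     c 1 * \sum_(z' <- bs) G x z' * (~~ mid z')%:R * J z'.
    rewrite !mulr_sumr -big_split /= !big_seq; apply: ler_sum => z' z'b.
    case: (boolP (mid z')) => zm /=; first by rewrite !(mulr0, mul0r) addr0.
    rewrite !mulr1; have zw i : (`|(z' - w)%R 0%R i| <= 2 * n)%N.
      have /mem_box/(_ i) := ball_box z'b; have /mem_box/(_ i) := ball_box wb.
      rewrite !mxE; move: (z' 0 i) (w 0 i) => p q; clear; lia.
    have HJ' := HJ _ zw; rewrite -JE // in HJ'.
    have j0 : 0 <= jump (z' - w) by apply: jump_ge0.
    have : c 1 * (cJ / n%:R ^+ d * rate n) <= jump (z' - w) + c 1 * J z'.
      apply: (@le_trans _ _ (c 1 * (jump (z' - w) + J z'))); first by rewrite ler_pM2l.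
      by rewrite mulrDr lerD2r ler_piMl.
    move=> /(ler_wpM2l (green_ge0 bs K0 x z')).
    by rewrite mulrDr mulrC [G x z' * (c 1 * _)]mulrCA.
  have M := green_core_mass xb xn.
  have : cM / n%:R ^+ d <= 2^-1 * (c 1 * (cJ / n%:R ^+ d * rate n) * \sum_(z' <- bs) G x z' * (~~ mid z')%:R).
    have -> : 2^-1 * (c 1 * (cJ / n%:R ^+ d * rate n) * \sum_(z' <- bs) G x z' * (~~ mid z')%:R) =
      2^-1 * c 1 * cJ / n%:R ^+ d * (rate n * \sum_(z' <- bs) G x z' * (~~ mid z')%:R) by ring.
    have -> : cM / n%:R ^+ d = 2^-1 * c 1 * cJ / n%:R ^+ d * (3 / 200) by rewrite cME; ring.
    by rewrite ler_pM2l // !mulr_gt0.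
  by move: S1 S2 S3; lra.
pose Q := cM / (2 * CF); rewrite -/Q.
have Q0 : 0 < Q by apply: divr_gt0 => //; apply: mulr_gt0.
have b49 : 0 < b * (49 / 256) by apply: mulr_gt0 => //; lra.
have cM2 : 0 < cM / 2 by apply: divr_gt0.
pose A2 := Q / (n%:R ^+ d * rate n).
pose A1 := Num.min (cM / 2) (b * (49 / 256) * Q) / n%:R ^+ d.
have A20 : 0 < A2 by apply: divr_gt0 => //; apply: mulr_gt0.
have A10 : 0 <= A1.
  by apply: ltW; apply: divr_gt0 => //; rewrite lt_min cM2; apply: mulr_gt0.
have A1a : A1 + A2 * (CF * rate n) <= cM / n%:R ^+ d.
  have -> : A2 * (CF * rate n) = cM / 2 / n%:R ^+ d.
    by rewrite /A2 /Q; field; rewrite !gt_eqF //; case/andP: rho01.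
  have : A1 <= cM / 2 / n%:R ^+ d by rewrite ler_pM2r // ge_min lexx.
  have -> : cM / n%:R ^+ d = cM / 2 / n%:R ^+ d + cM / 2 / n%:R ^+ d.
    by field; rewrite gt_eqF.
  lra.
have A1b : A1 * (b * rate n)^-1 <= A2 * (49 / 256).
  have -> : A2 * (49 / 256) = (b * (49 / 256) * Q) / n%:R ^+ d * (b * rate n)^-1.
    by rewrite /A2; field; rewrite !gt_eqF.
  by rewrite ler_pM2r ?invr_gt0 ?mulr_gt0 // ler_pM2r // ge_min lexx orbT.
pose v w := h w - A1 * eta w + A2 * F w.
have sumE w : \sum_(z <- bs) K w z * v z =
    \sum_(z <- bs) K w z * h z - A1 * (\sum_(z <- bs) K w z * eta z) + A2 * (\sum_(z <- bs) K w z * F z).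
  rewrite !mulr_sumr -sumrB -big_split; apply: eq_bigr => z _ /=; rewrite /v; ring.
have vb : 0 <= v y.
  apply: (max_principle (D := far)) yb => w wb.
    move=> nf; rewrite /v /h (negbTE nf) sub0r addrC subr_ge0.
    apply: (@le_trans _ _ (A1 * (b * rate n)^-1)); first by rewrite ler_wpM2l // eta_le.
    by apply: le_trans A1b _; rewrite ler_pM2l // F_core.
  move=> wf; rewrite sumE etaE //.
  have hE : h w = \sum_(z <- bs) K w z * G x z.
    rewrite /h wf greenK //; case: eqP => [xw|_]; last by rewrite add0r.
    by move: wf xn; rewrite xw; move: nn0; lra.
  have := inner w wb; rewrite (eq_bigr (fun z => K w z * G x z - K w z * h z)); last first.
    by move=> z _; rewrite mulrBr.
  rewrite sumrB -hE => I.
  have := ler_wpM2l (ltW A20) (KF w); rewrite mulrDr.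
  rewrite /v; move: I A1a; move: (A2 * (CF * rate n)) (cM / _) => J1 J2; lra.
have yf : far y by move: yn nn0 => /=; rewrite /rho; lra.
have Fy : bump (rho * nn) y ^+ 2 = 0 := F_out yn.
by move: vb; rewrite /v Fy /h yf mulr0 addr0 subr_ge0.
Qed.

(** Walk with unit jumps from [x] to the origin and from there to [y]; both
shortest paths stay in the ball. *)
Lemma green_path x y : x \in bs -> y \in bs ->
  (c 1 / (2 * d%:R)) ^+ (l1 x + l1 y) <= G x y.
Proof.
have dR : (0 : R) < 2 * d%:R by rewrite mulr_gt0 // ltr0n.
set e0 := c 1 / _; have e00 : 0 < e0 by rewrite divr_gt0.
have nb (e : 'I_d * bool) : e0 <= jump (step e).
  apply: le_trans (jump_neighbor d_gt0 c_ge0 c_sum (step e)).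
  rewrite /e0 ler_pM2l // -[leLHS]mulr1 srwS /avg ler_pM2l ?invr_gt0 //.
  rewrite (bigD1 e) //= subrr srw0 eqxx lerDl sumr_ge0 // => e' _; exact: srw_ge0.
have closer u : u \in bs -> u != 0 ->
    exists2 e, (l1 (u - step e)%R).+1 = l1 u & u - step e \in bs.
  move=> ub u0; have [e [eu le]] := l1_step u0; exists e => //.
  move: ub; rewrite !mem_ball; apply: le_lt_trans; apply: ler_sum => i _.
  rewrite -(real_normK (num_real ((u - step e) 0 i)%:~R)) -(real_normK (num_real (u 0 i)%:~R)).
  rewrite lerXn2r ?nnegrE // -!intr_norm ler_int.
  by have := le i; move: ((u - step e) 0 i) (u 0 i) => p q; clear; lia.
have G0 u v : 0 <= G u v by apply: green_ge0.
have zb : 0 \in bs by rewrite mem_ball nsq0.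
have H1 : forall k u, l1 u = k -> u \in bs -> e0 ^+ k <= G u 0.
  elim=> [|k IH] u lu ub.
    rewrite (l1_eq0 lu) expr0 (green_left us K0 del01 row_gap) // eqxx lerDl.
    by apply: sumr_ge0 => z _; rewrite mulr_ge0.
  have u0 : u != 0.
    by apply/eqP => u0; move: lu; rewrite u0 /l1 big1 // => i _; rewrite mxE.
  have [e eu eb] := closer u ub u0.
  rewrite (green_left us K0 del01 row_gap) //; apply: ler_wpDl; first by rewrite ler0n.
  rewrite (bigD1_seq (u - step e)) //=; apply: ler_wpDr.
    by apply: sumr_ge0 => z _; rewrite mulr_ge0.
  rewrite exprS ler_pM ?exprn_ge0 ?(ltW e00) //.
    by rewrite /jump_from addrAC subrr add0r jumpN.
  by apply: IH => //; move: eu; rewrite lu => -[].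
move=> xb; move: {2}(l1 y) (erefl (l1 y)) => k; elim: k y => [|k IH] y ly yb.
  by rewrite ly addn0 (l1_eq0 ly); apply: H1.
have y0 : y != 0.
  by apply/eqP => y0; move: ly; rewrite y0 /l1 big1 // => i _; rewrite mxE.
have [e ey eb] := closer y yb y0.
rewrite greenK //; apply: ler_wpDl; first by rewrite ler0n.
rewrite (bigD1_seq (y - step e)) //=; apply: ler_wpDr.
  by apply: sumr_ge0 => z _; rewrite mulr_ge0.
have ek : l1 (y - step e)%R = k by move: ey; rewrite ly => -[].
rewrite ly addnS exprS ler_pM ?exprn_ge0 ?(ltW e00) //.
  by rewrite /jump_from addrAC subrr add0r jumpN.
by have := IH _ ek eb; rewrite ek.
Qed.

End OneBall.

(** For [n < 15] the Green function is bounded below by [green_path] and the exit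
time is bounded above, so any constant that works for these finitely many
radii is enough. *)
Theorem ball_green_comparison : exists C6 C7 : R, [/\ 0 < C6, 0 < C7 &
  forall n, (0 < n)%N -> exists2 del, 0 < del <= 1 &
  (forall z, \sum_(w <- ball n) @jump_from R d c z w <= 1 - del) /\
  forall x y, nsq x < 1 / 100 * n%:R ^+ 2 -> 16 / 100 * n%:R ^+ 2 <= nsq y ->
  y \in ball n ->
  let G := green (ball n) (@jump_from R d c) in
  let eta := potential (ball n) (@jump_from R d c) (fun=> 1) in
  C6 / n%:R ^+ d * eta y <= G x y /\ G x y <= C7 / n%:R ^+ d * eta y].
Proof.
have [b b0 B] := jump_row d_gt0 c_ge0 c_sum phi_laplace phi1 g2_lt1 a1_gt0 a2_gt0 scaling.
have r200 : 0 < 1%:R / 200%:R :> R by lra.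
have [CG CG0 HG] := green_off d_gt0 c_ge0 c_sum phi_laplace phi1 g2_ltd a1_gt0 a2_gt0 scaling r200.
have [CJ CJ0 HJ] := jump_far d_gt0 c_ge0 c_sum phi_laplace r200.
have [cJ cJ0 HcJ] := jump_near d_gt0 c_ge0 c_sum phi_laplace phi1 g1_gt0 g2_lt1 a1_gt0 a2_gt0 scaling.
pose rho : R := 16%:R / 100%:R; pose CF := 34 / rho.
have CF0 : 0 < CF by rewrite divr_gt0 // /rho; lra.
pose cM := 2^-1 * c 1 * cJ * (3 / 200).
have cM0 : 0 < cM by apply: mulr_gt0; [apply: mulr_gt0 => //; apply: mulr_gt0|lra].
pose CL := Num.min (cM / 2) (b * (49 / 256) * (cM / (2 * CF))).
have CL0 : 0 < CL.
  rewrite lt_min divr_gt0 //= mulr_gt0 ?mulr_gt0 //.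
  by rewrite invr_gt0 mulr_gt0.
pose e0 := c 1 / (2 * d%:R); have e00 : 0 < e0 by rewrite divr_gt0 // mulr_gt0 // ltr0n.
have e01 : e0 <= 1.
  rewrite ler_pdivrMr ?mulr_gt0 ?ltr0n // mul1r.
  have := @Ec_ge_term R c c_ge0 c_sum 1 (fun=> 1) (bdd_cst ler01).
  rewrite mulr1 Ec_cst // => /le_trans; apply; rewrite -natrM ler1n muln_gt0 d_gt0 //.
have r15 : 0 < rate 15 := rate_gt0 phi1 a1_gt0 scaling (n := 15) isT.
pose CS := e0 ^+ (30 * d) * (b * (a1 * rate 15)).
have CS0 : 0 < CS by rewrite !mulr_gt0 // exprn_gt0.
exists (Num.min CL CS), (256 / 49 * CG * CF + CJ / b); split.
- by rewrite lt_min CL0.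
- by apply: addr_gt0; [apply: mulr_gt0 => //; apply: mulr_gt0 => //; lra|apply: divr_gt0].
move=> n n0; have nR : (0 : R) < n%:R by rewrite ltr0n.
have nd0 : 0 < n%:R ^+ d :> R by rewrite exprn_gt0.
have rn0 : 0 < rate n := rate_gt0 phi1 a1_gt0 scaling n0.
have row z : \sum_(w <- ball n) @jump_from R d c z w <= 1 - b * rate n.
  by apply: B => //; [apply: ball_uniq|apply: ball_box].
have zb : 0 \in ball n by rewrite mem_ball nsq0 exprn_gt0.
have gap1 : b * rate n <= 1.
  have := row 0; have : 0 <= \sum_(w <- ball n) @jump_from R d c 0 w.
    by apply: sumr_ge0 => w _; apply: jump_from_ge0.
  lra.
have del01 : 0 < b * rate n <= 1 by rewrite mulr_gt0.
exists (b * rate n) => //; split=> // x y xn yn yb G eta.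
have xb : x \in ball n.
  by rewrite mem_ball; apply: lt_le_trans xn _; have := exprn_gt0 2 nR; lra.
have K0 := @jump_from_ge0.
have eta0 : 0 <= eta y.
  apply: le_trans ler01 _; apply: (potential_cst1_ge1 (ball_uniq n) _ del01 row yb).
  exact: jump_from_ge0.
split; last first.
  apply: green_upper_ball => //.
    by move=> u v ub vb uv; apply: (HG n (ball n) u v (b * rate n)) => //; apply: ball_uniq.
  by move=> u; apply: HJ.
have [n15|n15] := leqP 15 n.
  apply: le_trans (green_lower_ball n0 b0 row gap1 (erefl cM) n15 cJ0 _ xb yb xn yn); last by move=> u; apply: HcJ.
  by rewrite ler_wpM2r // ler_pM2r ?invr_gt0 // ge_min lexx.
apply: le_trans (green_path n0 b0 row gap1 xb yb).
have etaU : eta y <= (b * rate n)^-1.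
  by apply: (potential_cst1_le (ball_uniq n) _ del01 row yb); apply: jump_from_ge0.
have l1n u : u \in ball n -> (l1 u <= 15 * d)%N.
  move=> /ball_box /mem_box ub; rewrite mulnC -[X in (_ <= X * _)%N]card_ord -sum_nat_const.
  by apply: leq_sum => i _; apply: leq_trans (ub i) (ltnW n15).
have ln : (l1 x + l1 y <= 30 * d)%N.
  by apply: leq_trans (leq_add (l1n x xb) (l1n y yb)) _; rewrite -mulnDl.
apply: (@le_trans _ _ (e0 ^+ (30 * d))); last by rewrite ler_wiXn2l // ltW.
have rn : a1 * rate 15 <= rate n.
  have l0 : 0 < 15%:R ^- 2 :> R by rewrite invr_gt0 exprn_gt0.
  have ln' : 15%:R ^- 2 <= n%:R ^- 2 :> R.
    by rewrite lef_pV2 ?posrE ?exprn_gt0 // lerXn2r ?nnegrE // ler_nat ltnW.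
  have /andP[_ in1] := @inv_sqr01 R n n0.
  have [+ _] := scaling l0 ln' in1; rewrite ler_pdivlMr //; apply: le_trans.
  rewrite ler_pM2r // ler_peMr ?(ltW a1_gt0) //.
  rewrite -[leLHS](powRr0 (n%:R ^- 2 / 15%:R ^- 2)) ler_powR ?(ltW g1_gt0) //.
  by rewrite ler_pdivlMr // mul1r.
apply: (@le_trans _ _ (CS * (b * rate n)^-1)).
  apply: ler_pM => //; first by rewrite divr_ge0 ?(ltW nd0) // le_min !ltW.
  rewrite ler_pdivrMr //; apply: (@le_trans _ _ CS); first by rewrite ge_min lexx orbT.
  by rewrite ler_peMr ?(ltW CS0) // exprn_ege1 // ler1n.
rewrite /CS -mulrA ler_piMr ?exprn_ge0 ?(ltW e00) //.
by rewrite ler_pdivrMr ?mulr_gt0 // mul1r ler_pM2l.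
Qed.

End BallComparison.

(** * The jump law of a complete Bernstein function *)

Section JumpWeights.
Context {R : realType}.
Implicit Types (mu : {measure set (measurableTypeR R) -> \bar R}) (t l : R) (m : nat).

Local Notation halfline := (`]0%R, +oo[%classic : set (measurableTypeR R)).

Definition poisson_weight m t : R := t ^+ m / m`!%:R * expR (- t).

Lemma poisson_weight_ge0 m t : 0 <= t -> 0 <= poisson_weight m t.
Proof. by move=> t0; rewrite mulr_ge0 ?expR_ge0 // divr_ge0 ?exprn_ge0. Qed.

Lemma measurable_poisson_weight m :
  measurable_fun halfline (poisson_weight m : measurableTypeR R -> R).
Proof.
apply: measurable_funM.
  by apply: measurable_funM; [apply: exprn_measurable|apply: measurable_cst].
by apply: measurableT_comp; [apply: measurable_expR|apply: oppr_measurable].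
Qed.

(** The generating function of the Poisson law of parameter [t] at [1 - l]. *)
Lemma poisson_laplace t l : 0 <= t -> 0 <= l <= 1 ->
  (\sum_(m <oo) (poisson_weight m t * (1 - (1 - l) ^+ m))%:E =
   (1 - expR (- (l * t)))%:E)%E.
Proof.
move=> t0 l01; apply/cvg_lim => //.
pose u n : R := expR (- t) * (series (exp_coeff t) n - series (exp_coeff ((1 - l) * t)) n).
rewrite (_ : (fun n => _) = EFin \o u); last first.
  apply/funext => n /=; rewrite sumEFin /u /series /= -sumrB mulr_sumr; congr _%:E.
  by apply: eq_bigr => m _; rewrite /poisson_weight /exp_coeff /= exprMn; ring.
apply: cvg_EFin; first by apply: nearW.
rewrite (_ : 1 - expR (- (l * t)) = expR (- t) * (expR t - expR ((1 - l) * t))); last first.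
  rewrite mulrBr -!expRD; congr (_ - expR _); last ring.
  by rewrite addNr expR0.
apply: cvgM; first exact: cvg_cst.
by apply: cvgB; apply: is_cvg_series_exp_coeff.
Qed.

Let halfline_measurable : measurable halfline.
Proof. exact: measurable_itv. Qed.

Let halflineP t : halfline t -> 0 < t.
Proof. by rewrite /= in_itv /= andbT. Qed.

(** The integral defining [jump_weight mu 0] may diverge, and the time change
jumps by positive amounts only. *)
Definition positive_weight mu m : \bar R := if m is 0 then 0%E else jump_weight mu m.

Lemma jump_weight_ge0 mu m : (0 <= jump_weight mu m)%E.
Proof.
apply: integral_ge0 => t /halflineP t0.
by rewrite lee_fin; apply: poisson_weight_ge0; apply: ltW.
Qed.

Lemma positive_weight_ge0 mu m : (0 <= positive_weight mu m)%E.
Proof. by case: m => [|m] //; apply: jump_weight_ge0. Qed.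

(** Integrate [poisson_laplace] against the Levy measure, term by term. *)
Lemma jump_weight_laplace phi mu (hphi : complete_bernstein phi mu) l : 0 < l <= 1 ->
  (\sum_(m <oo) (positive_weight mu m * (1 - (1 - l) ^+ m)%:E) = (phi l)%:E)%E.
Proof.
move=> /andP[l0 l1]; have l01 : 0 <= l <= 1 by rewrite ltW.
have f0 m : 0 <= 1 - (1 - l) ^+ m.
  by rewrite subr_ge0 exprn_ile1 ?subr_ge0 // gerBl ltW.
rewrite (cb_repr hphi) //.
transitivity (\int[mu]_(t in halfline) \sum_(m <oo) (poisson_weight m t * (1 - (1 - l) ^+ m))%:E)%E; last first.
  by apply: eq_integral => t; rewrite inE => /halflineP t0; apply: poisson_laplace; rewrite // ltW.
rewrite integral_nneseries //; first last.
- by move=> m t /halflineP t0; rewrite lee_fin mulr_ge0 // poisson_weight_ge0 // ltW.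
- move=> m; apply/measurable_EFinP; apply: measurable_funM; last exact: measurable_cst.
  exact: measurable_poisson_weight.
apply: eq_eseriesr => m _.
transitivity (\int[mu]_(t in halfline) ((1 - (1 - l) ^+ m)%:E * (poisson_weight m t)%:E))%E; last first.
  by apply: eq_integral => t _; rewrite -EFinM mulrC.
rewrite ge0_integralZl_EFin //; first last.
- by apply/measurable_EFinP; apply: measurable_poisson_weight.
- by move=> t /halflineP t0; rewrite lee_fin poisson_weight_ge0 // ltW.
by case: m => [|m] /=; rewrite ?expr0 ?subrr ?mule0 ?mul0e // muleC.
Qed.

Lemma positive_weight_sum phi mu (hphi : complete_bernstein phi mu) : phi 1 = 1 ->
  (\sum_(m <oo) positive_weight mu m = 1)%E.
Proof.
move=> phi1; have := jump_weight_laplace hphi (l := 1); rewrite ltr01 lexx phi1 => /(_ isT) <-.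
apply: eq_eseriesr => -[|m] _; first by rewrite mul0e.
by rewrite subrr expr0n /= subr0 mule1.
Qed.

Lemma positive_weight_fin phi mu (hphi : complete_bernstein phi mu) m : phi 1 = 1 ->
  positive_weight mu m \is a fin_num.
Proof.
move=> phi1; rewrite ge0_fin_numE ?positive_weight_ge0 //.
apply: (@le_lt_trans _ _ 1%E); last exact: ltry.
rewrite -(positive_weight_sum hphi phi1).
apply: le_trans (nneseries_lim_ge m.+1 _); last by move=> k _ _; apply: positive_weight_ge0.
by rewrite big_nat_recr //= leeDr // sume_ge0 // => k _; apply: positive_weight_ge0.
Qed.

(** A vanishing weight at 1 would make the measure null on the half-line. *)
Lemma jump_weight1_gt0 phi mu (hphi : complete_bernstein phi mu) : phi 1 = 1 ->
  (0 < jump_weight mu 1)%E.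
Proof.
move=> phi1; rewrite lt_neqAle jump_weight_ge0 andbT; apply/negP => /eqP w0.
have mw : measurable_fun halfline (fun t : measurableTypeR R => (poisson_weight 1 t)%:E).
  by apply/measurable_EFinP; apply: measurable_poisson_weight.
have := ae_eq_integral_abs mu halfline_measurable mw.
have -> : (\int[mu]_(t in halfline) `|(poisson_weight 1 t)%:E| = 0)%E.
  rewrite [RHS]w0; apply: eq_integral => t; rewrite inE => /halflineP t0.
  by rewrite gee0_abs // lee_fin poisson_weight_ge0 // ltW.
case=> /(_ erefl) ae0 _.
have := cb_repr hphi ltr01; rewrite phi1 => H1.
suff : (\int[mu]_(t in halfline) (1 - expR (- (1 * t)))%:E = 0)%E by rewrite -H1 => -[] /eqP; rewrite oner_eq0.
rewrite -[RHS](@integral0 _ _ _ mu halfline); apply: ae_eq_integral => //.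
  apply/measurable_EFinP; apply: measurable_funB; first exact: measurable_cst.
  apply: measurableT_comp; first exact: measurable_expR.
  by apply: measurableT_comp; [apply: oppr_measurable|apply: mulrl_measurable].
apply: filterS ae0 => t H Dt; have t0 := halflineP Dt; have := H Dt.
rewrite /poisson_weight expr1 divr1 => -[] /eqP.
by rewrite mulf_eq0 gt_eqF //= gt_eqF // expR_gt0.
Qed.

End JumpWeights.

(** * Maps to discrete spaces *)

Section DiscreteMaps.
Context {Omega : Type} (M : set (set Omega)).
Hypothesis M_sigma : sigma_algebra setT M.

Definition discrete_map {V : Type} (f : Omega -> V) := forall B : set V, M (f @^-1` B).

Lemma sigmaC A : M A -> M (~` A).
Proof. by case: M_sigma => _ H _ /H; rewrite setTD. Qed.

Lemma sigma_bigcup (A : nat -> set Omega) : (forall k, M (A k)) -> M (\bigcup_k A k).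
Proof. by case: M_sigma => _ _; apply. Qed.

Lemma sigmaT : M setT.
Proof. by rewrite -setC0; apply: sigmaC; case: M_sigma. Qed.

Lemma sigmaU A B : M A -> M B -> M (A `|` B).
Proof.
move=> MA MB; rewrite -bigcup2E; apply: sigma_bigcup => -[|[|k]] //=.
by case: M_sigma.
Qed.

Lemma sigmaI A B : M A -> M B -> M (A `&` B).
Proof. by move=> MA MB; rewrite -[_ `&` _]setCK setCI; apply/sigmaC/sigmaU; apply: sigmaC. Qed.

Lemma discrete_comp {V W : Type} (f : Omega -> V) (h : V -> W) :
  discrete_map f -> discrete_map (h \o f).
Proof. by move=> mf B; apply: (mf (h @^-1` B)). Qed.

Lemma discrete_pair {V : countType} {W : Type} (f : Omega -> V) (g : Omega -> W) :
  discrete_map f -> discrete_map g -> discrete_map (fun w => (f w, g w)).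
Proof.
move=> mf mg B.
pose A k : set Omega := if @choice.unpickle V k is Some v then
  (f @^-1` [set v]) `&` (g @^-1` [set x | B (v, x)]) else set0.
have -> : (fun w => (f w, g w)) @^-1` B = \bigcup_k A k.
  apply/seteqP; split => [w Bw|w [k _]].
    by exists (choice.pickle (f w)) => //; rewrite /A choice.pickleK.
  by rewrite /A; case: choice.unpickle => [v|//] [/= ->].
apply: sigma_bigcup => k; rewrite /A; case: choice.unpickle => [v|].
  by apply: sigmaI; [apply: mf|apply: mg].
by case: M_sigma.
Qed.

Lemma discrete_at_random_index {V : Type} (N : Omega -> nat) (Y : nat -> Omega -> V) :
  discrete_map N -> (forall k, discrete_map (Y k)) -> discrete_map (fun w => Y (N w) w).
Proof.
move=> mN mY B.
have -> : (fun w => Y (N w) w) @^-1` B = \bigcup_k ((N @^-1` [set k]) `&` (Y k @^-1` B)).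
  apply/seteqP; split => [w Bw|w [k _] [/= <-] //].
  by exists (N w).
by apply: sigma_bigcup => k; apply: sigmaI; [apply: mN|apply: mY].
Qed.

End DiscreteMaps.

(** * Splitting an event by the value of a discrete variable *)

Section ProbabilityPartitions.
Context {R : realType} {disp : measure_display} {Omega : measurableType disp}.
Variable P : probability Omega R.

Lemma prob_split (A B : set Omega) : measurable A -> measurable B ->
  (P A = P (A `&` B) + P (A `&` ~` B))%E.
Proof. by move=> mA mB; rewrite (measureDI P mA mB) setDE addeC. Qed.

Lemma prob_partition_nat (A : set Omega) (N : Omega -> nat) : measurable A ->
  (forall k, measurable (N @^-1` [set k])) ->
  P A = (\sum_(k <oo) P (A `&` N @^-1` [set k]))%E.
Proof.
move=> mA mN; rewrite -(measure_semi_bigcup _ (A := fun k => A `&` N @^-1` [set k])).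
- congr (P _); apply/seteqP; split => [w Aw|w [k _] []//].
  by exists (N w).
- by move=> k; apply: measurableI.
- by move=> i j _ _ [w [[_ /= <-] [_ /= <-]]].
- by apply: bigcupT_measurable => k; apply: measurableI.
Qed.

Lemma prob_partition_seq {V : eqType} (A : set Omega) (f : Omega -> V) (s : seq V) :
  uniq s -> measurable A -> (forall v, measurable (f @^-1` [set v])) ->
  (forall w, A w -> f w \in s) ->
  P A = (\sum_(v <- s) P (A `&` f @^-1` [set v]))%E.
Proof.
elim: s A => [|v s IH] A /= us mA mf As.
  rewrite big_nil (_ : A = set0) ?measure0 //.
  by apply/seteqP; split => // w /As.
case/andP: us => vs us; rewrite big_cons (prob_split mA (mf v)); congr (_ + _)%E.
rewrite (IH (A `&` ~` (f @^-1` [set v]))) //.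
- apply: eq_big_seq => u us'; congr (P _); apply/seteqP; split => w /=.
    by move=> [[Aw _] ->].
  by move=> [Aw fu]; split => //; split => // fv; move: vs; rewrite -fv fu us'.
- by apply: measurableI => //; apply: measurableC.
move=> w [Aw /= fv]; have := As w Aw; rewrite inE => /orP[/eqP fwv|//].
by case: fv.
Qed.

(** The values in [s] already have total mass one, so the rest is negligible. *)
Lemma prob_partition_as {V : eqType} (A : set Omega) (f : Omega -> V) (s : seq V) :
  uniq s -> measurable A -> (forall B : set V, measurable (f @^-1` B)) ->
  (\sum_(v <- s) P (f @^-1` [set v]) = 1)%E ->
  P A = (\sum_(v <- s) P (A `&` f @^-1` [set v]))%E.
Proof.
move=> us mA mf s1; pose B := f @^-1` [set v | v \in s].
have mB : measurable B by apply: mf.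
have PB : P B = 1%E.
  rewrite (prob_partition_seq us mB (f := f)) // -s1; apply: eq_big_seq => v vs.
  by congr (P _); apply/seteqP; split => [w []//|w /= fw]; split=> //; rewrite /B /= fw.
have PCB : P (~` B) = 0%E by rewrite probability_setC // PB subee.
rewrite (prob_split mA mB) (_ : P (A `&` ~` B) = 0%E) ?adde0; last first.
  apply/eqP; rewrite eq_le measure_ge0 andbT -PCB.
  by apply: le_measure; rewrite ?inE; [apply: measurableI => //; apply: measurableC|apply: measurableC|move=> w []].
rewrite (prob_partition_seq us _ (f := f)) //; last 2 first.
- exact: measurableI.
- by move=> w [_].
apply: eq_big_seq => v vs; congr (P _); apply/seteqP; split => w /=.
  by move=> [[]].
by move=> [Aw fw]; split => //; split => //; rewrite /B /= fw.
Qed.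

Lemma independent_prefix {V : Type} (Y : nat -> Omega -> V) (B : nat -> set V) n :
  mutually_independent P Y ->
  P [set w | forall k, (k < n)%N -> B k (Y k w)] =
  (\prod_(k < n) P (Y k @^-1` B k))%E.
Proof.
move=> ind; have := ind (seq_fset tt (iota 0 n)) B.
have memJ k : [set` seq_fset tt (iota 0 n)] k <-> (k < n)%N.
  by rewrite -[X in X <-> _]/(is_true (k \in seq_fset tt (iota 0 n))) seq_fsetE mem_iota.
have -> : \bigcap_(k in [set` seq_fset tt (iota 0 n)]) (Y k @^-1` B k) =
    [set w | forall k, (k < n)%N -> B k (Y k w)].
  by apply/seteqP; split => w H k => [/memJ|/memJ]; apply: H.
move=> ->; rewrite (perm_big (iota 0 n)); last first.
  by apply: uniq_perm; rewrite ?seq_fset_uniq ?iota_uniq // => k; rewrite seq_fsetE.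
by rewrite -{1}[n]subn0 -/(index_iota 0 n) big_mkord.
Qed.

End ProbabilityPartitions.

(** * The subordinate walk as a Markov chain *)

Section SubordinateLaw.
Context {R : realType} {disp : measure_display} {Omega : measurableType disp}.
Variable P : probability Omega R.
Context {d : nat}.
Hypothesis d_gt0 : (0 < d)%N.
Local Notation pt := ('rV[int]_d).
Local Notation srw := (@srw R d).
Variables (Z : nat -> Omega -> pt) (S : nat -> Omega -> nat) (c : nat -> R).
Hypothesis walk : simple_random_walk P Z.
Hypothesis S_discrete : discrete_process S.
Hypothesis S_indep : mutually_independent P S.
Hypothesis S_law : forall n k, P [set w | S n w = k] = (c k)%:E.
Hypothesis ZS_indep : independent_processes P Z S.
Hypothesis c_ge0 : forall m, 0 <= c m.
Hypothesis c_sum : (\sum_(m <oo) (c m)%:E = 1)%E.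
Implicit Types (w : Omega) (u v x y z : pt) (t m k n : nat) (L : seq (nat * pt)).

Let incr n w : pt := Z n.+1 w - Z n w.

Lemma step_inj : injective (@step d).
Proof.
move=> [i s] [j t] /rowP E.
have := E i; rewrite /step !mxE !eqxx /= mulr1.
case: (eqVneq i j) => [->|ij]; last first.
  by rewrite mulr0 => /eqP; rewrite signr_eq0.
by rewrite mulr1; case: s {E}; case: t.
Qed.

(** Futures list pairs of a duration and a displacement, because one step of the
subordinate walk consumes one such block of the simple walk. *)
Fixpoint walk_future t L : set Omega :=
  if L is (m, u) :: L' then
    [set w | Z (t + m)%N w - Z t w = u] `&` walk_future (t + m) L'
  else setT.

Definition future_weight L : R := \prod_(q <- L) srw q.1 q.2.
Definition jump_weight_prod L : R := \prod_(q <- L) (c q.1 * srw q.1 q.2).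

Let discrete_diff (M : set (set Omega)) (hM : sigma_algebra setT M) a b :
  (forall k (B : set pt), M (Z k @^-1` B)) ->
  discrete_map M (fun w => Z a w - Z b w).
Proof.
move=> H; apply: (@discrete_comp _ M _ _ (fun w => (Z a w, Z b w)) (fun q => q.1 - q.2)).
by apply: discrete_pair; [|apply: H|apply: H].
Qed.

Lemma walk_future_sigma (M : set (set Omega)) t L : sigma_algebra setT M ->
  (forall k (B : set pt), M (Z k @^-1` B)) -> M (walk_future t L).
Proof.
move=> hM H; elim: L t => [|[m u] L IH] t; first exact: sigmaT.
by apply: sigmaI => //; apply: (discrete_diff hM _ _ H [set u]).
Qed.

Let measurable_sigma : sigma_algebra setT (@measurable _ Omega).
Proof. by split=> [|A mA|A mA]; [|rewrite setTD; apply: measurableC|apply: bigcupT_measurable]. Qed.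

Lemma measurable_walk_future t L : measurable (walk_future t L).
Proof. exact: (walk_future_sigma _ _ measurable_sigma (srw_measurable walk)). Qed.

Lemma incr_discrete n : discrete_map (@measurable _ Omega) (incr n).
Proof. exact: (discrete_diff measurable_sigma _ _ (srw_measurable walk)). Qed.

Lemma incr_law n e : P (incr n @^-1` [set step e]) = ((2 * d%:R)^-1)%:E.
Proof. by rewrite -(srw_law walk n e.1 e.2). Qed.

(** The independence of the increments is available for single steps only;
histories record them one by one until a block of the future is exhausted. *)
Definition history (es : seq ('I_d * bool)) e0 : set Omega :=
  [set w | forall k, (k < size es)%N -> incr k w = step (nth e0 es k)].

Lemma history_prob es e0 : P (history es e0) = ((2 * d%:R)^-1 ^+ size es)%:E.
Proof.
rewrite (independent_prefix (fun k => [set step (nth e0 es k)]) (size es) (srw_indep walk)).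
rewrite (eq_bigr (fun=> ((2 * d%:R)^-1)%:E)) => [|k _]; last exact: incr_law.
by rewrite prodEFin prodr_const card_ord.
Qed.

Lemma measurable_history es e0 : measurable (history es e0).
Proof.
rewrite (_ : history es e0 = \bigcap_(k in [set k | (k < size es)%N]) (incr k @^-1` [set step (nth e0 es k)])) //.
by apply: bigcap_measurableType => k _; apply: incr_discrete.
Qed.

Lemma history_rcons es e e0 :
  history (rcons es e) e0 = history es e0 `&` incr (size es) @^-1` [set step e].
Proof.
apply/seteqP; split => [w H|w [H He] k]; last first.
  rewrite size_rcons ltnS leq_eqVlt => /orP[/eqP ->|ks].
    by rewrite nth_rcons ltnn eqxx.
  by rewrite nth_rcons ks; apply: H.
split => [k ks|].
  by have := H k; rewrite size_rcons nth_rcons ks => -> //; apply: ltnW.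
by rewrite /= (H (size es)) ?size_rcons // nth_rcons ltnn eqxx.
Qed.

Lemma sum_incr_law n :
  (\sum_(u <- [seq step e | e <- enum {: 'I_d * bool}]) P (incr n @^-1` [set u]) = 1)%E.
Proof.
rewrite big_map big_enum /= (eq_bigr (fun=> ((2 * d%:R)^-1)%:E)); last first.
  by move=> e _; apply: incr_law.
rewrite sumEFin; congr _%:E.
rewrite -[RHS](@avg_cst R d d_gt0 1) /avg mulr_sumr.
by apply: eq_bigr => e _; rewrite mulr1.
Qed.

(** Unroll the first block of the future step by step: each step moves from the
future to the history and reproduces the recursion of the kernel. *)
Lemma history_future es e0 L :
  P (history es e0 `&` walk_future (size es) L) =
  ((2 * d%:R)^-1 ^+ size es * future_weight L)%:E.
Proof.
elim: L es => [|[m u] L IHL] es.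
  by rewrite setIT /future_weight big_nil mulr1 history_prob.
elim: m u es => [|m IHm] u es.
  rewrite /= addn0 /future_weight big_cons /= srw0; have [->|u0] := eqVneq u 0.
    rewrite mul1r -IHL; congr (P _); apply/seteqP; split => w.
      by move=> [Hh [_ Hf]].
    by move=> [Hh Hf]; split => //; split => //=; rewrite subrr.
  rewrite mul0r mulr0 (_ : _ `&` _ = set0) ?measure0 //.
  by apply/seteqP; split => // w [_ [/= H _]]; move: u0; rewrite -H subrr eqxx.
have mA : measurable (history es e0 `&` walk_future (size es) ((m.+1, u) :: L)).
  by apply: measurableI; [apply: measurable_history|apply: measurable_walk_future].
have us : uniq [seq step e | e <- enum {: 'I_d * bool}].
  by rewrite map_inj_uniq ?enum_uniq //; apply: step_inj.
rewrite (prob_partition_as us mA (incr_discrete (size es)) (sum_incr_law (size es))).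
rewrite big_map big_enum /=.
rewrite (eq_bigr (fun e => ((2 * d%:R)^-1 ^+ (size es).+1 * (srw m (u - step e) * future_weight L))%:E)).
  rewrite sumEFin; congr _%:E; rewrite /future_weight big_cons /= srwS /avg.
  rewrite exprSr -mulr_sumr -!mulr_suml; ring.
move=> e _; have := IHm (u - step e) (rcons es e).
rewrite size_rcons [future_weight (_ :: _)]big_cons /= => <-; congr (P _).
rewrite history_rcons; apply/seteqP; split => w /=.
  move=> [[Hh [Hu Hf]] He]; split; first by split.
  split; last by rewrite addSnnS.
  by rewrite addSnnS -Hu -He /incr opprB addrA subrK.
move=> [[Hh He] [Hu Hf]]; split => //; split => //; split; last by rewrite -addSnnS.
by rewrite -addSnnS -[u](subrK (step e)) -Hu -He /incr addrA subrK.
Qed.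

Lemma walk_future_prob L : P (walk_future 0 L) = (future_weight L)%:E.
Proof.
have := history_future [::] (Ordinal d_gt0, true) L; rewrite expr0 mul1r => <-.
by congr (P _); apply/seteqP; split => w //= [].
Qed.

Definition time_future n (ms : seq nat) : set Omega :=
  [set w | forall k, (k < size ms)%N -> S (n + k)%N w = nth 0%N ms k].

Definition future n t L := time_future n [seq q.1 | q <- L] `&` walk_future t L.

Lemma time_future_sigma (M : set (set Omega)) n ms : sigma_algebra setT M ->
  (forall k (B : set nat), M (S k @^-1` B)) -> M (time_future n ms).
Proof.
move=> hM H; elim: ms n => [|m ms IH] n.
  by rewrite (_ : time_future n [::] = setT); [apply: sigmaT|apply/seteqP; split].
rewrite (_ : time_future n (m :: ms) = S n @^-1` [set m] `&` time_future n.+1 ms).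
  by apply: sigmaI => //; apply: H.
apply/seteqP; split => w.
  move=> Hw; split; first by have := Hw 0%N; rewrite addn0; apply.
  by move=> k kms; rewrite addSnnS; apply: (Hw k.+1).
by move=> [H0 Hw] [_|k kms] //=; rewrite ?addn0 // -addSnnS; apply: Hw.
Qed.

Lemma measurable_future n t L : measurable (future n t L).
Proof.
apply: measurableI; last exact: measurable_walk_future.
exact: (time_future_sigma _ _ measurable_sigma S_discrete).
Qed.

Lemma time_future_prob ms : P (time_future 0 ms) = (\prod_(m <- ms) c m)%:E.
Proof.
rewrite (independent_prefix (fun k => [set nth 0%N ms k]) (size ms) S_indep).
rewrite (eq_bigr (fun k : 'I_(size ms) => (c (nth 0%N ms k))%:E)) => [|k _]; last exact: S_law.
by rewrite prodEFin; congr _%:E; rewrite [RHS](big_nth 0%N) big_mkord.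
Qed.

Lemma future_prob L : P (future 0 0 L) = (jump_weight_prod L)%:E.
Proof.
have sZ : process_sigma_algebra Z (walk_future 0 L).
  apply: walk_future_sigma; first exact: smallest_sigma_algebra.
  by move=> k B; apply: sub_sigma_algebra; exists k, B.
have sS : process_sigma_algebra S (time_future 0 [seq q.1 | q <- L]).
  apply: time_future_sigma; first exact: smallest_sigma_algebra.
  by move=> k B; apply: sub_sigma_algebra; exists k, B.
rewrite /future setIC (ZS_indep sZ sS) walk_future_prob time_future_prob -EFinM; congr _%:E.
by rewrite big_map /jump_weight_prod big_split /= mulrC.
Qed.

Variables (x : pt) (bs : seq pt).
Hypothesis bs_uniq : uniq bs.
Hypothesis x_bs : x \in bs.
Local Notation X := (subordinate_walk Z S x).
Local Notation T := (random_time S).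

Definition alive n : set Omega :=
  [set w | forall i, (1 <= i <= n)%N -> X i w \in bs].

Lemma random_timeS n w : T n.+1 w = (T n w + S n w)%N.
Proof. by rewrite /random_time big_ord_recr. Qed.

Lemma random_time_discrete n : discrete_map (@measurable _ Omega) (T n).
Proof.
elim: n => [|n IH] B.
  have [B0|B0] := pselect (B 0%N).
    rewrite (_ : T 0 @^-1` B = setT); first exact: measurableT.
    by apply/seteqP; split => // w _ /=; rewrite /random_time big_ord0.
  rewrite (_ : T 0 @^-1` B = set0); first exact: measurable0.
  by apply/seteqP; split => // w /=; rewrite /random_time big_ord0.
have := @discrete_comp _ (@measurable _ Omega) _ _ (fun w => (T n w, S n w)) (fun q => (q.1 + q.2)%N).
move=> /(_ _ B) H; rewrite (_ : T n.+1 = (fun q => (q.1 + q.2)%N) \o (fun w => (T n w, S n w))).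
  by apply: H; apply: discrete_pair => //; apply: S_discrete.
by apply/funext => w; rewrite random_timeS.
Qed.

Lemma walk_discrete n : discrete_map (@measurable _ Omega) (X n).
Proof.
apply: (@discrete_comp _ _ _ _ (fun w => Z (T n w) w) (fun z => x + z)).
apply: discrete_at_random_index => //; first exact: random_time_discrete.
exact: (srw_measurable walk).
Qed.

Lemma measurable_alive n : measurable (alive n).
Proof.
rewrite (_ : alive n = \bigcap_(i in [set i | (1 <= i <= n)%N]) (X i @^-1` [set z | z \in bs])) //.
by apply: bigcap_measurableType => k _; apply: walk_discrete.
Qed.

Lemma walk0 w : X 0 w = x.
Proof. by rewrite /subordinate_walk /random_time big_ord0 (srw_start walk) addr0. Qed.

Lemma alive_in n w : alive n w -> X n w \in bs.
Proof. by case: n => [|n] H; [rewrite walk0|apply: H; rewrite /= leqnn]. Qed.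

Lemma aliveS n w : alive n.+1 w <-> alive n w /\ X n.+1 w \in bs.
Proof.
split=> [H|[H HX] i /andP[i1 iN]].
  split; last by apply: H; rewrite /= leqnn.
  by move=> i /andP[i1 iN]; apply: H; rewrite i1 /= ltnW.
move: iN; rewrite leq_eqVlt => /orP[/eqP -> //|iN].
by apply: H; rewrite i1.
Qed.

Definition state n z t : set Omega :=
  (alive n `&` X n @^-1` [set z]) `&` T n @^-1` [set t].

Lemma measurable_state n z t : measurable (state n z t).
Proof.
apply: measurableI; last exact: random_time_discrete.
by apply: measurableI; [apply: measurable_alive|apply: walk_discrete].
Qed.

(** One step: a jump of the time change by [m] over which the walk moves from
[z] to [z'] reads as one more entry of the future. *)
Lemma state_step n z z' t m L : z' \in bs ->
  (state n.+1 z' (t + m) `&` future n.+1 (t + m) L) `&`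
    (fun w => (T n w, X n w)) @^-1` [set (t, z)] =
  state n z t `&` future n t ((m, z' - z) :: L).
Proof.
move=> z'b.
have futE w : future n t ((m, z' - z) :: L) w <->
    [/\ S n w = m, Z (t + m)%N w - Z t w = z' - z & future n.+1 (t + m) L w].
  split=> [[Hs [Hz Hf]]|[H0 Hz [Hs Hf]]].
    split => //; first by have := Hs 0%N isT; rewrite addn0.
    by split => // k kL; have := Hs k.+1 kL; rewrite -addSnnS.
  by split => // -[_|k kL] //=; rewrite ?addn0 // -addSnnS; apply: Hs.
apply/seteqP; split => w.
  move=> [[[[/aliveS[Ha _] /= HX] HT] Hf] [Tt Xz]]; split; first by split => //; split.
  apply/futE; split => //.
    by move: HT; rewrite /= random_timeS Tt => /addnI.
  rewrite -HX -Xz /subordinate_walk HT Tt opprD addrACA subrr add0r //.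
move=> [[[Ha /= HX] HT] /futE [Hs Hz Hf]].
have HT' : T n.+1 w = (t + m)%N by rewrite random_timeS HT Hs.
have HX' : X n.+1 w = z'.
  move: HX; rewrite /subordinate_walk HT HT' => HX.
  by rewrite -[z'](subrK z) -Hz -HX addrA addrAC subrK addrC.
split; last by rewrite /= HT HX.
by split => //; split => //; split => //=; apply/aliveS; rewrite HX'.
Qed.

(** The future is independent of the present state: a Markov property for the
pair formed by the time change and the walk. *)
Lemma state_future n z t L :
  P (state n z t `&` future n t L) = (P (state n z t) * (jump_weight_prod L)%:E)%E.
Proof.
elim: n z t L => [|n IH] z t L.
  have [zt|nzt] := pselect (z = x /\ t = 0%N).
    have -> : state 0 z t = setT.
      apply/seteqP; split => // w _; case: zt => -> ->; split; last by rewrite /= /random_time big_ord0.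
      by split; [move=> [|i]|rewrite /= walk0].
    by rewrite setTI probability_setT mul1e; case: zt => _ ->; apply: future_prob.
  have -> : state 0 z t = set0.
    apply/seteqP; split => // w [[_ /= Xz] Tt]; apply: nzt; split; first by rewrite -Xz walk0.
    by rewrite -Tt /= /random_time big_ord0.
  by rewrite set0I measure0 mul0e.
have [zb|zb] := boolP (z \in bs); last first.
  have -> : state n.+1 z t = set0.
    apply/seteqP; split => // w [[/alive_in Ha /= Xz] _].
    by move: zb; rewrite -Xz Ha.
  by rewrite set0I measure0 mul0e.
have decomp L' : P (state n.+1 z t `&` future n.+1 t L') =
   (\sum_(q <- [seq (s, v) | s <- iota 0 t.+1, v <- bs])
     P (state n q.2 q.1) * (c (t - q.1) * srw (t - q.1) (z - q.2))%:E * (jump_weight_prod L')%:E)%E.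
  rewrite (@prob_partition_seq _ _ _ P _ _ (fun w => (T n w, X n w)) [seq (s, v) | s <- iota 0 t.+1, v <- bs]).
  - apply: eq_big_seq => -[s v] /allpairsP[[s' v'] [+ vb [-> ->]]].
    rewrite mem_iota ltnS => /= st.
    have := @state_step n v' z s' (t - s') L' zb; rewrite subnKC // => ->.
    by rewrite IH /jump_weight_prod big_cons EFinM muleA.
  - by apply: allpairs_uniq => //; [apply: iota_uniq|move=> [? ?] [? ?] _ _ [-> ->]].
  - by apply: measurableI; [apply: measurable_state|apply: measurable_future].
  - move=> q; apply: (@discrete_pair _ _ measurable_sigma _ _ (T n) (X n)) => //.
      exact: random_time_discrete.
    exact: walk_discrete.
  move=> w [[[Ha _] HT] _]; apply/allpairsP; exists (T n w, X n w); split => //.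
    by rewrite mem_iota ltnS /= -HT random_timeS leq_addr.
  by apply: alive_in; move/aliveS: Ha => [].
rewrite decomp; have := decomp [::].
rewrite (_ : future n.+1 t [::] = setT); last first.
  by apply/seteqP; split => // w _; split.
rewrite setIT => ->; rewrite ge0_sume_distrl; last first.
  move=> q _; rewrite !mule_ge0 // lee_fin ?mulr_ge0 ?srw_ge0 //.
  by rewrite /jump_weight_prod big_nil.
by apply: eq_bigr => q _; rewrite /jump_weight_prod big_nil mule1.
Qed.

Lemma alive_step n y : y \in bs ->
  P (alive n.+1 `&` X n.+1 @^-1` [set y]) =
  (\sum_(z <- bs) P (alive n `&` X n @^-1` [set z]) * (jump_from c z y)%:E)%E.
Proof.
move=> yb.
have mX k v : measurable (X k @^-1` [set v]) by apply: walk_discrete.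
have mT k m : measurable (T k @^-1` [set m]) by apply: random_time_discrete.
have mA k v : measurable (alive k `&` X k @^-1` [set v]).
  by apply: measurableI; [apply: measurable_alive|apply: walk_discrete].
rewrite (@prob_partition_seq _ _ _ P _ _ (X n) bs) //; last first.
  by move=> w [/aliveS[/alive_in]].
apply: eq_big_seq => z zb.
rewrite (@prob_partition_nat _ _ _ P _ (T n)) //; last exact: measurableI.
rewrite (@prob_partition_nat _ _ _ P (alive n `&` X n @^-1` [set z]) (T n)) // muleC -nneseriesZl //.
apply: eq_eseriesr => t _.
rewrite (@prob_partition_nat _ _ _ P _ (S n)); last 2 first.
- by apply: measurableI => //; apply: measurableI.
- by move=> k; apply: S_discrete.
rewrite muleC /jump_from EcE //; last exact: bdd_srw.
rewrite -(fineK (fin_num_measure P _ (measurable_state n z t))) -nneseriesZl; last first.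
  by move=> m _; rewrite lee_fin mulr_ge0 // srw_ge0.
apply: eq_eseriesr => m _.
rewrite fineK ?fin_num_measure //; last exact: measurable_state.
have -> : (c m * srw m (y - z))%:E = (jump_weight_prod [:: (m, y - z)])%:E.
  by rewrite /jump_weight_prod big_seq1.
rewrite -state_future -(@state_step n z y t m [::]) //; congr (P _).
apply/seteqP; split => w.
  move=> [[[[Ha Xy] Xz] Tt] Sm]; split; last by rewrite /= Tt Xz.
  split; last by split.
  by split => //; rewrite /= random_timeS Tt Sm.
move=> [[[[Ha Xy] TS] _] [Tt Xz]]; split; first by split.
by move: TS; rewrite /= random_timeS Tt => /addnI.
Qed.

(** The time change and the walk together are Markov; summing over the time
reached and over the next jump leaves a chain on the lattice. *)
Theorem alive_prob n y : y \in bs ->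
  P (alive n `&` X n @^-1` [set y]) = (kpow bs (jump_from c) n x y)%:E.
Proof.
elim: n y => [|n IH] y yb.
  have [xy|xy] := eqVneq x y.
    rewrite /= -xy eqxx (_ : _ `&` _ = setT) ?probability_setT //.
    by apply/seteqP; split => // w _; split; [move=> [|i]|rewrite /= walk0].
  rewrite /= (negbTE xy) (_ : _ `&` _ = set0) ?measure0 //.
  by apply/seteqP; split => // w [_ /=]; rewrite walk0 => xy'; move: xy; rewrite xy' eqxx.
rewrite alive_step // -sumEFin; apply: eq_big_seq => z zb.
by rewrite IH // EFinM.
Qed.

End SubordinateLaw.

(** * Exit times and occupation times as sums of kernel powers *)

Section ExitTime.
Context {R : realType} {disp : measure_display} {Omega : measurableType disp}.
Variable P : probability Omega R.
Context {d : nat}.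
Hypothesis d_gt0 : (0 < d)%N.
Local Notation pt := ('rV[int]_d).
Variables (Z : nat -> Omega -> pt) (S : nat -> Omega -> nat) (c : nat -> R).
Hypothesis walk : simple_random_walk P Z.
Hypothesis S_discrete : discrete_process S.
Hypothesis S_indep : mutually_independent P S.
Hypothesis S_law : forall n k, P [set w | S n w = k] = (c k)%:E.
Hypothesis ZS_indep : independent_processes P Z S.
Hypothesis c_ge0 : forall m, 0 <= c m.
Hypothesis c_sum : (\sum_(m <oo) (c m)%:E = 1)%E.
Variables (bs : seq pt) (B : set pt) (del : R).
Hypothesis bs_uniq : uniq bs.
Hypothesis B_bs : forall z, B z <-> z \in bs.
Hypothesis del01 : 0 < del <= 1.
Hypothesis row_gap : forall z, \sum_(w <- bs) jump_from c z w <= 1 - del.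
Implicit Types (w : Omega) (x y z : pt) (n k : nat).

Let K0 z z' : 0 <= jump_from c z z' := jump_from_ge0 d_gt0 c_ge0 c_sum z z'.

Lemma lt_exit_time x n w :
  (n%:R%:E < exit_time (subordinate_walk Z S x) B w :> \bar R)%E = `[< alive Z S x bs n w >].
Proof.
apply/idP/asboolP => [nw i /andP[i1 iN]|al].
  apply: contrapT => ni; move: nw; rewrite ltNge => /negP; apply.
  apply: (@le_trans _ _ i%:R%:E); last by rewrite lee_fin ler_nat.
  by apply: ereal_inf_lbound; exists i => //; split => // /B_bs.
apply: (@lt_le_trans _ _ n.+1%:R%:E); first by rewrite lte_fin ltr_nat.
apply: le_ereal_inf_tmp => _ [i [i1 iB] <-]; rewrite lee_fin ler_nat ltnNge.
by apply/negP => iN; apply/iB/B_bs/al; rewrite i1.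
Qed.

Lemma alive_decr x n k w : (k <= n)%N -> alive Z S x bs n w -> alive Z S x bs k w.
Proof. by move=> kn H i /andP[i1 ik]; apply: H; rewrite i1 (leq_trans ik). Qed.

(** The exit time counts the times [n] before it; a walk that never leaves makes
both sides infinite. *)
Lemma exit_time_series x w : exit_time (subordinate_walk Z S x) B w =
  (\sum_(n <oo) (\1_(alive Z S x bs n) w)%:E)%E :> \bar R.
Proof.
have ind n : \1_(alive Z S x bs n) w = (n%:R%:E < exit_time (subordinate_walk Z S x) B w :> \bar R)%E%:R :> R.
  by rewrite lt_exit_time indicE; congr (nat_of_bool _)%:R; apply/idP/asboolP; rewrite inE.
have u0 n : (0 <= (\1_(alive Z S x bs n) w)%:E :> \bar R)%E by rewrite lee_fin ind ler0n.
have [al|/existsNP[N0 nal]] := pselect (forall n, alive Z S x bs n w).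
  have E n : (n%:R%:E <= exit_time (subordinate_walk Z S x) B w :> \bar R)%E.
    by apply/ltW; rewrite lt_exit_time; apply/asboolP.
  have U n : (n%:R%:E <= \sum_(n <oo) (\1_(alive Z S x bs n) w)%:E :> \bar R)%E.
    apply: le_trans (nneseries_lim_ge n _) => //.
    rewrite (eq_bigr (fun=> 1%E)) => [|k _]; last by rewrite indicE mem_set.
    by rewrite sumEFin lee_fin sumr_const_nat subn0.
  have top (a : \bar R) : (forall n, (n%:R%:E <= a)%E) -> a = +oo%E.
    move=> H; apply/eqP; rewrite eq_le leey /=; case: a H => [r|//|] H.
      have := H (Num.truncn r).+1; rewrite lee_fin leNgt truncnS_gt //.
    by have := H 0%N.
  by rewrite (top _ E) (top _ U).
have ex : exists n, `[< ~ alive Z S x bs n w >] by exists N0; apply/asboolP.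
have [N /asboolP nalN minN] := ex_minnP ex.
have N1 : (0 < N)%N.
  by case: N nalN {minN} => // nal0; case: nal0 => -[|].
have alE n : alive Z S x bs n w <-> (n < N)%N.
  split=> [al|nN].
    by rewrite ltnNge; apply/negP => Nn; apply: nalN; apply: alive_decr al.
  by apply: contrapT => na; have := minN n (asboolT na); rewrite leqNgt nN.
have -> : exit_time (subordinate_walk Z S x) B w = N%:R%:E :> \bar R.
  apply/eqP; rewrite eq_le; apply/andP; split.
    rewrite leNgt; apply/negP; rewrite lt_exit_time => /asboolP/alE.
    by rewrite ltnn.
  case: N N1 alE {nalN minN} => // N _ alE.
  apply: le_ereal_inf_tmp => _ [i [i1 iB] <-]; rewrite lee_fin ler_nat ltnNge.
  apply/negP => iN; apply/iB/B_bs; have /alE al : (N < N.+1)%N by [].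
  by apply: al; rewrite i1.
rewrite (nneseries_split 0 N) // [X in (_ + X)%E]eseries0 ?adde0; last first.
  move=> i Ni _; rewrite indicE memNset // => /alE; rewrite ltnNge.
  by move: Ni; rewrite add0n => ->.
rewrite add0n big_mkord (eq_bigr (fun=> 1%E)) => [|k _].
  by rewrite sumEFin sumr_const card_ord.
by rewrite indicE mem_set //; apply/alE.
Qed.

Lemma measurable_indic_EFin (A : set Omega) : measurable A ->
  measurable_fun setT (fun w => (\1_A w)%:E : \bar R).
Proof. by move=> mA; apply/measurable_EFinP; apply: measurable_indic. Qed.

Lemma expected_exit_timeE y : y \in bs ->
  expected_exit_time P (subordinate_walk Z S y) B =
  (potential bs (jump_from c) (fun=> 1) y)%:E.
Proof.
move=> yb; rewrite /expected_exit_time.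
have mA n : measurable (alive Z S y bs n) by exact: (measurable_alive walk S_discrete).
rewrite (eq_integral (fun w => \sum_(n <oo) (\1_(alive Z S y bs n) w)%:E)%E); last first.
  by move=> w _; apply: exit_time_series.
rewrite integral_nneseries; first last.
- by move=> n w _; rewrite lee_fin indicE ler0n.
- by move=> n; apply: measurable_indic_EFin.
- exact: measurableT.
transitivity (\sum_(n <oo) \sum_(z <- bs) (kpow bs (jump_from c) n y z)%:E)%E.
  apply: eq_eseriesr => n _; rewrite integral_indic // setIT.
  have part := prob_partition_seq P bs_uniq (mA n)
    (fun z => walk_discrete walk S_discrete y n [set z]) (fun w => @alive_in _ _ _ _ _ _ _ walk _ _ yb n w).
  apply: etrans part _; apply: eq_big_seq => z zb.
  exact: (alive_prob d_gt0 walk S_discrete S_indep S_law ZS_indep c_ge0 c_sum bs_uniq yb n zb).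
rewrite nneseries_sum; last by move=> z n _; rewrite lee_fin kpow_ge0.
rewrite /potential -sumEFin; apply: eq_big_seq => z zb.
by rewrite mulr1 (greenE bs_uniq K0 del01 row_gap).
Qed.

Lemma green_functionE x y : x \in bs -> y \in bs ->
  green_function P Z S B x y = (green bs (jump_from c) x y)%:E.
Proof.
move=> xb yb; rewrite /green_function /occupation_before_exit.
pose A n : set Omega := alive Z S x bs n `&` subordinate_walk Z S x n @^-1` [set y].
have mA n : measurable (A n).
  by apply: measurableI; [exact: (measurable_alive walk S_discrete)|apply: (walk_discrete walk S_discrete)].
transitivity (\int[P]_w \sum_(n <oo) (\1_(A n) w)%:E)%E.
  apply: eq_integral => w _; rewrite eseries_mkcond; apply: eq_eseriesr => n _.
  rewrite lt_exit_time indicE /A in_setI; case: asboolP => al.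
    rewrite mem_set //=; congr (nat_of_bool _)%:R%:E.
    by apply/eqP/idP; rewrite inE.
  by rewrite memNset.
rewrite integral_nneseries; first last.
- by move=> n w _; rewrite lee_fin indicE ler0n.
- by move=> n; apply: measurable_indic_EFin.
- exact: measurableT.
rewrite (greenE bs_uniq K0 del01 row_gap) //; apply: eq_eseriesr => n _; rewrite integral_indic // setIT.
exact: (alive_prob d_gt0 walk S_discrete S_indep S_law ZS_indep c_ge0 c_sum bs_uniq xb n yb).
Qed.

End ExitTime.

(** * Euclidean balls *)

Section LatticeBall.
Context {R : realType} {d : nat}.
Local Notation pt := ('rV[int]_d).

Lemma euclidean_norm_lt (z : pt) (r : R) : 0 < r ->
  (euclidean_norm z < r) = (nsq z < r ^+ 2).
Proof.
move=> r0; rewrite /euclidean_norm -{1}(ger0_norm (ltW r0)) -sqrtr_sqr.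
by rewrite ltr_sqrt // exprn_gt0.
Qed.

Lemma euclidean_norm_ge (z : pt) (r : R) : 0 < r ->
  (r <= euclidean_norm z) = (r ^+ 2 <= nsq z).
Proof. by move=> r0; rewrite !leNgt euclidean_norm_lt. Qed.

End LatticeBall.

(** * The comparison for the subordinate random walk *)

Theorem corollary5p8 (R : realType) (d : nat) (hd : (1 <= d)%N)
  (phi : R -> R) (mu : {measure set (measurableTypeR R) -> \bar R})
  (hphi : complete_bernstein phi mu) (hphi1 : phi 1 = 1)
  (disp : measure_display) (Omega : measurableType disp)
  (P : probability Omega R)
  (Z : nat -> Omega -> 'rV[int]_d) (S : nat -> Omega -> nat)
  (hZ : simple_random_walk P Z) (hS : time_jumps P mu S)
  (hZS : independent_processes P Z S)
  (gamma1 gamma2 a1 a2 : R)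
  (hgamma1 : 0 < gamma1) (hgamma12 : gamma1 <= gamma2) (hgamma2 : gamma2 < 1)
  (hgamma2d : gamma2 < d%:R / 2) (ha1 : 0 < a1) (ha2 : 0 < a2)
  (hscaling : forall r s : R, 0 < r -> r <= s -> s <= 1 ->
     a1 * (s / r) `^ gamma1 <= phi s / phi r /\
     phi s / phi r <= a2 * (s / r) `^ gamma2) :
  exists C6 C7 b1 b2 : R,
    [/\ 0 < C6, 0 < C7, 0 < b1 < 1 / 2, 0 < b2 < 1 / 2 & 2 * b1 <= b2] /\
    forall n : nat, (1 <= n)%N ->
    forall x y : 'rV[int]_d,
      lattice_ball (b1 * n%:R) x ->
      lattice_annulus (b2 * n%:R) n%:R y ->
      let B : set 'rV[int]_d := lattice_ball (n%:R : R) in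
      let Etau : \bar R := expected_exit_time P (subordinate_walk Z S y) B in
      ((C6 * n%:R ^- d)%:E * Etau <= green_function P Z S B x y)%E /\
      (green_function P Z S B x y <= (C7 * n%:R ^- d)%:E * Etau)%E.
Proof.
have [mpos [msum mlap]] : [/\ (forall m, positive_weight mu m \is a fin_num),
    (\sum_(m <oo) positive_weight mu m = 1)%E &
    forall l : R, 0 < l <= 1 ->
    (\sum_(m <oo) (positive_weight mu m * (1 - (1 - l) ^+ m)%:E) = (phi l)%:E)%E].
  split; [by move=> m; apply: (positive_weight_fin hphi)|exact: (positive_weight_sum hphi)|].
  exact: (jump_weight_laplace hphi).
pose c m : R := fine (positive_weight mu m).
have cE m : (c m)%:E = positive_weight mu m by rewrite fineK.
have c_ge0 m : 0 <= c m by apply/fine_ge0/positive_weight_ge0.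
have c_sum : (\sum_(m <oo) (c m)%:E = 1)%E.
  by rewrite -[RHS]msum; apply: eq_eseriesr => m _.
have c_lap (l : R) : 0 < l <= 1 ->
    (\sum_(m <oo) (c m * (1 - (1 - l) ^+ m))%:E = (phi l)%:E)%E.
  by move=> l01; rewrite -(mlap l l01); apply: eq_eseriesr => m _; rewrite EFinM cE.
have c1 : 0 < c 1 by rewrite -lte_fin cE; apply: (jump_weight1_gt0 hphi).
have mS k n : measurable [set w | S k w = n] by apply: (tj_measurable hS k [set n]).
have S_law n k : P [set w | S n w = k] = (c k)%:E.
  case: k => [|k]; last by rewrite (tj_law hS) // cE.
  (* The weights of the positive integers already have total mass one. *)
  have := @prob_partition_nat _ _ _ P setT (S n) measurableT (mS n).
  rewrite probability_setT nneseries_recl //.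
  have -> : (\sum_(1 <= k <oo) P ([set: Omega] `&` S n @^-1` [set k]) = 1)%E.
    have w0 k : (0 <= positive_weight mu k)%E by apply: positive_weight_ge0.
    have := @nneseries_recl R xpredT _ (fun k _ => w0 k) isT.
    rewrite msum [positive_weight mu 0]/= add0e => ->.
    rewrite -(nneseries_addn 1%N w0) -(@nneseries_addn _ (fun k => P ([set: Omega] `&` S n @^-1` [set k])) 1) //.
    by apply: eq_eseriesr => k _; rewrite addn1 setTI (tj_law hS).
  rewrite setTI [c 0]/c /= => H.
  have fin : P (S n @^-1` [set 0%N]) \is a fin_num by apply: fin_num_measure; apply: mS.
  move: H; rewrite -[P _ in X in X -> _](fineK fin) -EFinD => -[] H.
  by rewrite -[LHS](fineK fin); congr _%:E; lra.
have [C6 [C7 [C60 C70 main]]] := ball_green_comparison hd c_ge0 c1 c_sum c_lap hphi1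
  hgamma1 hgamma2 hgamma2d ha1 ha2 hscaling.
(* The squares of these radii are the [1 / 100] and [16 / 100] of
   [ball_green_comparison]. *)
exists C6, C7, (1 / 10), (2 / 5); split; first by split=> //; lra.
move=> n n1 x y xn /andP[yl yu] B Etau.
have nR : (0 : R) < n%:R by rewrite ltr0n.
have nn0 : (0 : R) < n%:R ^+ 2 by rewrite exprn_gt0.
have {}xn : @nsq R d x < 1 / 100 * n%:R ^+ 2.
  move: xn; rewrite /lattice_ball /= euclidean_norm_lt; last by clear -nR; lra.
  by rewrite exprMn; lra.
have {}yl : 16 / 100 * n%:R ^+ 2 <= @nsq R d y.
  move: yl; rewrite euclidean_norm_ge; last by clear -nR; lra.
  by rewrite exprMn; lra.
have yb : y \in @ball R d n by rewrite mem_ball -euclidean_norm_lt.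
have xb : x \in @ball R d n by rewrite mem_ball; apply: lt_trans xn _; lra.
have Bb z : B z <-> z \in @ball R d n by rewrite mem_ball -euclidean_norm_lt.
have [del del01 [row]] := main n n1.
move=> /(_ x y xn yl yb) [lower upper].
have EE := expected_exit_timeE hd hZ (tj_measurable hS) (tj_indep hS) S_law hZS c_ge0 c_sum
  (ball_uniq n) Bb del01 row yb.
have GE := green_functionE hd hZ (tj_measurable hS) (tj_indep hS) S_law hZS c_ge0 c_sum
  (ball_uniq n) Bb del01 row xb yb.
by rewrite /Etau EE GE -!EFinM !lee_fin.
Qed.
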